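(* Let $n\ge 1$ and let $\lambda,\mu,\nu$ be weakly decreasing sequences of $n$ integers. Then the following are equivalent: (1) there exist $n\times n$ Hermitian matrices $H_\lambda,H_\mu,H_\nu$ with spectra (eigenvalues listed with multiplicity) $\lambda,\mu,\nu$ respectively such that $H_\lambda+H_\mu=H_\nu$; (2) the irreducible representation $V_\nu$ of $U(n)$ appears at least once in the decomposition of $V_\lambda\otimes V_\mu$ into irreducible representations.
   Context: For a weakly decreasing sequence $\lambda=(\lambda_1\ge\dots\ge\lambda_n)$ of integers, $V_\lambda$ denotes the irreducible unitary representation of the unitary group $U(n)$ with highest weight $\lambda$. For example, for $\lambda$ consisting of $k$ ones followed by $n-k$ zeros, $V_\lambda=\bigwedge^k\mathbb C^n$ with the standard action. *)

(* Defs.v *)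
From mathcomp Require Import all_boot all_order all_algebra.
From mathcomp Require Import spectral sesquilinear complex.
From mathcomp Require Import mxtens.
From mathcomp Require Import all_classical all_reals all_analysis.
Import numFieldNormedType.Exports.

Set Implicit Arguments.
Unset Strict Implicit.
Unset Printing Implicit Defensive.

Import Order.TTheory GRing.Theory Num.Theory.
Local Open Scope classical_set_scope.
Local Open Scope ring_scope.

(* The multiset of eigenvalues is read off the characteristic polynomial, so
   that multiplicities are taken into account. *)
Definition has_spectrum (C : numClosedFieldType) (n : nat) (H : 'M[C]_n)
    (lam : n.-tuple int) : Prop :=
  char_poly H = \prod_(i < n) ('X - ((tnth lam i)%:~R)%:P).

(* A finite-dimensional unitary representation of U(n), written in an
   orthonormal basis of the representation space: a continuous homomorphism
   U(n) -> U(d), with U(n) acting on column vectors.  As rho is a total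
   function on matrices, only its values on unitary matrices are meaningful,
   and every notion below only looks at those. *)
Definition unitary_rep (C : numClosedFieldType) (n d : nat)
    (rho : 'M[C]_n -> 'M[C]_d) : Prop :=
  [/\ forall g, g \is unitarymx -> rho g \is unitarymx,
      rho 1%:M = 1%:M,
      forall g h, g \is unitarymx -> h \is unitarymx ->
        rho (g *m h) = rho g *m rho h
    & {within [set g : 'M[C]_n | g \is unitarymx], continuous rho}].

Definition invariant_subspace (C : numClosedFieldType) (n d : nat)
    (rho : 'M[C]_n -> 'M[C]_d) (W : {vspace 'cV[C]_d}) : Prop :=
  forall g v, g \is unitarymx -> v \in W -> rho g *m v \in W.

Definition irreducible_subspace (C : numClosedFieldType) (n d : nat)
    (rho : 'M[C]_n -> 'M[C]_d) (W : {vspace 'cV[C]_d}) : Prop :=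
  [/\ W <> 0%VS, invariant_subspace rho W
    & forall W' : {vspace 'cV[C]_d}, invariant_subspace rho W' ->
        (W' <= W)%VS -> W' = 0%VS \/ W' = W].

Definition irreducible_rep (C : numClosedFieldType) (n d : nat)
    (rho : 'M[C]_n -> 'M[C]_d) : Prop :=
  irreducible_subspace rho fullv.

(* kap is a weight for the maximal torus of diagonal unitary matrices: some
   nonzero v satisfies diag(t_1, ..., t_n) v = t_1^kap_1 ... t_n^kap_n v. *)
Definition is_weight (C : numClosedFieldType) (n d : nat)
    (rho : 'M[C]_n -> 'M[C]_d) (kap : n.-tuple int) : Prop :=
  exists2 v : 'cV[C]_d, v != 0 &
    forall t : 'rV[C]_n, (forall i, `|t 0 i| = 1) ->
      rho (diag_mx t) *m v = (\prod_(i < n) t 0 i ^ tnth kap i) *: v.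

(* kap is lower than lam: lam - kap is a combination, with coefficients in nat,
   of the positive roots e_i - e_j (i < j). *)
Definition weight_le (n : nat) (kap lam : n.-tuple int) : Prop :=
  exists c : 'I_n -> 'I_n -> nat, forall k : 'I_n,
    tnth lam k - tnth kap k =
      \sum_(i < n) \sum_(j < n | (i < j)%N)
        (c i j)%:Z * ((k == i)%:Z - (k == j)%:Z).

Definition highest_weight (C : numClosedFieldType) (n d : nat)
    (rho : 'M[C]_n -> 'M[C]_d) (lam : n.-tuple int) : Prop :=
  is_weight rho lam /\ forall kap, is_weight rho kap -> weight_le kap lam.

(* rho is (a model of) V_lam; such a rho is unique up to isomorphism. *)
Definition is_irrep (C : numClosedFieldType) (n d : nat)
    (lam : n.-tuple int) (rho : 'M[C]_n -> 'M[C]_d) : Prop :=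
  [/\ unitary_rep rho, irreducible_rep rho & highest_weight rho lam].

Definition tensor_rep (C : numClosedFieldType) (n d1 d2 : nat)
    (rho1 : 'M[C]_n -> 'M[C]_d1) (rho2 : 'M[C]_n -> 'M[C]_d2) :
    'M[C]_n -> 'M[C]_(d1 * d2) :=
  fun g => tensmx (rho1 g) (rho2 g).

Definition subspace_iso (C : numClosedFieldType) (n d e : nat)
    (sigma : 'M[C]_n -> 'M[C]_e) (rho : 'M[C]_n -> 'M[C]_d)
    (W : {vspace 'cV[C]_d}) : Prop :=
  exists f : 'Hom('cV[C]_e, 'cV[C]_d),
    [/\ lker f = 0%VS, limg f = W
      & forall g v, g \is unitarymx -> f (sigma g *m v) = rho g *m f v].

(* W_0, ..., W_(k-1) is a decomposition of rho into irreducibles. *)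
Definition irreducible_decomposition (C : numClosedFieldType) (n d k : nat)
    (rho : 'M[C]_n -> 'M[C]_d) (W : 'I_k -> {vspace 'cV[C]_d}) : Prop :=
  [/\ forall i, irreducible_subspace rho (W i),
      directv (\sum_(i < k) W i)%VS
    & (\sum_(i < k) W i)%VS = fullv].

Definition appears_in (C : numClosedFieldType) (n d e : nat)
    (sigma : 'M[C]_n -> 'M[C]_e) (rho : 'M[C]_n -> 'M[C]_d) : Prop :=
  exists (k : nat) (W : 'I_k -> {vspace 'cV[C]_d}),
    irreducible_decomposition rho W /\ exists i, subspace_iso sigma rho (W i).

(* Main.v *)
From HB Require Import structures.
Require Import Defs.
From mathcomp Require Import all_boot all_order all_algebra perm fingroup.
From mathcomp Require Import spectral sesquilinear mxtens boolp ring lra zify.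

Set Implicit Arguments.
Unset Strict Implicit.
Unset Printing Implicit Defensive.

Import Order.TTheory GRing.Theory Num.Theory.
Local Open Scope ring_scope.

(** From (2) to (1) the argument is variational. Let [z] be the image in V_lam ⊗ V_mu of a highest
    weight vector of V_nu, let [v1], [v2] be highest weight vectors of the two factors, and choose
    unitary [g1], [g2] maximizing the modulus of the inner product of [z] with x = g1 v1 ⊗ g2 v2
    ([orbit_modulus_max]). The maximum is nonzero because the orbit of a nonzero vector spans an
    irreducible representation. Criticality makes the functionals X -> <z, (X ⊗ 1) x> / <z, x> and X
    -> <z, (1 ⊗ X) x> / <z, x> Hermitian on gl_n ([maximal_modulus_real]). Since [v1] and [v2] are
    highest weight vectors, these functionals are X -> tr (H X) with H the conjugate of diag(lam) by
    [g1], resp. of diag(mu) by [g2]. Read on the side of [z], their sum is X -> tr (diag(nu) X),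
    whence the equality of matrices ([critical_sum]).

    From (1) to (2), scalar shifts turn H_lam + H_mu - H_nu = 0 into three Hermitian matrices with
    spectra in nat and sum r Id. For each of them the spans [F y] of the eigenvectors with
    eigenvalue above a level l form a chain, and all the orthogonal projections on these subspaces
    add up to r Id. Taking traces, the dimensions of the [F y] add up to n r, and the dimensions of
    the intersections of the [F y] with a subspace H add up to at most r dim H, with a small error
    if each chain is moved a little. By [destabilizing_subspace], this semistability forces the
    existence of moves of the chains and of vectors m_y in C^r for which the subspaces F_y ⊗ m_y are
    independent; counting dimensions, they then fill C^n ⊗ C^r ([hermitian_sum_full_rank]).

    Independence means that an (n r) x (n r) determinant does not vanish. As a multilinear function
    of n r vectors of C^n it is a functional on a tensor power, semi-invariant under gl_n, and the
    tensor at which it is evaluated lies in the module over three copies of gl_n generated by a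
    product of column antisymmetrized tensors, whose highest weights are exactly the three shifted
    spectra ([tensor_highest_weight_model]). No multiple of the weights is taken, so saturation is
    part of the argument. A highest weight morphism from V_lam ⊗ V_mu ⊗ V_nu^* to this module pulls
    the functional back to a nonzero invariant one ([horn_functional]), that is, to a nonzero
    intertwiner from V_nu to V_lam ⊗ V_mu ([horn_intertwiner]). Schur's lemma and complete
    reducibility conclude.

    Representations are handled through their restrictions to the circle subgroups fixing a
    hyperplane ([circle_diagonal]). The derivative [diff_rep] is defined from the integral
    generators of these circles, and highest weight modules are compared through the inner products
    of words in the generators ([highest_weight_relations]). *)

(** * Generic values of a parameter, and ranks of matrix pencils *)

Definition generically (K : numFieldType) (P : K -> Prop) : Prop :=
  exists2 p : {poly K}, p != 0 & forall t, p.[t] != 0 -> P t.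

Lemma generically_and (K : numFieldType) (P Q : K -> Prop) :
  generically P -> generically Q -> generically (fun t => P t /\ Q t).
Proof.
move=> [p p0 hp] [q q0 hq]; exists (p * q); first by rewrite mulf_neq0.
by move=> t; rewrite hornerM mulf_eq0 negb_or => /andP[/hp ? /hq ?].
Qed.

Lemma generically_near (K : numFieldType) (P : K -> Prop) (e : K) :
  generically P -> 0 < e -> exists2 t, P t & `|t| < e.
Proof.
move=> [p p0 hp] e0.
(* These are [size p] distinct points of modulus below [e], too many to be all roots of [p]. *)
pose s := [seq e / (k.+2)%:R | k <- iota 0 (size p)].
have us : uniq s.
  rewrite map_inj_uniq ?iota_uniq // => i j /(mulfI (lt0r_neq0 e0)) /invr_inj.
  by move/eqP; rewrite eqr_nat => /eqP [].
have [/allP hs|] := boolP (all (root p) s).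
  have := max_poly_roots p0 (introT allP hs) us.
  by rewrite size_map size_iota ltnn.
move=> /allPn[t /mapP[k _ ->]] /hp h; exists (e / k.+2%:R) => //.
rewrite ger0_norm ?divr_ge0 ?ler0n ?ltW // ltr_pdivrMr ?ltr0n //.
by rewrite ltr_pMr // ltr1n.
Qed.

Lemma generically_ex (K : numFieldType) (P : K -> Prop) :
  generically P -> exists t, P t.
Proof. by move=> h; have [t Pt _] := generically_near h ltr01; exists t. Qed.

Lemma generically_imp (K : numFieldType) (P Q : K -> Prop) :
  (forall t, P t -> Q t) -> generically P -> generically Q.
Proof. by move=> h [p p0 hp]; exists p => // t /hp /h. Qed.

Lemma generically_forall (K : numFieldType) (I : finType) (P : I -> K -> Prop) :
  (forall i, generically (P i)) -> generically (fun t => forall i, P i t).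
Proof.
move=> h; suff: generically (fun t => forall i, i \in enum I -> P i t).
  by apply: generically_imp => t ht i; apply: ht; rewrite mem_enum.
elim: (enum I) => [|i s IH]; first by exists 1; rewrite ?oner_eq0.
apply: generically_imp (generically_and (h i) IH) => t [h1 h2] j.
by rewrite inE => /predU1P[->|/h2].
Qed.

Definition eval_mx (K : numFieldType) m n (Z : 'M[{poly K}]_(m, n)) (t : K) :
  'M[K]_(m, n) := map_mx (horner_eval t) Z.

Definition polyC_mx (K : numFieldType) m n (Z : 'M[K]_(m, n)) :
  'M[{poly K}]_(m, n) := map_mx polyC Z.

Definition line_mx (K : numFieldType) m n (A B : 'M[K]_(m, n)) :
  'M[{poly K}]_(m, n) := polyC_mx A + 'X *: polyC_mx B.

Section Eval.
Variables (K : numFieldType) (t : K).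

Lemma eval_polyC_mx m n (Z : 'M[K]_(m, n)) : eval_mx (polyC_mx Z) t = Z.
Proof. by apply/matrixP => i j; rewrite !mxE /horner_eval hornerC. Qed.

Lemma eval_line_mx m n (A B : 'M[K]_(m, n)) : eval_mx (line_mx A B) t = A + t *: B.
Proof. by apply/matrixP => i j; rewrite !mxE /horner_eval !hornerE. Qed.

Lemma eval_mulmx m n p (A : 'M[{poly K}]_(m, n)) (B : 'M_(n, p)) :
  eval_mx (A *m B) t = eval_mx A t *m eval_mx B t.
Proof. exact: map_mxM. Qed.

Lemma eval_scalemx m n p (A : 'M[{poly K}]_(m, n)) :
  eval_mx (p *: A) t = p.[t] *: eval_mx A t.
Proof. exact: map_mxZ. Qed.

Lemma eval_subrmx m n (A B : 'M[{poly K}]_(m, n)) :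
  eval_mx (A - B) t = eval_mx A t - eval_mx B t.
Proof. exact: map_mxB. Qed.

Lemma eval_det n (A : 'M[{poly K}]_n) : (\det A).[t] = \det (eval_mx A t).
Proof. exact/esym/(det_map_mx (horner_eval t) A). Qed.

Lemma eval_adj n (A : 'M[{poly K}]_n) : eval_mx (\adj A) t = \adj (eval_mx A t).
Proof. exact: (map_mx_adj (horner_eval t) A). Qed.

End Eval.

(** A substitute for choosing an invertible submatrix of maximal size: [\det (P *m Z *m Q)] is then
    a polynomial whose nonvanishing bounds the rank of [Z] from below. *)
Lemma mxrank_minor (K : fieldType) m n (A : 'M[K]_(m, n)) :
  exists (P : 'M[K]_(\rank A, m)) (Q : 'M[K]_(n, \rank A)), P *m A *m Q = 1%:M.
Proof.
have /row_fullP[P hP] := col_base_full A.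
have /row_freeP[Q hQ] := row_base_free A.
exists P, Q; have -> : P *m A = P *m (col_base A *m row_base A) by rewrite mulmx_base.
by rewrite mulmxA [X in X *m _ *m _]hP mul1mx [LHS]hQ.
Qed.

Lemma mxrank_ge_minor (K : fieldType) m n r (A : 'M[K]_(m, n))
    (P : 'M[K]_(r, m)) (Q : 'M[K]_(n, r)) :
  \det (P *m A *m Q) != 0 -> (r <= \rank A)%N.
Proof.
rewrite -unitfE -unitmxE -row_full_unit => /eqP <-.
exact: leq_trans (mxrankM_maxl _ _) (mxrankM_maxr _ _).
Qed.

(** Semicontinuity of the rank: a minor that is 1 at [t0] is a nonzero polynomial. *)
Lemma generically_rank (K : numFieldType) m n (Z : 'M[{poly K}]_(m, n)) (t0 : K) :
  generically (fun t => \rank (eval_mx Z t0) <= \rank (eval_mx Z t))%N.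
Proof.
have [P [Q PQ]] := mxrank_minor (eval_mx Z t0).
exists (\det (polyC_mx P *m Z *m polyC_mx Q)).
  apply/eqP => /(congr1 (fun p => p.[t0])); rewrite eval_det !eval_mulmx.
  by rewrite !eval_polyC_mx PQ det1 hornerC => /eqP; rewrite oner_eq0.
by move=> t; rewrite eval_det !eval_mulmx !eval_polyC_mx; apply: mxrank_ge_minor.
Qed.

Lemma generically_rank_line (K : numFieldType) m n (A B : 'M[K]_(m, n)) (t0 : K) :
  generically (fun t => \rank (A + t0 *: B)%R <= \rank (A + t *: B)%R)%N.
Proof.
apply: generically_imp (generically_rank (line_mx A B) t0) => t.
by rewrite !eval_line_mx.
Qed.

(* The (r+1)-minor bordering an invertible r-minor of A, to first order in t. *)
Lemma max_rank_first_order (K : numFieldType) m n (A B : 'M[K]_(m, n))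
    (u : 'rV[K]_m) (w : 'cV[K]_n) :
  (forall t, \rank (A + t *: B)%R <= \rank A)%N ->
  u *m A = 0 -> A *m w = 0 -> u *m B *m w = 0.
Proof.
move=> hr uA Aw; have [P [Q PQ]] := mxrank_minor A; move: (\rank A) P Q PQ hr => r P Q PQ hr.
(* This is the bordered minor of [A + t *: B] with its last row divided by [t]. For nonzero [t] the
   rank bound makes it singular, hence also at 0, where its determinant is [u *m B *m w]. *)
pose Z : 'M[{poly K}]_(r + 1) := block_mx
   (1%:M + 'X *: polyC_mx (P *m B *m Q)) ('X *: polyC_mx (P *m B *m w))
   (polyC_mx (u *m B *m Q)) (polyC_mx (u *m B *m w)).
have Zt t : eval_mx Z t = block_mx (1%:M + t *: (P *m B *m Q)) (t *: (P *m B *m w))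
    (u *m B *m Q) (u *m B *m w).
  rewrite /eval_mx map_block_mx; congr block_mx; apply/matrixP => i j;
    rewrite !mxE /horner_eval ?hornerE ?hornerC //.
  by case: (i == j); rewrite ?hornerE.

have detZ0 : (\det Z).[0] = (u *m B *m w) 0 0.
  rewrite eval_det Zt !scale0r addr0 det_lblock det1 mul1r.
  by rewrite [X in \det X]mx11_scalar det_scalar1.
have detZ t : t != 0 -> (\det Z).[t] = 0.
  move=> t0; apply/eqP; apply: contraT => h.
  suff: (r.+1 <= r)%N by rewrite ltnn.
  apply: leq_trans (hr t); rewrite -addn1.
  apply: (@mxrank_ge_minor _ _ _ _ _ (col_mx P u) (row_mx Q w)).
  have -> : col_mx P u *m (A + t *: B) *m row_mx Q w =
     block_mx 1%:M 0 0 (t%:M) *m eval_mx Z t.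
    rewrite Zt mul_col_mx mul_col_row mulmx_block !mul1mx !mul0mx !addr0 !add0r.
    rewrite !mul_scalar_mx !mulmxDr !mulmxDl PQ uA mul0mx add0r.
    by rewrite -!(mulmxA _ A w) Aw !mulmx0 -!scalemxAr -!scalemxAl mul0mx !add0r.
  rewrite det_mulmx det_lblock det1 mul1r det_scalar1 mulf_neq0 //.
  by rewrite -eval_det.
have Z0 : \det Z = 0.
  apply/eqP; apply: contraT => Z0.
  have [t] : exists t, (\det Z).[t] != 0 /\ t != 0.
    apply: generically_ex; apply: generically_and; first by exists (\det Z).
    by exists 'X; rewrite ?polyX_eq0 // => t; rewrite hornerX.
  by case=> h /detZ; move/eqP: h.
by apply/matrixP => i j; rewrite !ord1 -detZ0 Z0 horner0 mxE.
Qed.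

(* Cramer's rule on an invertible minor of maximal size extends kernel vectors
   polynomially. *)
Lemma kernel_lift (K : numFieldType) m n a b (I : finType) (A B : 'M[K]_(m, n))
    (L : I -> {linear 'cV[K]_n -> 'M[K]_(a, b)}) (w : 'cV[K]_n) :
  (forall t, \rank (A + t *: B)%R <= \rank A)%N -> A *m w = 0 ->
  generically (fun t => exists2 w' : 'cV[K]_n, (A + t *: B) *m w' = 0 &
     forall i, (\rank (L i w) <= \rank (L i w'))%N).
Proof.
move=> hr Aw; have [P [Q PQ]] := mxrank_minor A; move: (\rank A) P Q PQ hr => r P Q PQ hr.
pose Z := line_mx A B.
pose M := polyC_mx P *m Z *m polyC_mx Q.
(* By Cramer's rule [W] is killed by [P *m Z], and it equals [w] at 0. By maximality of the rank,
   the rows of [P *m (A + t *: B)] span those of [A + t *: B] for generic [t], so [W] is killed by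
   the whole matrix. *)
pose W := \det M *: polyC_mx w - polyC_mx Q *m \adj M *m (polyC_mx P *m Z *m polyC_mx w).
have Mt t : eval_mx M t = P *m (A + t *: B) *m Q.
  by rewrite !eval_mulmx !eval_polyC_mx eval_line_mx.
have Wt t : eval_mx W t = \det (P *m (A + t *: B) *m Q) *: w -
   Q *m \adj (P *m (A + t *: B) *m Q) *m (P *m (A + t *: B) *m w).
  rewrite eval_subrmx eval_scalemx !eval_mulmx !eval_polyC_mx eval_adj.
  by rewrite eval_det Mt eval_line_mx.
have W0 : eval_mx W 0 = w.
  by rewrite Wt scale0r addr0 PQ det1 scale1r -(mulmxA P) Aw !mulmx0 subr0.
have gM : generically (fun t => \det (P *m (A + t *: B) *m Q) != 0).
  exists (\det M); last by move=> t; rewrite eval_det Mt.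
  apply/eqP => /(congr1 (fun p => p.[0])); rewrite eval_det Mt scale0r addr0 PQ.
  by rewrite det1 horner0 => /eqP; rewrite oner_eq0.
pose LZ i : 'M[{poly K}]_(a, b) := \sum_(c < n) W c 0 *: polyC_mx (L i (delta_mx c 0)).
have LZt i t : eval_mx (LZ i) t = L i (eval_mx W t).
  rewrite /LZ [X in L i X]matrix_sum_delta linear_sum /eval_mx raddf_sum /=.
  apply: eq_bigr => c _; rewrite big_ord1 linearZ /= map_mxZ /=; congr (_ *: _).
    by rewrite [RHS]mxE.
  by apply: etrans (eval_polyC_mx t _) _; congr (L i (delta_mx c _)); apply: val_inj.
have gL := generically_forall (fun i => generically_rank (LZ i) 0).
apply: generically_imp (generically_and gM gL) => t [h1 h2].
exists (eval_mx W t); last by move=> i; have := h2 i; rewrite !LZt W0.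
have At : (A + t *: B) = (A + t *: B) *m Q *m invmx (P *m (A + t *: B) *m Q)
                          *m P *m (A + t *: B).
  set N := P *m _ *m _ in h1 *; set At := A + t *: B in N h1 *.
  have uN : N \in unitmx by rewrite unitmxE unitfE.
  have sub : (At <= P *m At)%MS.
    have e : \rank (P *m At) = \rank At.
      apply/eqP; rewrite eqn_leq mxrankM_maxr (leq_trans (hr t)) //.
      by have := mxrankM_maxl (P *m At) Q; rewrite mxrank_unit.
    by rewrite -(mxrank_leqif_sup (submxMl P At)) e.
  have /submxP[D hD] := sub.
  have -> : At *m Q *m invmx N = D by rewrite [X in X *m Q]hD -!mulmxA !mulmxA -(mulmxA _ P) -(mulmxA D) mulmxK.
  by rewrite -mulmxA.
rewrite Wt mulmxBr -scalemxAr.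
set N := P *m _ *m Q in h1 At *; have uN : N \in unitmx by rewrite unitmxE unitfE.
have e : (A + t *: B) *m Q *m \adj N = \det N *: ((A + t *: B) *m Q *m invmx N).
  by rewrite /invmx uN -scalemxAr scalerA divff ?scale1r.
by rewrite !mulmxA e -!scalemxAl -At subrr.
Qed.

(** * Conjugating chains of subspaces *)

Lemma rank_eq_mulmx_unit (K : fieldType) p q n (A : 'M[K]_(p, n)) (B : 'M[K]_(q, n)) :
  \rank A = \rank B -> exists2 g : 'M[K]_n, g \in unitmx & (A *m g :=: B)%MS.
Proof.
move=> h.
have [f hf] : exists f : 'M[K]_n, (A *m f :=: B)%MS.
  exists (pinvmx (row_base A) *m (castmx (esym h, erefl) (row_base B))).
  have /submxP[D hD] : (A <= row_base A)%MS by rewrite eq_row_base.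
  have : (A *m pinvmx (row_base A) :=: 1%:M)%MS.
    apply/eqmxP; rewrite submx1 sub1mx /row_full eqn_leq rank_leq_col /=.
    have := mxrankM_maxl (A *m pinvmx (row_base A)) (row_base A).
    by rewrite mulmxKpV ?eq_row_base.
  rewrite mulmxA => /(eqmxMr (castmx (esym h, erefl) (row_base B))) e.
  apply: eqmx_trans e _; rewrite mul1mx; apply: eqmx_trans (eqmx_cast _ _) _.
  exact: eq_row_base.
have [|g ug hg] := @complete_unitmx _ _ _ A f; first by rewrite hf h.
by exists g; rewrite -?hg.
Qed.

(* Any two chains of subspaces of the same dimensions are conjugate. *)
Lemma chain_conj (K : fieldType) n k (A B : nat -> 'M[K]_n) :
  (forall a, (A a <= A a.+1)%MS) -> (forall a, (B a <= B a.+1)%MS) ->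
  (forall a, \rank (A a) = \rank (B a)) ->
  exists2 g : 'M[K]_n, g \in unitmx & forall a, (a <= k)%N -> (A a *m g :=: B a)%MS.
Proof.
move=> hA hB hr; elim: k => [|k [g ug hg]].
  have [g ug hg] := rank_eq_mulmx_unit (hr 0%N).
  by exists g => // a; rewrite leqn0 => /eqP ->.
pose A' := A k.+1 *m g; pose S := B k.
have SA : (S <= A')%MS by rewrite -(hg k) // submxMr.
have SB : (S <= B k.+1)%MS by exact: hB.
have rA : \rank A' = \rank (B k.+1).
  by rewrite mxrankMfree ?row_free_unit.
pose C := (A' :\: S)%MS; pose C' := (B k.+1 :\: S)%MS.
have rC : \rank C = \rank C'.
  have e1 := mxrank_cap_compl A' S; have e2 := mxrank_cap_compl (B k.+1) S.
  apply: (@addnI (\rank S)); rewrite -{1}(capmx_idPr SA) -{1}(capmx_idPr SB).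
  by rewrite e1 e2.
have [h uh hh] := rank_eq_mulmx_unit rC.
have SC : (S :&: C = 0)%MS.
  by apply/eqP; rewrite -submx0 capmxC capmx_diff.
have sumA : (S + C :=: A')%MS.
  apply: eqmx_trans (addsmx_diff_cap_eq A' S); rewrite addsmxC.
  by apply: adds_eqmx => //; apply/eqmx_sym/capmx_idPr.
have sumB : (S + C' :=: B k.+1)%MS.
  apply: eqmx_trans (addsmx_diff_cap_eq (B k.+1) S); rewrite addsmxC.
  by apply: adds_eqmx => //; apply/eqmx_sym/capmx_idPr.
(* Identity on [S = B k], so that the members already matched stay in place, and [h] from a
   complement of [S] in [A'] to one in [B k.+1]. *)
pose f := proj_mx S C + proj_mx C S *m h.
have fS m (X : 'M_(m, n)) : (X <= S)%MS -> X *m f = X.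
  move=> XS; rewrite mulmxDr proj_mx_id // mulmxA [X *m _]proj_mx_0 ?mul0mx ?addr0 //.
  by rewrite capmxC.
have fC m (X : 'M_(m, n)) : (X <= C)%MS -> X *m f = X *m h.
  move=> XC; rewrite mulmxDr proj_mx_0 // add0r mulmxA proj_mx_id //.
  by rewrite capmxC.
have fA : (A' *m f :=: B k.+1)%MS.
  apply: eqmx_trans (eqmxMr f (eqmx_sym sumA)) _.
  apply: eqmx_trans (addsmxMr _ _ _) _; rewrite fS // fC //.
  by apply: eqmx_trans sumB; apply: adds_eqmx.
have [|g' ug' hg'] := @complete_unitmx _ _ _ A' f; first by rewrite fA rA.
have g'S a : (a <= k)%N -> B a *m g' = B a.
  move=> ak; have BS : (B a <= S)%MS.
    rewrite /S -(subnKC ak); elim: (k - a)%N => [|j IH]; first by rewrite addn0.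
    by rewrite addnS; apply: submx_trans IH (hB _).
  have /submxP[D hD] := submx_trans BS SA.
  by rewrite hD -mulmxA -hg' mulmxA -hD fS.
exists (g *m g'); first by rewrite unitmx_mul ug.
move=> a; rewrite leq_eqVlt => /predU1P[->|]; first by rewrite mulmxA -/A' -hg'.
rewrite ltnS => ak; rewrite mulmxA; apply: eqmx_trans (eqmxMr g' (hg a ak)) _.
by rewrite g'S.
Qed.

(** * Sums of subspaces tensored with vectors *)

Section Family.
Variables (K : numFieldType) (N r : nat).
Implicit Types (n p : nat) (m : 'M[K]_(N, r)).

Definition fam_fun n p (F : 'I_N -> 'M[K]_(p, n)) (x : 'M[K]_(N, p)) : 'M[K]_(N, n) :=
  \matrix_y (row y x *m F y).

Fact fam_fun_is_linear n p (F : 'I_N -> 'M[K]_(p, n)) : linear (fam_fun F).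
Proof.
move=> a u v; apply/row_matrixP => y.
by rewrite linearD linearZ /= !rowK linearD linearZ /= mulmxDl scalemxAl.
Qed.

HB.instance Definition _ n p (F : 'I_N -> 'M[K]_(p, n)) :=
  GRing.isLinear.Build K 'M[K]_(N, p) 'M[K]_(N, n) _ _ (fam_fun_is_linear F).

Definition pair_fun n m (v : 'M[K]_(N, n)) : 'M[K]_(n, r) := v^T *m m.

Fact pair_fun_is_linear n m : linear (@pair_fun n m).
Proof. by move=> a u v; rewrite /pair_fun linearD linearZ /= mulmxDl scalemxAl. Qed.

HB.instance Definition _ n m :=
  GRing.isLinear.Build K 'M[K]_(N, n) 'M[K]_(n, r) _ _ (@pair_fun_is_linear n m).

(* [fam_mx F] spans, inside the N x n matrices, those whose row y lies in F y;
   a matrix v of this kind is a relation among the F y (x) m_y iff v^T *m m = 0. *)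
Definition fam_mx n p (F : 'I_N -> 'M[K]_(p, n)) : 'M[K]_(N * p, N * n) :=
  lin_mx (fam_fun F).

Definition pair_mx n m : 'M[K]_(N * n, n * r) := lin_mx (@pair_fun n m).

(** The dimension of the sum of the [F y] ⊗ m_y in K^n ⊗ K^r, where m_y is row [y] of [m] and
    tensors are [n] by [r] matrices. It is at most the sum of the ranks of the [F y], with equality
    when there is no relation. *)
Definition tensor_rank n p (F : 'I_N -> 'M[K]_(p, n)) m : nat :=
  \rank (fam_mx F *m pair_mx n m).

Lemma mul_fam_mx n p (F : 'I_N -> 'M[K]_(p, n)) (x : 'M_(N, p)) :
  mxvec x *m fam_mx F = mxvec (fam_fun F x).
Proof. exact: mul_vec_lin. Qed.

Lemma mul_pair_mx n m (v : 'M_(N, n)) : mxvec v *m pair_mx n m = mxvec (v^T *m m).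
Proof. exact: mul_vec_lin. Qed.

Lemma sub_fam_mxP n p (F : 'I_N -> 'M[K]_(p, n)) (v : 'M_(N, n)) :
  reflect (forall y, (row y v <= F y)%MS) (mxvec v <= fam_mx F)%MS.
Proof.
apply: (iffP idP) => [/submxP[D hD] y|h].
  move: hD; rewrite -[D]vec_mxK mul_fam_mx => /(can_inj mxvecK) ->.
  by rewrite rowK submxMl.
have -> : v = fam_fun F (\matrix_z (row z v *m pinvmx (F z))).
  by apply/row_matrixP => y; rewrite !rowK mulmxKpV.
by rewrite -mul_fam_mx submxMl.
Qed.

Lemma sub_fam_mx n p q (F : 'I_N -> 'M[K]_(p, n)) (G : 'I_N -> 'M[K]_(q, n)) :
  (forall y, (F y <= G y)%MS) -> (fam_mx F <= fam_mx G)%MS.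
Proof.
move=> h; apply/rV_subP => v; rewrite -[v]vec_mxK => /sub_fam_mxP hv.
by apply/sub_fam_mxP => y; apply: submx_trans (hv y) (h y).
Qed.

Lemma eq_fam_mx n p q (F : 'I_N -> 'M[K]_(p, n)) (G : 'I_N -> 'M[K]_(q, n)) :
  (forall y, (F y :=: G y)%MS) -> (fam_mx F :=: fam_mx G)%MS.
Proof. by move=> h; apply/eqmxP; rewrite !sub_fam_mx // => y; rewrite h. Qed.

Lemma eq_tensor_rank n p q (F : 'I_N -> 'M[K]_(p, n)) (G : 'I_N -> 'M[K]_(q, n)) m :
  (forall y, (F y :=: G y)%MS) -> tensor_rank F m = tensor_rank G m.
Proof. by move=> /eq_fam_mx h; rewrite /tensor_rank (eqmxMr _ h). Qed.

Lemma row_delta_mul n y z (v : 'rV[K]_n) :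
  row z (delta_mx y 0 *m v : 'M_(N, n)) = (z == y)%:R *: v.
Proof.
rewrite row_mul; apply/rowP => j; rewrite !mxE big_ord1 !mxE eqxx andbT.
by case: (z == y).
Qed.

(** The members of the family occupy separate rows, so [fam_mx F] is the external direct sum of the
    [F y]; [E y] embeds the [y]-th summand. *)
Lemma rank_fam_mx n p (F : 'I_N -> 'M[K]_(p, n)) :
  \rank (fam_mx F) = (\sum_y \rank (F y))%N.
Proof.
pose E (y : 'I_N) : 'M[K]_(n, N * n) :=
  lin1_mx (fun v : 'rV[K]_n => mxvec (delta_mx y 0 *m v : 'M_(N, n))).
have mulE y (v : 'rV_n) : v *m E y = mxvec (delta_mx y 0 *m v).
  have lin : linear (fun v : 'rV[K]_n => mxvec (delta_mx y 0 *m v : 'M_(N, n))).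
    by move=> a u w; rewrite mulmxDr linearD /= -scalemxAr linearZ.
  pose f : {linear _ -> _} := HB.pack
   (fun v : 'rV[K]_n => mxvec (delta_mx y 0 *m v : 'M_(N, n)))
   (GRing.isLinear.Build K 'rV[K]_n 'rV[K]_(N * n) _ _ lin).
  exact: (mul_rV_lin1 f v).
have rowE := row_delta_mul.
have freeE y : row_free (E y).
  apply/inj_row_free => v; rewrite mulE => /(canRL mxvecK); rewrite linear0 => h.
  by have := congr1 (row y) h; rewrite rowE eqxx scale1r row0.
have sumE : (fam_mx F :=: \sum_y <<F y *m E y>>)%MS.
  apply/eqmxP/andP; split.
    apply/rV_subP => v; rewrite -[v]vec_mxK => /sub_fam_mxP hv.
    have -> : mxvec (vec_mx v) = \sum_y row y (vec_mx v) *m E y.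
      under eq_bigr do rewrite mulE. rewrite -linear_sum; congr mxvec.
      apply/row_matrixP => z; rewrite linear_sum (bigD1 z) //= rowE eqxx scale1r.
      by rewrite big1 ?addr0 // => y zy; rewrite rowE eq_sym (negPf zy) scale0r.
    by apply: summx_sub_sums => y _; rewrite genmxE submxMr.
  apply/sumsmx_subP => y _; rewrite genmxE; apply/rV_subP => v /submxP[D ->].
  rewrite mulmxA mulE.
  apply/sub_fam_mxP => z; rewrite rowE.
  by have [->|_] := eqVneq z y; rewrite ?scale1r ?scale0r ?submxMl ?sub0mx.
rewrite sumE; have /mxdirectP /= -> : mxdirect (\sum_y <<F y *m E y>>)%MS.
  apply/mxdirect_sumsP => y _; apply/eqP; rewrite -submx0; apply/rV_subP => v.
  rewrite sub_capmx genmxE => /andP[/submxP[D hD]].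
  have /sumsmx_subP : forall z, z != y -> (<<F z *m E z>> <= fam_mx
    (fun x => if x == y then 0 else F x))%MS.
    move=> z zy; rewrite genmxE; apply/rV_subP => w /submxP[D' ->].
    rewrite mulmxA mulE; apply/sub_fam_mxP => x; rewrite rowE.
    case: (x =P z) => [->|_]; last by rewrite scale0r sub0mx.
    by rewrite (negPf zy) scale1r submxMl.
  move=> h1 h2; have {h1 h2} := submx_trans h2 h1.
  rewrite hD mulmxA mulE => /sub_fam_mxP /(_ y); rewrite eqxx rowE eqxx /=.
  by rewrite scale1r submx0 => /submx0null ->; rewrite mulmx0 linear0 eqxx.
by apply: eq_bigr => y _; rewrite genmxE mxrankMfree.
Qed.

(* Padding every relation lemma: restricting a family to subspaces that contain
   all its relations changes the two dimensions by the same amount. *)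
Lemma tensor_rank_sub n p q (F : 'I_N -> 'M[K]_(p, n)) (G : 'I_N -> 'M[K]_(q, n)) m :
  (forall y, (G y <= F y)%MS) ->
  (forall v : 'M_(N, n), (forall y, (row y v <= F y)%MS) -> v^T *m m = 0 ->
     forall y, (row y v <= G y)%MS) ->
  (tensor_rank F m + \sum_y \rank (G y) = tensor_rank G m + \sum_y \rank (F y))%N.
Proof.
move=> GF rel; rewrite -!rank_fam_mx.
rewrite -(mxrank_mul_ker (fam_mx F) (pair_mx n m)).
rewrite -(mxrank_mul_ker (fam_mx G) (pair_mx n m)) -!/(tensor_rank _ _).
rewrite addnCA; congr (_ + (_ + _))%N.
apply/eqmx_rank; rewrite !sub_capmx !capmxSr !andbT.
rewrite (submx_trans (capmxSl _ _) (sub_fam_mx GF)) /=.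
apply/rV_subP => v; rewrite -[v]vec_mxK sub_capmx => /andP[/sub_fam_mxP hv].
move=> /sub_kermxP; rewrite mul_pair_mx => /(canRL mxvecK); rewrite linear0 => h.
by apply/sub_fam_mxP; apply: rel.
Qed.

Lemma mul_pair_mx_col n m (v : 'M_(N, n)) (phi : 'M[K]_(n, r)) :
  mxvec v *m pair_mx n m *m (mxvec phi)^T = \sum_y row y v *m phi *m (row y m)^T.
Proof.
rewrite mul_pair_mx; have -> : v^T *m m = \sum_y (row y v)^T *m row y m.
  apply/matrixP => i j; rewrite summxE !mxE; apply: eq_bigr => y _.
  by rewrite !mxE big_ord1 !mxE.
by rewrite linear_sum mulmx_suml; apply: eq_bigr => y _; rewrite mxvec_dotmul.
Qed.

(** The annihilator of the sum of the [F y] ⊗ m_y, written as the kernel of a matrix so that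
    [max_rank_first_order] and [kernel_lift] apply to it. *)
Definition pairing_ker n p (F : 'I_N -> 'M[K]_(p, n)) m (phi : 'M[K]_(n, r)) : Prop :=
  fam_mx F *m pair_mx n m *m (mxvec phi)^T = 0.

Lemma pairing_kerP n p (F : 'I_N -> 'M[K]_(p, n)) m (phi : 'M[K]_(n, r)) :
  pairing_ker F m phi <-> forall y, F y *m phi *m (row y m)^T = 0.
Proof.
split=> [h y|h].
  have hu (u : 'rV_p) : u *m F y *m phi *m (row y m)^T = 0.
    have := congr1 (mulmx (mxvec (delta_mx y 0 *m u : 'M_(N, p)))) h.
    rewrite mulmx0 mulmxA (mulmxA _ (fam_mx F)) mul_fam_mx mul_pair_mx_col.
    rewrite (bigD1 y) //= big1 ?addr0 => [|z zy].
      by rewrite rowK row_delta_mul eqxx scale1r.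
    by rewrite rowK row_delta_mul (negPf zy) scale0r !mul0mx.
  by apply/row_matrixP => i; rewrite row0 !row_mul rowE; apply: hu.
apply/row_matrixP => i; rewrite row0 !row_mul rowE.
rewrite -[delta_mx _ _]vec_mxK mul_fam_mx mul_pair_mx_col big1 // => y _.
by rewrite rowK -!mulmxA mulmxA -!mulmxA (mulmxA (F y)) h mulmx0.
Qed.

(* Differentiating in m: a relation v and a pairing phi at a point of maximal
   rank satisfy <v^T m', phi> = 0 for every m'. *)
Lemma relation_in_kernel n p (F : 'I_N -> 'M[K]_(p, n)) m (phi : 'M[K]_(n, r))
    (v : 'M[K]_(N, n)) :
  (forall m', tensor_rank F m' <= tensor_rank F m)%N -> pairing_ker F m phi ->
  (forall y, (row y v <= F y)%MS) -> v^T *m m = 0 -> v *m phi = 0.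
Proof.
move=> hmax hphi /sub_fam_mxP /submxP[u hu] hv.
have H m' : mxvec v *m pair_mx n m' *m (mxvec phi)^T = 0.
  rewrite hu -(mulmxA u).
  apply: (max_rank_first_order (A := fam_mx F *m pair_mx n m)) => //.
    move=> t; apply: leq_trans (hmax (m + t *: m')).
    rewrite /tensor_rank; have -> : pair_mx n (m + t *: m') = pair_mx n m + t *: pair_mx n m'.
      apply/row_matrixP => i; apply/rowP => j.
      by rewrite /pair_mx !mxE /= /pair_fun mulmxDr -scalemxAr !linearD !linearZ /= !mxE.
    by rewrite mulmxDr scalemxAr.
  by rewrite mulmxA -hu mul_pair_mx hv linear0.
apply/row_matrixP => y; rewrite row0 row_mul; apply/rowP => j.
have dE z : row z (delta_mx y j : 'M[K]_(N, r)) = (z == y)%:R *: delta_mx 0 j.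
  by apply/rowP => k; rewrite !mxE eqxx /=; case: (z == y); rewrite ?mul1r ?mul0r.
have := H (delta_mx y j); rewrite mul_pair_mx_col (bigD1 y) //= big1 ?addr0 => [|z zy].
  rewrite dE eqxx scale1r => /matrixP /(_ 0 0); rewrite !mxE (bigD1 j) //= big1 ?addr0.
    by rewrite !mxE !eqxx mulr1.
  by move=> k kj; rewrite !mxE (negPf kj) andbF mulr0.
by rewrite dE (negPf zy) scale0r trmx0 mulmx0.
Qed.

End Family.

(** * Extremal choices, and the entrywise l1 norm *)

Lemma bounded_max (P : nat -> Prop) b :
  (exists k, P k) -> (forall k, P k -> k <= b)%N ->
  exists2 k, P k & forall j, P j -> (j <= k)%N.
Proof.
move=> ex bd; have ex' : exists k, `[< P k >] by case: ex => k /asboolP; exists k.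
have bd' k : `[< P k >] -> (k <= b)%N by move/asboolP/bd.
by case: (ex_maxnP ex' bd') => k /asboolP Pk hk; exists k => // j /asboolP/hk.
Qed.

Lemma leq_sum_eq (I : finType) (a b : I -> nat) :
  (forall i, a i <= b i)%N -> (\sum_i b i <= \sum_i a i)%N -> forall i, a i = b i.
Proof.
move=> ab; rewrite leqNgt => h i; apply/eqP; rewrite eqn_leq ab leqNgt.
apply: contra h => h; rewrite (bigD1 i) //= [in X in (_ < X)%N](bigD1 i) //=.
by rewrite -addSn leq_add // leq_sum.
Qed.

Definition l1norm (K : numDomainType) m n (A : 'M[K]_(m, n)) : K :=
  \sum_i \sum_j `|A i j|.

Section L1norm.
Variable K : numFieldType.

Lemma l1norm_ge0 m n (A : 'M[K]_(m, n)) : 0 <= l1norm A.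
Proof. by rewrite sumr_ge0 // => i _; rewrite sumr_ge0. Qed.

Lemma l1norm_ge m n (A : 'M[K]_(m, n)) i j : `|A i j| <= l1norm A.
Proof.
rewrite /l1norm (bigD1 i) //= (bigD1 j) //= -addrA lerDl addr_ge0 //.
  by rewrite sumr_ge0.
by rewrite sumr_ge0 // => k _; rewrite sumr_ge0.
Qed.

Lemma ler_l1normD m n (A B : 'M[K]_(m, n)) : l1norm (A + B) <= l1norm A + l1norm B.
Proof.
rewrite /l1norm -big_split ler_sum //= => i _; rewrite -big_split ler_sum //= => j _.
by rewrite mxE ler_normD.
Qed.

Lemma l1normZ m n a (A : 'M[K]_(m, n)) : l1norm (a *: A) = `|a| * l1norm A.
Proof.
rewrite /l1norm mulr_sumr; apply: eq_bigr => i _; rewrite mulr_sumr.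
by apply: eq_bigr => j _; rewrite mxE normrM.
Qed.

Lemma l1normN m n (A : 'M[K]_(m, n)) : l1norm (- A) = l1norm A.
Proof. by rewrite -scaleN1r l1normZ normrN1 mul1r. Qed.

Lemma ler_l1normM m n p (A : 'M[K]_(m, n)) (B : 'M[K]_(n, p)) :
  l1norm (A *m B) <= l1norm A * l1norm B.
Proof.
rewrite /l1norm mulr_suml ler_sum // => i _; rewrite mulr_suml.
apply: (@le_trans _ _ (\sum_j \sum_k `|A i k| * `|B k j|)).
  apply: ler_sum => j _; rewrite mxE; apply: le_trans (ler_norm_sum _ _ _) _.
  by apply: ler_sum => k _; rewrite normrM.
rewrite exchange_big; apply: ler_sum => k _; rewrite -mulr_sumr ler_wpM2l //.
by rewrite [leRHS](bigD1 k) //= lerDl sumr_ge0 // => l _; rewrite sumr_ge0.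
Qed.

End L1norm.

Lemma generically_unit_line (K : numFieldType) n (A B : 'M[K]_n) t0 :
  A + t0 *: B \in unitmx -> generically (fun t => A + t *: B \in unitmx).
Proof.
move=> h; apply: generically_imp (generically_rank_line A B t0) => t.
by rewrite (mxrank_unit h) -row_full_unit /row_full eqn_leq rank_leq_col.
Qed.

Lemma mxrank_eq_ker (K : fieldType) m n p (A : 'M[K]_(m, n)) (B : 'M[K]_(m, p)) :
  (forall u : 'rV_m, u *m A = 0 <-> u *m B = 0) -> \rank A = \rank B.
Proof.
move=> h; have : (kermx A :=: kermx B)%MS.
  by apply/eqmxP/andP; split; apply/rV_subP => u /sub_kermxP /h e; apply/sub_kermxP.
by move=> e; rewrite -(subKn (rank_leq_row A)) -mxrank_ker e mxrank_ker subKn ?rank_leq_row.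
Qed.

(** * Moving the subspaces of a family *)

Section Variation.
Variables (K : numFieldType) (N r : nat) (I : finType) (fam : 'I_N -> I).
Implicit Types (m : 'M[K]_(N, r)).

(** One matrix per index in [I]: all the members of a chain are moved together, which keeps them a
    chain. *)
Definition move_fam n p (F : 'I_N -> 'M[K]_(p, n)) (g : I -> 'M[K]_n) y :=
  F y *m g (fam y).

Lemma tensor_rank_row_free n n' p (F : 'I_N -> 'M[K]_(p, n)) (B : 'M[K]_(n, n')) m :
  row_free B -> tensor_rank (fun y => F y *m B) m = tensor_rank F m.
Proof.
move=> /row_freeP[B' BB']; apply: mxrank_eq_ker => u.
have e : vec_mx (u *m (fam_mx (fun y => F y *m B) *m pair_mx n' m)) =
   B^T *m vec_mx (u *m (fam_mx F *m pair_mx n m)).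
  rewrite !mulmxA -[u]vec_mxK !mul_fam_mx !mul_pair_mx !mxvecK mulmxA -trmx_mul.
  congr (_^T *m _); apply/row_matrixP => y.
  by rewrite row_mul !rowK mulmxA.
split=> /(congr1 vec_mx) /=.
  rewrite e linear0 => h; apply: (can_inj vec_mxK); rewrite linear0.
  by rewrite -[LHS]mul1mx -trmx1 -BB' trmx_mul -mulmxA h mulmx0.
by rewrite linear0 => h; apply: (can_inj vec_mxK); rewrite e h mulmx0 linear0.
Qed.

Lemma fam_mx_line n p (F : 'I_N -> 'M[K]_(p, n)) (g h : I -> 'M[K]_n) t :
  fam_mx (move_fam F (fun i => g i + t *: h i)) =
  fam_mx (move_fam F g) + t *: fam_mx (move_fam F h).
Proof.
apply/row_matrixP => a; rewrite linearD linearZ /= ![row a _]rowE.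
rewrite -[delta_mx _ _]vec_mxK !mul_fam_mx -linearZ -linearD /=; congr mxvec.
apply/row_matrixP => y; rewrite linearD linearZ /= !rowK /move_fam.
by rewrite !mulmxDr -!scalemxAr.
Qed.

Lemma pair_mx_line n m m' t :
  pair_mx n (m + t *: m') = pair_mx n m + t *: pair_mx n m'.
Proof.
apply/row_matrixP => i; apply/rowP => j.
by rewrite /pair_mx !mxE /= /pair_fun mulmxDr -scalemxAr !linearD !linearZ /= !mxE.
Qed.

Lemma generically_tensor_rank_fam n p (F : 'I_N -> 'M[K]_(p, n)) (g h : I -> 'M[K]_n) m t0 :
  generically (fun t => tensor_rank (move_fam F (fun i => (g i + t0 *: h i)%R)) m <=
                   tensor_rank (move_fam F (fun i => (g i + t *: h i)%R)) m)%N.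
Proof.
have := generically_rank_line (fam_mx (move_fam F g) *m pair_mx n m)
   (fam_mx (move_fam F h) *m pair_mx n m) t0.
by apply: generically_imp => t; rewrite /tensor_rank !fam_mx_line !mulmxDl !scalemxAl.
Qed.

Lemma generically_tensor_rank_vec n p (F : 'I_N -> 'M[K]_(p, n)) m m' t0 :
  generically (fun t => tensor_rank F (m + t0 *: m')%R <= tensor_rank F (m + t *: m')%R)%N.
Proof.
have := generically_rank_line (fam_mx F *m pair_mx n m) (fam_mx F *m pair_mx n m') t0.
by apply: generically_imp => t; rewrite /tensor_rank !pair_mx_line !mulmxDr !scalemxAr.
Qed.

Lemma move_fam1 n p (F : 'I_N -> 'M[K]_(p, n)) y : move_fam F (fun=> 1%:M) y = F y.
Proof. exact: mulmx1. Qed.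

(* Moving the traces on [ker phi] extends to a move of the whole space that fixes
   [phi], so the restricted family is again of maximal tensor rank. *)
Lemma restricted_variation n p (F : 'I_N -> 'M[K]_(p, n)) m (phi : 'M[K]_(n, r))
    (e : I -> 'M[K]_n) :
  (forall g m', tensor_rank (move_fam F g) m' <= tensor_rank F m)%N ->
  pairing_ker F m phi -> (forall i, kermx phi *m e i <= kermx phi)%MS ->
  (tensor_rank (move_fam (fun y => F y :&: kermx phi)%MS e) m + \sum_y \rank (F y) <=
   tensor_rank F m + \sum_y \rank (F y :&: kermx phi))%N.
Proof.
move=> hmax hphi he; set H := kermx phi in he *; pose P := proj_mx H (H^C)%MS.
have PH q (X : 'M_(q, n)) : (X <= H)%MS -> X *m P = X.
  by move=> XH; rewrite proj_mx_id // capmx_compl.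
have PsubH : (P <= H)%MS by rewrite -[P]mul1mx proj_mx_sub.
(* The path [1%:M + s *: d i] joins 1 to a matrix agreeing with [e i] on [H]. It fixes [phi],
   because [d i] takes values in [H = kermx phi]. *)
pose d i := P *m (e i - 1%:M).
have dH i : (d i <= H)%MS.
  rewrite /d mulmxBr mulmx1 addmx_sub ?eqmx_opp //.
  by apply: submx_trans (he i); rewrite submxMr.
have dphi i : d i *m phi = 0 by apply/sub_kermxP.
pose g s i := 1%:M + s *: d i.
have gphi s i : g s i *m phi = phi by rewrite mulmxDl mul1mx -scalemxAl dphi scaler0 addr0.
have eqg1 q (X : 'M_(q, n)) i : (X <= H)%MS -> X *m g 1 i = X *m e i.
  move=> XH; rewrite /g scale1r mulmxDr mulmx1 mulmxA PH // mulmxBr mulmx1.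
  by rewrite addrC subrK.
have gH s i : (H *m g s i <= H)%MS.
  rewrite mulmxDr mulmx1 addmx_sub // -scalemxAr scalemx_sub //.
  exact: submx_trans (submxMl _ _) (dH i).
have G1 := generically_tensor_rank_fam F (fun=> 1%:M) d m 0.
have G2 : generically (fun s => forall i, g s i \in unitmx).
  apply: generically_forall => i; apply: (@generically_unit_line _ _ _ _ 0).
  by rewrite scale0r addr0 unitmx1.
have G3 := generically_tensor_rank_fam (fun y => F y :&: H)%MS (fun=> 1%:M) d m 1.
have [s [[r1 ug] r2]] := generically_ex (generically_and (generically_and G1 G2) G3).
have {}r1 : tensor_rank (move_fam F (g s)) m = tensor_rank F m.
  apply/eqP; rewrite eqn_leq hmax (leq_trans _ r1) //.
  rewrite (eq_tensor_rank (F := F) (G := move_fam F (fun i => 1%:M + 0 *: d i))) //.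
  by move=> y; rewrite /move_fam scale0r addr0 mulmx1.
have {}r2 : (tensor_rank (move_fam (fun y => F y :&: H)%MS e) m <=
     tensor_rank (move_fam (fun y => F y :&: H)%MS (g s)) m)%N.
  apply: leq_trans r2; rewrite leq_eqVlt; apply/orP; left; apply/eqP.
  by apply: eq_tensor_rank => y; rewrite /move_fam -/(g 1 _) eqg1 ?capmxSr.
have sub y : (move_fam (fun y => F y :&: H)%MS (g s) y <= move_fam F (g s) y)%MS.
  by rewrite /move_fam submxMr ?capmxSl.
(* For generic [s] the moved family still has maximal rank and [phi] still annihilates it, so by
   [relation_in_kernel] all its relations lie in [H]; passing to the traces on [H] then loses no
   relation. *)
have := tensor_rank_sub (m := m) sub; rewrite r1.
have rk q (X : 'M_(q, n)) i : \rank (X *m g s i) = \rank X.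
  by rewrite mxrankMfree ?row_free_unit.
under eq_bigr do rewrite rk.
under [in X in _ -> _ = (_ + X)%N]eq_bigr do rewrite rk.
move=> E; rewrite E ?leq_add2r // => {E} v hv vm y.
have ker_max m' : (tensor_rank (move_fam F (g s)) m' <= tensor_rank (move_fam F (g s)) m)%N.
  by rewrite r1 hmax.
have hphi' : pairing_ker (move_fam F (g s)) m phi.
  by apply/pairing_kerP => z; rewrite /move_fam -(mulmxA (F z)) gphi; apply: (pairing_kerP _ _ _).1.
have vphi := relation_in_kernel ker_max hphi' hv vm.
have vH : (row y v <= H)%MS by apply/sub_kermxP; rewrite -row_mul vphi row0.
have Hg : (H <= H *m g s (fam y))%MS.
  by rewrite -(mxrank_leqif_sup (gH s (fam y))) rk.
have ui : row_free (g s (fam y)) by rewrite row_free_unit.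
have := hv y; rewrite /move_fam -(mulmxKV (ug (fam y)) (row y v)) !submxMfree //.
rewrite sub_capmx => -> /=; rewrite -(submxMfree _ _ ui) mulmxKV //.
exact: submx_trans vH Hg.
Qed.

End Variation.

(** * Existence of destabilizing subspaces *)

Lemma exists_kernel_vector (K : fieldType) m n (A : 'M[K]_(m, n)) :
  (\rank A < n)%N -> exists2 w : 'cV[K]_n, w != 0 & A *m w = 0.
Proof.
move=> h; have : kermx A^T != 0 by rewrite -mxrank_eq0 mxrank_ker mxrank_tr subn_eq0 -ltnNge.
move=> /rowV0Pn[v /sub_kermxP vA v0]; exists v^T; first by rewrite trmx_eq0.
by rewrite -[A]trmxK -trmx_mul vA trmx0.
Qed.

Lemma mxrank_cap_ker (K : fieldType) m n p (A : 'M[K]_(m, n)) (B : 'M[K]_(n, p)) :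
  \rank (A :&: kermx B) = (\rank A - \rank (A *m B))%N.
Proof. by rewrite -(mxrank_mul_ker A B) addnC addnK. Qed.

Section Destabilizing.
Variables (K : numFieldType) (N r : nat) (I : finType) (fam : 'I_N -> I).
Variable s : I -> seq 'I_N.
Hypothesis mem_s : forall y, y \in s (fam y).
Hypothesis fam_s : forall i y, y \in s i -> fam y = i.

Definition fam_chain n p (F : 'I_N -> 'M[K]_(p, n)) :=
  forall i, sorted (fun y z => (F y <= F z)%MS) (s i).

Lemma fam_chain_homo n n' p p' (F : 'I_N -> 'M[K]_(p, n)) (G : 'I_N -> 'M[K]_(p', n')) :
  (forall y z, fam y = fam z -> (F y <= F z)%MS -> (G y <= G z)%MS) ->
  fam_chain F -> fam_chain G.
Proof.
move=> h ch i; apply: (sub_in_sorted (P := mem (s i))) (ch i); last exact/allP.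
by move=> y z ys zs; apply: h; rewrite (fam_s ys) (fam_s zs).
Qed.

(** The traces of a chain on [X], followed by [X] itself, form a chain with the same dimensions as
    the one on [Y], so [chain_conj] applies. *)
Lemma fam_chain_conj n (F : 'I_N -> 'M[K]_n) (X Y : 'M[K]_n) i :
  fam_chain F -> \rank X = \rank Y ->
  (forall y, \rank (F y :&: X)%MS = \rank (F y :&: Y)%MS) ->
  exists2 f : 'M[K]_n, f \in unitmx & (X *m f :=: Y)%MS /\
    forall y, fam y = i -> ((F y :&: X) *m f :=: F y :&: Y)%MS.
Proof.
move=> ch rXY rF.
(* Past the end of the list the chain is constantly [Z]; this last value is what makes [f] carry [X]
   onto [Y]. *)
pose A Z a := if (a < size (s i))%N then
   (if s i is y0 :: _ then (F (nth y0 (s i) a) :&: Z)%MS else Z) else Z.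
have incr Z a : (A Z a <= A Z a.+1)%MS.
  rewrite /A; have := ch i; case: (s i) => [|y0 t] // st.
  case: ifP => ha; case: ifP => ha'; rewrite ?capmxSr //; last by move/negP: ha; case; apply: ltnW ha'.
  rewrite capmxS //; exact: elimT (sortedP y0) st a ha'.
have rA a : \rank (A X a) = \rank (A Y a).
  by rewrite /A; case: (s i) => [|y0 q] //=; case: ifP => _ //; apply: rF.
have [f uf hf] := chain_conj (size (s i)) (incr X) (incr Y) rA.
exists f => //; split.
  by have := hf _ (leqnn _); rewrite /A ltnn.
move=> y fy; have ys : y \in s i by rewrite -fy mem_s.
have := hf (index y (s i)); rewrite /A index_mem ys index_size.
by move: ys; case: (s i) => // y0 t ys; rewrite nth_index // => /(_ isT).
Qed.

(** [None] adds the whole space to the family, so that the rank of [phi] is controlled together with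
    the ranks of the [F y *m phi]. *)
Let tau n (F : 'I_N -> 'M[K]_n) (o : option 'I_N) : 'M[K]_n :=
  if o is Some y then F y else 1%:M.

(** At a point of maximal rank the annihilator varies polynomially, so [phi] follows a line through
    [m], and the ranks of its images can only go up generically. *)
Lemma pairing_ker_lift n (F : 'I_N -> 'M[K]_n) (m m' : 'M[K]_(N, r)) (phi : 'M[K]_(n, r)) :
  (forall m' : 'M[K]_(N, r), tensor_rank F m' <= tensor_rank F m)%N -> pairing_ker F m phi ->
  generically (fun t => exists2 phi', pairing_ker F (m + t *: m') phi' &
    forall o, (\rank (tau F o *m phi) <= \rank (tau F o *m phi'))%N).
Proof.
move=> hmax hphi.
pose L (o : option 'I_N) (w : 'cV[K]_(n * r)) : 'M[K]_(n, r) := tau F o *m vec_mx w^T.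
have linL o : linear (L o).
  by move=> a u v; rewrite /L !linearD !linearZ /= scalemxAr.
pose L' o : {linear 'cV[K]_(n * r) -> 'M[K]_(n, r)} := HB.pack (L o)
  (GRing.isLinear.Build K 'cV[K]_(n * r) 'M[K]_(n, r) _ _ (linL o)).
have := @kernel_lift _ _ _ _ _ _ (fam_mx F *m pair_mx n m) (fam_mx F *m pair_mx n m')
   L' (mxvec phi)^T _ hphi.
move=> H; apply: generically_imp (H _) => [t [w' w'0 hw']|t]; last first.
  by apply: leq_trans (hmax (m + t *: m')); rewrite /tensor_rank pair_mx_line mulmxDr scalemxAr.
exists (vec_mx w'^T).
  by rewrite /pairing_ker vec_mxK trmxK pair_mx_line mulmxDr -scalemxAr.
by move=> o; have := hw' o; rewrite /= /L trmxK mxvecK.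
Qed.

Lemma row_full_pairing_ker n (F : 'I_N -> 'M[K]_n) (m : 'M[K]_(N, r)) :
  (forall phi : 'M[K]_(n, r), pairing_ker F m phi -> phi = 0) -> tensor_rank F m = (n * r)%N.
Proof.
move=> h; apply/eqP; rewrite eqn_leq rank_leq_col leqNgt; apply/negP => /exists_kernel_vector.
case=> w w0 hw; case/negP: w0; apply/eqP/trmx_inj/(can_inj vec_mxK).
by rewrite trmx0 linear0; apply: h; rewrite /pairing_ker vec_mxK trmxK.
Qed.

(** Induction on [n]. At moves and vectors of maximal rank, take [phi] in the annihilator with all
    ranks of the [F y *m phi] as large as possible. If [phi] is 0, the tensors fill K^n ⊗ K^r and
    the whole space destabilizes. Otherwise the traces of the family on [H = kermx phi] again have
    relations for all moves and vectors, and the induction hypothesis inside [H] gives the subspace.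
    Moves are kept close to 1, since the metric estimate applied to the result holds only there. *)
Theorem destabilizing_subspace n (F : 'I_N -> 'M[K]_n) (e : K) :
  fam_chain F -> 0 < e ->
  (forall g (m : 'M_(N, r)), tensor_rank (move_fam fam F g) m < \sum_y \rank (F y))%N ->
  exists g : I -> 'M[K]_n, [/\ forall i, g i \in unitmx,
    forall i, l1norm (g i - 1%:M) < e &
    exists H : 'M[K]_n, (r * \rank H < \sum_y \rank (move_fam fam F g y :&: H)%MS)%N].
Proof.
elim/ltn_ind: n F e => n IH F e ch e0 hlt.
have [rho [g0 [m0 er0]] rho_max] := @bounded_max
   (fun k => exists g (m : 'M[K]_(N, r)), tensor_rank (move_fam fam F g) m = k) (\sum_y \rank (F y))
   (ex_intro _ _ (ex_intro _ (fun=> 1%:M) (ex_intro _ 0 erefl)))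
   (fun k => ltac:(by move=> [g [m <-]]; apply: ltnW (hlt g m))).
(* The line from 1 through [g0] reaches rank [rho] at parameter 1, hence also at some arbitrarily
   small parameter where all the moves are invertible. *)
pose d i := g0 i - 1%:M.
have [t [t1 t2] t3] : exists2 t, tensor_rank (move_fam fam F (fun i => 1%:M + t *: d i)) m0 = rho
    /\ (forall i, 1%:M + t *: d i \in unitmx) & `|t| < (e / 2) / (1 + \sum_i l1norm (d i)).
  apply: generically_near; last first.
    by rewrite !divr_gt0 // ltr_pwDl // sumr_ge0 // => i _; rewrite l1norm_ge0.
  apply: generically_and; last first.
    apply: generically_forall => i; apply: (@generically_unit_line _ _ _ _ 0).
    by rewrite scale0r addr0 unitmx1.
  apply: generically_imp (generically_tensor_rank_fam fam F (fun=> 1%:M) d m0 1) => t h.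
  apply/eqP; rewrite eqn_leq; apply/andP; split; first by apply: rho_max; eexists; eexists.
  apply: leq_trans h; rewrite -er0 leq_eqVlt; apply/orP; left; apply/eqP.
  by apply: eq_tensor_rank => y; rewrite /move_fam /d scale1r addrC subrK.
pose G i := 1%:M + t *: d i.
have G1 i : l1norm (G i - 1%:M) < e / 2.
  rewrite /G addrC addKr l1normZ.
  apply: le_lt_trans (_ : `|t| * (1 + \sum_i l1norm (d i)) < _).
    rewrite ler_wpM2l // (bigD1 i) //= addrCA lerDl addr_ge0 // sumr_ge0 // => j _.
    by rewrite l1norm_ge0.
  by rewrite -ltr_pdivlMr // ltr_pwDl // sumr_ge0 // => j _; rewrite l1norm_ge0.
pose F1 := move_fam fam F G.
have rF1 y : \rank (F1 y) = \rank (F y) by rewrite mxrankMfree // row_free_unit t2.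
have ch1 : fam_chain F1.
  by apply: fam_chain_homo ch => y z yz h; rewrite /F1 /move_fam yz submxMr.
have max1 g (m : 'M[K]_(N, r)) : (tensor_rank (move_fam fam F1 g) m <= rho)%N.
  apply: rho_max; exists (fun i => G i *m g i), m.
  by apply: eq_tensor_rank => y; rewrite /F1 /move_fam mulmxA.
have max1' (m : 'M[K]_(N, r)) : (tensor_rank F1 m <= rho)%N.
  apply: leq_trans (max1 (fun=> 1%:M) m); rewrite leq_eqVlt; apply/orP; left; apply/eqP.
  by apply: eq_tensor_rank => y; rewrite move_fam1.
have pk0 : pairing_ker F1 m0 0 by rewrite /pairing_ker linear0 trmx0 mulmx0.
(* Maximizing the sum of the ranks, over [m] as well, forces each of them to stay constant when
   [phi] is later deformed. *)
have [T [m [phi [rm phim eT]]] Tmax] := @bounded_max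
   (fun k => exists (m : 'M[K]_(N, r)) phi, [/\ tensor_rank F1 m = rho, pairing_ker F1 m phi &
      k = (\sum_o \rank (tau F1 o *m phi))%N]) (\sum_(o : option 'I_N) r)
   (ex_intro _ _ (ex_intro _ m0 (ex_intro _ 0 (And3 t1 pk0 erefl))))
   (fun k => ltac:(by move=> [m [phi [_ _ ->]]]; apply: leq_sum => o _; apply: rank_leq_col)).
have [phi0|phi0] := eqVneq phi 0.
  have full : tensor_rank F1 m = (n * r)%N.
    apply: row_full_pairing_ker => psi hpsi; apply/eqP; rewrite -mxrank_eq0 -leqn0.
    have := Tmax _ (ex_intro _ m (ex_intro _ psi (And3 rm hpsi erefl))).
    rewrite eT phi0 [X in (_ <= X)%N]big1 => [|o _]; last by rewrite mulmx0 mxrank0.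
    by apply: leq_trans; rewrite (bigD1 None) //= mul1mx leq_addr.
  exists G; split=> // [i|]; first by apply: lt_le_trans (G1 i) _; rewrite ler_pdivrMr // mulr_natr mulr2n lerDl ltW.
  exists 1%:M; rewrite mxrank1 mulnC -full; apply: leq_trans (hlt G m) _.
  apply: leq_sum => y _; rewrite -rF1; apply: mxrankS.
  by rewrite sub_capmx submx_refl submx1.
set H := kermx phi; set k := \rank H.
have [B Bfree BH] : exists2 B : 'M[K]_(k, n), row_free B & (B :=: H)%MS.
  by exists (row_base H); [exact: row_base_free | exact: eq_row_base].
have /row_freeP[S BS] := Bfree.
have kn : (k < n)%N.
  rewrite /k mxrank_ker ltn_subrL lt0n mxrank_eq0 phi0 /=.
  by case: (n) phi phi0 {Tmax phim eT H k B S Bfree BH BS} => // phi; rewrite flatmx0 eqxx.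
have SB q (X : 'M_(q, n)) : (X <= H)%MS -> X *m S *m B = X.
  by rewrite -BH => /submxP[D ->]; rewrite -(mulmxA D) BS mulmx1.
(* The traces on [H] in the coordinates of the basis [B], of which [S] is a right inverse. *)
pose F' y : 'M[K]_k := <<(F1 y :&: H) *m S>>%MS.
have F'B y : (F' y *m B :=: F1 y :&: H)%MS.
  by apply: eqmx_trans (eqmxMr B (genmxE _)) _; rewrite SB ?capmxSr.
have rF' y : \rank (F' y) = \rank (F1 y :&: H)%MS by rewrite -F'B mxrankMfree.
have ch' : fam_chain F'.
  by apply: fam_chain_homo ch1 => y z _ h; rewrite !genmxE submxMr // capmxS.
(* Bounds the distortion when a move of [H] is extended to the whole space by [S] and [B] and
   composed with [G]. *)
pose c := 1 + \sum_i l1norm (G i *m S) * l1norm B.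
have c0 : 0 < c.
  by rewrite ltr_pwDl // sumr_ge0 // => i _; rewrite mulr_ge0 // l1norm_ge0.
have [//||h [uh h1 [H' hH']]] := IH k kn F' (e / 2 / c) ch'; first by rewrite !divr_gt0.
  (* For an arbitrary [m'], pass to a generic point [mx] of the line from [m] to [m']. The rank
     there is still [rho], [phi] has deformed to some [psi] with the same ranks, and the rank of the
     traces is at least the one at [m'], which is the point of parameter 1. *)
  move=> h m'.
  have K1 := generically_tensor_rank_vec F1 m (m' - m) 0.
  have max2 (m'' : 'M[K]_(N, r)) : (tensor_rank F1 m'' <= tensor_rank F1 m)%N by rewrite rm max1'.
  have K2 := pairing_ker_lift (m' - m) max2 phim.
  have K3 := generically_tensor_rank_vec (move_fam fam F' h) m (m' - m) 1.
  have [x [[x1 [psi hpsi x2]] x3]] := generically_ex (generically_and (generically_and K1 K2) K3).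
  set mx := m + x *: (m' - m) in x1 x2 x3 hpsi.
  rewrite scale0r addr0 rm in x1; rewrite scale1r addrC subrK in x3.
  have {}x1 : tensor_rank F1 mx = rho by apply/eqP; rewrite eqn_leq max1' x1.
  have {}x2 := leq_sum_eq x2 (ltac:(rewrite -eT; apply: Tmax; exists mx, psi; split=> //)).
  set H1 := kermx psi.
  have rH : \rank H = \rank H1.
    by rewrite !mxrank_ker; have := x2 None; rewrite /= !mul1mx => ->.
  have rFH y : \rank (F1 y :&: H)%MS = \rank (F1 y :&: H1)%MS.
    by rewrite !mxrank_cap_ker; have := x2 (Some y) => /= ->.
  have [f uf hf] := fin_all_exists2 (fun i => fam_chain_conj i ch1 rH rFH).
  have [f0 uf0 hf0] := rank_eq_mulmx_unit rH.
  (* The move [h] transported from [H] to [H1 = kermx psi]. The way in, [f i], depends on the chain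
     and matches the traces; the way out, [f0], is common to all chains, so that [B *m f0] is one
     injective map and preserves tensor ranks. *)
  pose E i := invmx (f i) *m S *m h i *m B *m f0.
  have XBf q (X : 'M_(q, k)) : (X *m B *m f0 <= H1)%MS.
    by rewrite -hf0 submxMr // -BH submxMl.
  have EH i : (kermx psi *m E i <= kermx psi)%MS by rewrite /E !mulmxA XBf.
  have := @restricted_variation _ _ _ _ fam _ _ F1 mx psi E.
  rewrite x1 => /(_ max1 hpsi EH).
  have -> : tensor_rank (move_fam fam (fun y => F1 y :&: H1)%MS E) mx =
            tensor_rank (move_fam fam F' h) mx.
    have Bf0 : row_free (B *m f0) by rewrite /row_free mxrankMfree ?row_free_unit.
    rewrite -(tensor_rank_row_free _ _ Bf0); apply: eq_tensor_rank => y.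
    rewrite /move_fam /E !mulmxA; do 3!apply: eqmxMr.
    apply: eqmx_trans (eqmx_sym (genmxE _)); apply: eqmxMr.
    apply: eqmx_trans (eqmxMr _ (eqmx_sym ((hf (fam y)).2 y erefl))) _.
    by rewrite mulmxK.
  (* By [V] the traces have at least as large a defect as the full family, which has a positive one
     by hypothesis. *)
  move=> V; have lt1 : (rho < \sum_y \rank (F1 y))%N.
    by under eq_bigr do rewrite rF1; rewrite -t1; apply: hlt.
  under eq_bigr do rewrite rF' rFH.
  apply: leq_ltn_trans x3 _; rewrite -(ltn_add2r (\sum_y \rank (F1 y))).
  by apply: leq_ltn_trans V _; rewrite addnC ltn_add2l.
(* The second factor restricts to [h i] on [H] and is invertible: a vector that it kills lies in
   [H], where [h i] is injective. *)
pose g i := G i *m (1%:M + S *m (h i - 1%:M) *m B).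
have extB q (X : 'M_(q, k)) i : X *m B *m (1%:M + S *m (h i - 1%:M) *m B) = X *m h i *m B.
  rewrite mulmxDr mulmx1 !mulmxA -(mulmxA X) BS mulmx1 mulmxBr mulmx1 mulmxBl.
  by rewrite addrC subrK.
exists g; split.
- move=> i; rewrite unitmx_mul t2 /=.
  rewrite -row_free_unit; apply/inj_row_free => v v0.
  have [w vw] : exists w, v = w *m B.
    exists (- (v *m S *m (h i - 1%:M))); apply/eqP; rewrite mulNmx -addr_eq0.
    by rewrite -v0 mulmxDr mulmx1 !mulmxA.
  move: v0; rewrite vw extB => /eqP; rewrite -(mul0mx _ B) => /eqP /(row_free_inj Bfree).
  by move=> /(congr1 (mulmx^~ (invmx (h i)))); rewrite /= mul0mx mulmxK // => ->; rewrite !mul0mx.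
- move=> i; have -> : g i - 1%:M = (G i - 1%:M) + G i *m S *m (h i - 1%:M) *m B.
    by rewrite /g mulmxDr mulmx1 !mulmxA addrAC.
  apply: le_lt_trans (ler_l1normD _ _) _; rewrite [ltRHS]splitr ltrD //.
  apply: le_lt_trans (ler_l1normM _ _) _.
  apply: (@le_lt_trans _ _ (l1norm (h i - 1%:M) * c)); last by rewrite -ltr_pdivlMr.
  apply: (@le_trans _ _ (l1norm (G i *m S) * l1norm (h i - 1%:M) * l1norm B)).
    by rewrite ler_wpM2r ?l1norm_ge0 // ler_l1normM.
  rewrite mulrAC mulrC ler_wpM2l ?l1norm_ge0 // /c (bigD1 i) //= addrCA lerDl addr_ge0 //.
  by rewrite sumr_ge0 // => j _; rewrite mulr_ge0 // l1norm_ge0.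
exists <<H' *m B>>%MS; rewrite genmxE mxrankMfree //; apply: leq_trans hH' _.
apply: leq_sum => y _; rewrite -(mxrankMfree (move_fam fam F' h y :&: H')%MS Bfree).
apply: mxrankS; rewrite sub_capmx genmxE submxMr ?capmxSr // andbT.
apply: submx_trans (submxMr _ (capmxSl _ _)) _; rewrite /move_fam -extB /g mulmxA submxMr //.
by rewrite F'B capmxSl.
Qed.

End Destabilizing.

Local Open Scope sesquilinear_scope.

(** * Spans, adjoints, and the Frobenius norm against projections *)

Lemma span_family (K : fieldType) (vT : vectType K) (T : Type) (f : T -> vT) :
  exists s : seq T, forall x, f x \in <<map f s>>%VS.
Proof.
have [k [s hs] kmax] := @bounded_max (fun k => exists s, \dim <<map f s>>%VS = k)
  (\dim {:vT}) (ex_intro _ _ (ex_intro _ [::] erefl))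
  (fun k => ltac:(by move=> [s <-]; apply: dimvS; apply: subvf)).
exists s => x; have le : (<<map f s>> <= <<map f (x :: s)>>)%VS.
  by rewrite /= span_cons addvSr.
have : <<map f s>>%VS == <<map f (x :: s)>>%VS.
  by rewrite eqEdim le hs; apply: kmax; exists (x :: s).
by move=> /eqP ->; rewrite memv_span // inE eqxx.
Qed.

Lemma adjmx_unitary (C : numClosedFieldType) n (P : 'M[C]_n) : P \is unitarymx ->
  P^t* *m P = 1%:M.
Proof. by move=> uP; rewrite -invmx_unitary // mulVmx // unitarymx_unit. Qed.

Section Frobenius.
Variable C : numClosedFieldType.

Lemma adjmxM m n p (A : 'M[C]_(m, n)) (B : 'M[C]_(n, p)) :
  (A *m B)^t* = B^t* *m A^t*.
Proof. by rewrite trmx_mul map_mxM. Qed.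

Lemma adjmxB m n (A B : 'M[C]_(m, n)) : (A - B)^t* = A^t* - B^t*.
Proof. by rewrite linearB /= map_mxB. Qed.

Lemma adjmx1 n : (1%:M : 'M[C]_n)^t* = 1%:M.
Proof. by rewrite trmx1 map_mx1. Qed.

Definition frob m n (A : 'M[C]_(m, n)) : C := \tr (A *m A^t*).

Lemma frobE m n (A : 'M[C]_(m, n)) : frob A = \sum_i \sum_j `|A i j| ^+ 2.
Proof.
apply: eq_bigr => i _; rewrite !mxE; apply: eq_bigr => j _.
by rewrite !mxE normCK.
Qed.

Lemma frob_ge0 m n (A : 'M[C]_(m, n)) : 0 <= frob A.
Proof. by rewrite frobE !sumr_ge0 // => i _; rewrite sumr_ge0 // => j _; rewrite exprn_ge0. Qed.

Lemma frob_le_l1norm m n (A : 'M[C]_(m, n)) : frob A <= l1norm A ^+ 2.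
Proof.
rewrite frobE expr2 {1}/l1norm mulr_suml ler_sum // => i _.
rewrite mulr_suml ler_sum // => j _.
by rewrite expr2 ler_wpM2l // l1norm_ge.
Qed.

Lemma frob_unitarymx m n (W : 'M[C]_(m, n)) : W \is unitarymx -> frob W = m%:R.
Proof. by move=> /unitarymxP h; rewrite /frob h mxtrace1. Qed.

(** The defect is the squared norm of [Q *m T], where [Q] is the orthogonal projection complementary
    to the row space of [Z]. *)
Lemma frob_unitarymxM m n p (Z : 'M[C]_(m, n)) (T : 'M[C]_(n, p)) :
  Z \is unitarymx -> frob (Z *m T) <= frob T.
Proof.
move=> /unitarymxP hZ; pose Q := 1%:M - Z^t* *m Z.
have Qh : Q^t* = Q by rewrite adjmxB adjmx1 adjmxM trmxCK.
have QQ : Q *m Q = Q.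
  rewrite {1}/Q mulmxBl mul1mx /Q mulmxBr mulmx1 -mulmxA (mulmxA Z) hZ mul1mx.
  by rewrite subrr subr0.
rewrite -subr_ge0; have <- : frob (Q *m T) = frob T - frob (Z *m T).
  rewrite /frob !adjmxM Qh mxtrace_mulC !mulmxA -(mulmxA _ Q Q) QQ -mulmxA mxtrace_mulC.
  rewrite /Q !mulmxBr mulmx1 [LHS](raddfB (@mxtrace C n)); congr (_ - _).
  by rewrite [RHS]mxtrace_mulC -!mulmxA mulmxA [LHS]mxtrace_mulC !mulmxA.
exact: frob_ge0.
Qed.

Lemma unitarymx_norm_le1 m n (W : 'M[C]_(m, n)) i j : W \is unitarymx -> `|W i j| <= 1.
Proof.
move=> /unitarymxP /matrixP /(_ i i); rewrite !mxE eqxx => h.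
rewrite -(@expr_le1 _ 2) // -[leRHS]/(true%:R) -h (bigD1 j) //= !mxE -normCK lerDl sumr_ge0 // => k _.
by rewrite !mxE -normCK exprn_ge0.
Qed.

Lemma l1norm_unitarymx m n (W : 'M[C]_(m, n)) : W \is unitarymx -> l1norm W <= (m * n)%:R.
Proof.
move=> h; apply: (@le_trans _ _ (\sum_(i < m) \sum_(j < n) 1)).
  by apply: ler_sum => i _; apply: ler_sum => j _; apply: unitarymx_norm_le1.
by rewrite !(sumr_const, card_ord) mulrnA -mulr_natr mulr_natl mulrnAC.
Qed.

Lemma unitary_basis m n (A : 'M[C]_(m, n)) :
  exists2 W : 'M[C]_(\rank A, n), W \is unitarymx & (W :=: A)%MS.
Proof.
exists (schmidt (row_base A)); first by rewrite schmidt_unitarymx // rank_leq_col.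
exact: eqmx_trans (eqmx_schmidt_free (row_base_free A)) (eq_row_base A).
Qed.

Lemma frob_proj m n (W : 'M[C]_(m, n)) (P : 'M[C]_n) :
  P^t* = P -> P *m P = P -> frob (W *m P) = \tr (W *m P *m W^t*).
Proof. by move=> Ph PP; rewrite /frob adjmxM Ph !mulmxA -(mulmxA W) PP. Qed.

(* A moved subspace F g (g near 1) meets H in dimension at most tr (P_H P_F) up to
   a small error. *)
Lemma rank_cap_le_frob n (F g P H : 'M[C]_n) h (UH : 'M[C]_(h, n)) (x : C) :
  P^t* = P -> P *m P = P -> F *m P = F -> g \in unitmx ->
  UH \is unitarymx -> (UH :=: H)%MS -> 
  l1norm (g - 1%:M) <= 2^-1 -> 2 * (n * n)%:R * l1norm (g - 1%:M) * l1norm (1%:M - P) <= x ->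
  (\rank (F *m g :&: H)%MS)%:R <= \tr (UH *m P *m UH^t*) + x ^+ 2.
Proof.
move=> Ph PP FP ug uUH eUH small hx.
have [W uW eW] := unitary_basis (F *m g :&: H)%MS; set w := \rank _ in W uW eW *.
set E := g - 1%:M in small hx.
have WWh : W *m W^t* = 1%:M by apply/unitarymxP.
rewrite -frob_proj //.
have WH : (W <= UH)%MS by rewrite eW eUH capmxSr.
have uZ' : W = W *m UH^t* *m UH.
  by have /submxP[D ->] := WH; rewrite -(mulmxA D) (unitarymxP uUH) mulmx1.
have uZ : W *m UH^t* \is unitarymx.
  by apply/unitarymxP; rewrite adjmxM trmxCK mulmxA -uZ'.
have le1 : frob (W *m P) <= frob (UH *m P).
  by rewrite {1}uZ' -(mulmxA _ UH); apply: frob_unitarymxM.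
have Qh : (1%:M - P)^t* = 1%:M - P by rewrite adjmxB adjmx1 Ph.
have QQ : (1%:M - P) *m (1%:M - P) = 1%:M - P.
  by rewrite mulmxBl mul1mx mulmxBr mulmx1 PP subrr subr0.
(* Pythagoras for an orthonormal basis [W] of the intersection. The first term is bounded by the
   trace, as [W] lies in [UH]. The second is small, as [W] is close to [W *m invmx g], which lies in
   [F] and is fixed by [P]. *)
have split_frob : w%:R = frob (W *m P) + frob (W *m (1%:M - P)).
  rewrite !frob_proj // mulmxBr mulmx1 mulmxBl raddfB /= addrC subrK.
  by rewrite -(frob_unitarymx uW).
rewrite split_frob lerD //; apply: le_trans (frob_le_l1norm _) _.
rewrite lerXn2r ?nnegrE ?l1norm_ge0 //.
  by apply: le_trans hx; rewrite !mulr_ge0 ?l1norm_ge0.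
apply: le_trans hx; have [X eX] : exists X, X = W *m invmx g by eexists.
have XF : (X <= F)%MS.
  have : (W <= F *m g)%MS by rewrite eW capmxSl.
  by move=> /(submxMr (invmx g)); rewrite mulmxK // -eX.
have XP : X *m P = X by have /submxP[D ->] := XF; rewrite -mulmxA FP.
have WX : W = X + X *m E by rewrite /E mulmxBr mulmx1 addrC subrK eX mulmxKV.
have -> : W *m (1%:M - P) = X *m E *m (1%:M - P).
  rewrite {1}WX mulmxDl; have -> : X *m (1%:M - P) = 0 by rewrite mulmxBr mulmx1 XP subrr.
  by rewrite add0r.
have WE : X = W - X *m E by rewrite WX addrK.
have X2 : l1norm X <= 2 * l1norm W.
  have : l1norm X <= l1norm W + l1norm X * 2^-1.
    rewrite {1}WE; apply: le_trans (ler_l1normD _ _) _; rewrite lerD2l l1normN.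
    by apply: le_trans (ler_l1normM _ _) _; rewrite ler_wpM2l // l1norm_ge0.
  by rewrite {1}(splitr (l1norm X)) lerD2r ler_pdivrMr // mulrC.
apply: le_trans (ler_l1normM _ _) _; rewrite ler_wpM2r ?l1norm_ge0 //.
apply: le_trans (ler_l1normM _ _) _; rewrite ler_wpM2r ?l1norm_ge0 //.
apply: le_trans X2 _; rewrite ler_wpM2l //; apply: le_trans (l1norm_unitarymx uW) _.
by rewrite ler_nat leq_mul // rank_leq_col.
Qed.

End Frobenius.

Lemma mxrank_proj_trace (C : numClosedFieldType) n (P : 'M[C]_n) :
  P^t* = P -> P *m P = P -> (\rank P)%:R = \tr P.
Proof.
move=> Ph PP; have [W uW eW] := unitary_basis P; set w := \rank P in W uW eW *.
have WW := unitarymxP uW.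
have WP : W *m P = W.
  by have /submxP[D ->] : (W <= P)%MS; rewrite ?eW // -mulmxA PP.
have PW : P *m W^t* = W^t* by rewrite -{1}Ph -adjmxM WP.
have -> : P = W^t* *m W.
  have /submxP[D hD] : (P <= W)%MS by rewrite eW.
  by rewrite -PW hD -!mulmxA (mulmxA W) WW mul1mx.
by rewrite mxtrace_mulC WW mxtrace1.
Qed.

(** Layer-cake formula: an integer [k j] is the number of levels below it. *)
Lemma sum_layers (C : numClosedFieldType) n (k : 'I_n -> nat) L :
  (forall j, k j <= L)%N ->
  diag_mx (\row_j (k j)%:R) = \sum_(l < L) diag_mx (\row_j (l < k j)%N%:R) :> 'M[C]_n.
Proof.
move=> hk; apply/matrixP => a b; rewrite summxE !mxE.
under eq_bigr do rewrite !mxE.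
have [->|_] := eqVneq a b; last by rewrite mulr0n big1.
rewrite mulr1n; under eq_bigr do rewrite mulr1n.
rewrite -natr_sum; congr (_%:R); have := hk b; move: (k b) => x {hk}.
suff -> : (\sum_(l < L) (l < x) = minn x L)%N by move/minn_idPl.
elim: L => [|L' IH]; first by rewrite big_ord0 minn0.
by rewrite big_ord_recr /= IH; lia.
Qed.

(** * From a sum of Hermitian matrices to a full-rank family *)

Section HermitianSum.
Variables (C : numClosedFieldType) (I : finType) (n r : nat).
Variables (U : I -> 'M[C]_n) (kap : I -> 'I_n -> nat).
Hypothesis uU : forall i, U i \is unitarymx.
Hypothesis sumH : \sum_i (U i)^t* *m diag_mx (\row_j (kap i j)%:R) *m U i = r%:R%:M.

(** An index [y] is a pair of a matrix [i] and a level [l] below [L]. [F y] spans the eigenvectors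
    with eigenvalue above [l], and [P y] is the orthogonal projection on it. *)
Let L := (\max_i \max_j kap i j)%N.
Let N := #|{: I * 'I_L}|.
Let fam (y : 'I_N) : I := (enum_val y).1.
Let lev (y : 'I_N) : 'I_L := (enum_val y).2.
Let D y : 'M[C]_n := diag_mx (\row_j (lev y < kap (fam y) j)%N%:R).
Let F y : 'M[C]_n := D y *m U (fam y).
Let P y : 'M[C]_n := (U (fam y))^t* *m F y.

Let DD y : D y *m D y = D y.
Proof.
rewrite mulmx_diag; congr diag_mx; apply/rowP => j; rewrite !mxE.
by case: (_ < _)%N; rewrite ?mulr1 ?mulr0.
Qed.

Let Dh y : (D y)^t* = D y.
Proof.
rewrite tr_diag_mx map_diag_mx; congr diag_mx; apply/rowP => j; rewrite !mxE.
exact: conjC_nat.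
Qed.

Let FP y : F y *m P y = F y.
Proof.
by rewrite /P /F !mulmxA -(mulmxA (D y)) (unitarymxP (uU _)) mulmx1 DD.
Qed.

Let PP y : P y *m P y = P y.
Proof. by rewrite {1}/P -mulmxA FP. Qed.

Let Ph y : (P y)^t* = P y.
Proof. by rewrite /P /F !adjmxM trmxCK Dh mulmxA. Qed.

Let kapL i j : (kap i j <= L)%N.
Proof. by apply: leq_trans (leq_bigmax i); exact: leq_bigmax. Qed.

Let sumP : \sum_y P y = r%:R%:M.
Proof.
rewrite -sumH; under [RHS]eq_bigr do rewrite (sum_layers _ (kapL _)) mulmx_sumr mulmx_suml.
rewrite pair_bigA /= [RHS](reindex (@enum_val _ {: I * 'I_L})) /=.
  by apply: eq_bigr => y _; rewrite /P /F mulmxA.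
exact: onW_bij (@enum_val_bij _).
Qed.

Let rankF y : \rank (F y) = \rank (P y).
Proof.
apply/eqP; rewrite eqn_leq -{1}FP mxrankM_maxr /=; exact: mxrankM_maxr.
Qed.

Let sumrankF : (\sum_y \rank (F y) = n * r)%N.
Proof.
apply/eqP; rewrite -(eqr_nat C) natr_sum; under eq_bigr do rewrite rankF mxrank_proj_trace //.
by rewrite -raddf_sum sumP /= mxtrace_scalar natrM mulr_natl.
Qed.

(** Reversed, because higher levels give smaller subspaces. *)
Let s (i : I) : seq 'I_N := [seq enum_rank (i, l) | l <- rev (enum 'I_L)].

Let mem_s y : y \in s (fam y).
Proof.
apply/mapP; exists (lev y); first by rewrite mem_rev mem_enum.
by rewrite -surjective_pairing enum_valK.
Qed.

Let fam_s i y : y \in s i -> fam y = i.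
Proof. by move=> /mapP[l _ ->]; rewrite /fam enum_rankK. Qed.

Let chF : fam_chain s F.
Proof.
move=> i; rewrite sorted_map rev_sorted.
have : sorted ltn (map val (enum 'I_L)) by rewrite val_enum_ord iota_ltn_sorted.
rewrite sorted_map; apply: sub_sorted => l l' /= ll'.
have -> : F (enum_rank (i, l')) = D (enum_rank (i, l')) *m F (enum_rank (i, l)).
  rewrite /F mulmxA /D /fam /lev !enum_rankK mulmx_diag; congr (diag_mx _ *m _).
  apply/rowP => j; rewrite !mxE -natrM mulnb; congr (_%:R)%R; congr nat_of_bool.
  by apply/idP/andP => [h|[]//]; split=> //; apply: leq_trans h; rewrite ltnS ltnW.
exact: submxMl.
Qed.

(** Were there a relation for all moves and vectors, some [H] would satisfy r dim H < sum of dim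
    (F_y g ∩ H) with [g] as close to 1 as desired. But dim (F_y g ∩ H) is at most the trace of [P y]
    compressed to [H] plus a small error, and these traces add up to r dim H. So some choice has no
    relation, and the dimensions add up to n r. *)
Lemma hermitian_sum_full_rank :
  exists (A : I -> 'M[C]_n) (m : I -> nat -> 'rV[C]_r), (forall i, A i \in unitmx) /\
  forall phi : 'M[C]_(n, r), (forall i j l, (l < kap i j)%N ->
      row j (A i) *m phi *m (m i l)^T = 0) -> phi = 0.
Proof.
have [[g [m hgm]]|none] := pselect (exists g (m : 'M[C]_(N, r)),
    (\sum_y \rank (F y) <= tensor_rank (move_fam fam F g) m)%N); last first.
  exfalso.
  have hlt g (m : 'M[C]_(N, r)) : (tensor_rank (move_fam fam F g) m < \sum_y \rank (F y))%N.
    by rewrite ltnNge; apply/negP => h; apply: none; exists g, m.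
  pose c := 1 + \sum_y l1norm (1%:M - P y).
  have c1 : 1 <= c by rewrite lerDl sumr_ge0 // => y _; rewrite l1norm_ge0.
  have c0 : 0 < c by apply: lt_le_trans c1.
  (* Chosen so that each of the [N] errors is at most the square of 1/(N+1); their sum is then below
     1, too small for an integer to fit in. *)
  pose a : C := (n * n).+1%:R * c * N.+1%:R.
  have a1 : 1 <= a by rewrite !mulr_ege1 ?ler1n.
  have a0 : 0 < a by apply: lt_le_trans a1.
  have e0 : 0 < (2 * a)^-1 by rewrite invr_gt0 mulr_gt0.
  have [g [ug g1 [H hH]]] := destabilizing_subspace mem_s fam_s chF e0 hlt.
  have [UH uUH eUH] := unitary_basis H.
  have bnd y : (\rank (move_fam fam F g y :&: H)%MS)%:R <=
     \tr (UH *m P y *m UH^t*) + N.+1%:R^-1 ^+ 2.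
    have gy : l1norm (g (fam y) - 1%:M) <= (2 * a)^-1 by apply/ltW/g1.
    apply: (rank_cap_le_frob (Ph y) (PP y) (FP y) (ug _) uUH eUH).
      apply: le_trans gy _; rewrite invfM ler_piMr ?invr_ge0 // invf_le1 //.
    have cy : l1norm (1%:M - P y) <= c.
      rewrite /c (bigD1 y) //= addrCA lerDl addr_ge0 // sumr_ge0 // => z _.
      by rewrite l1norm_ge0.
    apply: (@le_trans _ _ (2 * (n * n).+1%:R * (2 * a)^-1 * c)).
      rewrite ler_pM ?mulr_ge0 ?l1norm_ge0 ?ler0n // ler_pM ?mulr_ge0 ?l1norm_ge0 ?ler0n //.
      by rewrite ler_wpM2l // ler_nat.
    have n0 : (n * n).+1%:R != 0 :> C by rewrite pnatr_eq0.
    have N0 : N.+1%:R != 0 :> C by rewrite pnatr_eq0.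
    have cn0 : c != 0 by rewrite gt_eqF.
    rewrite le_eqVlt; apply/orP; left; apply/eqP; rewrite /a.
    move: n0 N0 cn0; move: ((n * n).+1%:R) (N.+1%:R) (c) => x y' z x0 y0 z0.
    by field; rewrite x0 y0 z0.
  have : (\sum_y \rank (move_fam fam F g y :&: H)%MS)%:R < (r * \rank H).+1%:R :> C.
    rewrite natr_sum; apply: le_lt_trans (ler_sum _ (fun y _ => bnd y)) _.
    rewrite big_split /= -raddf_sum -mulmx_suml -mulmx_sumr sumP /=.
    rewrite mul_mx_scalar -scalemxAl (unitarymxP uUH) mxtraceZ mxtrace1 -natrM -[ltRHS]natr1.
    rewrite ltrD2l sumr_const card_ord -[ltLHS]mulr_natl exprVn.
    rewrite ltr_pdivrMr ?exprn_gt0 ?ltr0n // mul1r -natrX ltr_nat.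
    by rewrite expnS expn1 mulSn ltn_addr.
  by rewrite ltr_nat ltnS leqNgt hH.
(* The moves found may be singular; a generic point of the line joining them to 1 keeps the rank and
   is invertible. *)
pose d i : 'M[C]_n := g i - 1%:M.
have G1 := generically_tensor_rank_fam fam F (fun=> 1%:M) d m 1.
have G2 : generically (fun t => forall i, 1%:M + t *: d i \in unitmx).
  apply: generically_forall => i; apply: (@generically_unit_line _ _ _ _ 0).
  by rewrite scale0r addr0 unitmx1.
have [t [t1 t2]] := generically_ex (generically_and G1 G2).
pose G i := 1%:M + t *: d i.
have full : tensor_rank (move_fam fam F G) m = (n * r)%N.
  apply/eqP; rewrite eqn_leq rank_leq_col /= -sumrankF; apply: leq_trans hgm _.
  apply: leq_trans t1; rewrite leq_eqVlt; apply/orP; left; apply/eqP.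
  by apply: eq_tensor_rank => y; rewrite /move_fam /d scale1r addrC subrK.
pose mm i (l : nat) : 'rV[C]_r :=
  if insub l is Some l' then row (enum_rank (i, l' : 'I_L)) m else 0.
exists (fun i => U i *m G i), mm; split.
  by move=> i; rewrite unitmx_mul t2 unitarymx_unit.
move=> phi hphi; have : pairing_ker (move_fam fam F G) m phi.
  apply/pairing_kerP => y; apply/row_matrixP => j; rewrite row0.
  rewrite /move_fam /F -!mulmxA row_mul /D row_diag_mx mxE -scalemxAl -rowE.
  case: (ltnP (lev y) (kap (fam y) j)) => [hl|_]; last by rewrite scale0r.
  rewrite scale1r; have := hphi (fam y) j (lev y) hl.
  rewrite /mm valK -surjective_pairing enum_valK => <-.
  by rewrite !row_mul !mulmxA.
rewrite /pairing_ker => h.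
have /row_fullP[B hB] : row_full (fam_mx (move_fam fam F G) *m pair_mx n m).
  by rewrite /row_full -/(tensor_rank _ _) full.
apply/trmx_inj/trmx_inj; rewrite !trmxK; apply: (can_inj mxvecK); apply: trmx_inj.
by rewrite linear0 trmx0 -[LHS]mul1mx -hB -mulmxA h mulmx0.
Qed.

End HermitianSum.

(** * Unitary frames in place of invertible ones *)

Section FullRank.
Variables (C : numClosedFieldType) (n r : nat).

(** The conditions depend only on the spans of the rows of [A] taken by decreasing [kap], the order
    given by [s], and Gram-Schmidt in that order preserves these spans. *)
Lemma schmidt_kernel (A : 'M[C]_n) (kap : 'I_n -> nat) (s : 'S_n)
    (m : nat -> 'rV[C]_r) :
  (forall j k : 'I_n, (j <= k)%N -> (kap (s k) <= kap (s j))%N) ->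
  exists2 W : 'M[C]_n, W \is unitarymx &
    forall phi : 'M[C]_(n, r),
    (forall (j : 'I_n) l, (l < kap j)%N -> row j W *m phi *m (m l)^T = 0) ->
    forall (j : 'I_n) l, (l < kap j)%N -> row j A *m phi *m (m l)^T = 0.
Proof.
move=> hs; pose S := schmidt (row_perm s A).
exists (row_perm s^-1 S).
  apply/unitarymxP; rewrite row_permE adjmxM -!mulmxA (mulmxA S).
  rewrite (unitarymxP (schmidt_unitarymx _ (leqnn n))) mul1mx.
  have -> : (perm_mx s^-1 : 'M[C]_n)^t* = perm_mx s.
    by rewrite tr_perm_mx map_perm_mx invgK.
  by rewrite -perm_mxM mulVg perm_mx1.
move=> phi' h j l lj.
have -> : row j A = row (s^-1 j)%g (row_perm s A).
  by apply/rowP => i; rewrite !mxE permKV.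
suff : (row (s^-1 j)%g (row_perm s A) <= kermx (phi' *m (m l)^T))%MS.
  by move/sub_kermxP; rewrite mulmxA.
apply: submx_trans (row_schmidt_sub _ _) _; apply/sumsmx_subP => k kj.
rewrite genmxE; apply/sub_kermxP; rewrite mulmxA.
have -> : row k (schmidt (row_perm s A)) = row (s k) (row_perm s^-1 S).
  by apply/rowP => i; rewrite !mxE permK.
by apply: h; apply: leq_trans lj _; have := hs _ _ kj; rewrite permKV.
Qed.

Theorem hermitian_sum_unitary_full_rank (I : finType) (U : I -> 'M[C]_n)
    (kap : I -> 'I_n -> nat) (s : I -> 'S_n) :
  (forall i, U i \is unitarymx) ->
  (forall i (j k : 'I_n), (j <= k)%N -> (kap i (s i k) <= kap i (s i j))%N) ->
  \sum_i (U i)^t* *m diag_mx (\row_j (kap i j)%:R) *m U i = r%:R%:M ->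
  exists (A : I -> 'M[C]_n) (m : I -> nat -> 'rV[C]_r), (forall i, A i \is unitarymx) /\
  forall phi : 'M[C]_(n, r), (forall i j l, (l < kap i j)%N ->
      row j (A i) *m phi *m (m i l)^T = 0) -> phi = 0.
Proof.
move=> uU hs hsum; have [A [m [_ hA]]] := hermitian_sum_full_rank uU hsum.
have hW i : {W : 'M[C]_n | W \is unitarymx & forall phi : 'M[C]_(n, r),
    (forall (j : 'I_n) l, (l < kap i j)%N -> row j W *m phi *m (m i l)^T = 0) ->
    forall (j : 'I_n) l, (l < kap i j)%N -> row j (A i) *m phi *m (m i l)^T = 0}.
  by apply: cid2; apply: (schmidt_kernel (A i) (m i) (hs i)).
exists (fun i => s2val (hW i)), m; split=> [i|phi hphi]; first exact: (s2valP (hW i)).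
by apply: hA => i; apply: (s2valP' (hW i)) => j l; apply: hphi.
Qed.

Lemma hermitian_sum_trace (I : finType) (U : I -> 'M[C]_n) (kap : I -> 'I_n -> nat) :
  (forall i, U i \is unitarymx) ->
  \sum_i (U i)^t* *m diag_mx (\row_j (kap i j)%:R) *m U i = r%:R%:M ->
  (\sum_i \sum_j kap i j = n * r)%N.
Proof.
move=> uU /(congr1 mxtrace); rewrite mxtrace_scalar linear_sum /= => e.
apply/eqP; rewrite -(eqr_nat C) natrM [_ * _]mulrC mulr_natr -e natr_sum; apply/eqP.
apply: eq_bigr => i _; rewrite mxtrace_mulC mulmxA (unitarymxP (uU i)) mul1mx.
by rewrite mxtrace_diag natr_sum; apply: eq_bigr => j _; rewrite mxE.
Qed.

End FullRank.

(** * First-order expansions without limits *)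

Section FirstOrder.
Variable C : numClosedFieldType.

(** A derivative at 0 with quadratic remainder: this is stable under products and linear maps, and
    only needs the order of the field. *)
Definition first_order m n (A : C -> 'M[C]_(m, n)) (A0 A1 : 'M[C]_(m, n)) :=
  exists2 c : C, 0 <= c & forall s, s \is Num.real -> `|s| <= 1 ->
    l1norm (A s - A0 - s *: A1) <= c * `|s| ^+ 2.

Lemma l1norm0 m n : l1norm (0 : 'M[C]_(m, n)) = 0.
Proof. by rewrite -(scale0r 0) l1normZ normr0 mul0r. Qed.

Lemma l1norm_eq0 m n (A : 'M[C]_(m, n)) : l1norm A <= 0 -> A = 0.
Proof.
move=> h; apply/matrixP => i j; rewrite mxE; apply/eqP; rewrite -normr_le0.
exact: le_trans (l1norm_ge A i j) h.
Qed.

Lemma first_order_uniq m n (A : C -> 'M[C]_(m, n)) A0 A1 A0' A1' :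
  first_order A A0 A1 -> first_order A A0' A1' -> A1 = A1'.
Proof.
move=> [c c0 hc] [c' c0' hc'].
have e0 : forall B0 B1 b, (forall s, s \is Num.real -> `|s| <= 1 ->
    l1norm (A s - B0 - s *: B1) <= b * `|s| ^+ 2) -> A 0 = B0.
  move=> B0 B1 b /(_ 0 (rpred0 _)); rewrite normr0 expr0n mulr0 scale0r subr0.
  by move=> /(_ ler01) /l1norm_eq0 /eqP; rewrite subr_eq0 => /eqP.
have := e0 _ _ _ hc; rewrite (e0 _ _ _ hc') => {e0} E; rewrite {}E in hc' *.
apply/eqP; rewrite -subr_eq0; apply/eqP/l1norm_eq0; set X := l1norm _.
have X0 : 0 <= X by apply: l1norm_ge0.
have bnd s : 0 < s -> s <= 1 -> X <= (c + c') * s.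
  move=> s0 s1; have sr : s \is Num.real by rewrite ger0_real // ltW.
  have s1' : `|s| <= 1 by rewrite gtr0_norm.
  have h : l1norm (s *: (A1 - A1')) <= (c + c') * `|s| ^+ 2.
    have -> : s *: (A1 - A1') = (A s - A0 - s *: A1') - (A s - A0 - s *: A1).
      by rewrite scalerBr opprB [RHS]addrC subrKA.
    apply: le_trans (ler_l1normD _ _) _; rewrite l1normN mulrDl addrC lerD //.
      exact: hc.
    exact: hc'.
  by move: h; rewrite l1normZ gtr0_norm // -/X expr2 mulrA mulrC ler_pM2r.
apply: contraT => Xp; have {}Xp : 0 < X by rewrite lt_def X0 andbT; apply: contra Xp => /eqP ->.
have D0 : 0 < (c + c') + (X + 1) by rewrite ltr_wpDl ?addr_ge0 // addr_gt0.
have le1 : X / ((c + c') + (X + 1)) <= 1.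
  by rewrite ler_pdivrMr // mul1r addrCA lerDl !addr_ge0.
(* With [s = X / (c + c' + X + 1)] the bound [X <= (c + c') * s] fails as soon as [X] is
   positive. *)
have := bnd _ (divr_gt0 Xp D0) le1.
rewrite mulrCA -[leLHS]mulr1 ler_pM2l // ler_pdivlMr // mul1r -subr_ge0 opprD addrA subrr sub0r.
by rewrite oppr_ge0 => /(lt_le_trans (addr_gt0 Xp ltr01)); rewrite ltxx.
Qed.

Lemma first_order_const m n (A : 'M[C]_(m, n)) : first_order (fun=> A) A 0.
Proof.
by exists 0 => // s _ _; rewrite subrr scaler0 subr0 l1norm0 mul0r.
Qed.

Lemma mul_first_order_expand m n p (dA A0 A1 : 'M[C]_(m, n)) (dB B0 B1 : 'M[C]_(n, p)) s :
  (dA + (A0 + s *: A1)) *m (dB + (B0 + s *: B1)) - A0 *m B0 - s *: (A0 *m B1 + A1 *m B0)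
  = dA *m (dB + (B0 + s *: B1)) + A0 *m dB + s ^+ 2 *: (A1 *m B1) + s *: (A1 *m dB).
Proof.
rewrite !(mulmxDl, mulmxDr) -!scalemxAl -!scalemxAr.
move: (dA *m dB) (dA *m B0) (dA *m B1) (A0 *m dB) (A0 *m B0) (A0 *m B1).
move: (A1 *m dB) (A1 *m B0) (A1 *m B1) => x1 x2 x3 x4 x5 x6 x7 x8 x9.
by apply/matrixP => i j; rewrite !mxE; ring.
Qed.

Lemma first_order_mul m n p A A0 A1 B B0 B1 :
  @first_order m n A A0 A1 -> @first_order n p B B0 B1 ->
  first_order (fun s => A s *m B s) (A0 *m B0) (A0 *m B1 + A1 *m B0).
Proof.
move=> [a a0 hA] [b b0 hB].
exists (a * (l1norm B0 + l1norm B1 + b) + l1norm A0 * b + l1norm A1 * l1norm B1 + l1norm A1 * b).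
  by rewrite !addr_ge0 // !mulr_ge0 ?addr_ge0 ?l1norm_ge0.
move=> s sr s1; have := hB s sr s1; have := hA s sr s1.
set dA := _ - _ - _ => ha; set dB := _ - _ - _ => hb.
have eA : A s = dA + (A0 + s *: A1) by rewrite /dA (addrC A0) addrA !subrK.
have eB : B s = dB + (B0 + s *: B1) by rewrite /dB (addrC B0) addrA !subrK.
have s2 : `|s| ^+ 2 <= 1 by rewrite expr_le1.
have nB : l1norm (B s) <= l1norm B0 + l1norm B1 + b.
  rewrite eB addrC; apply: le_trans (ler_l1normD _ _) _; apply: lerD.
    apply: le_trans (ler_l1normD _ _) _; rewrite lerD2l l1normZ ler_piMl ?l1norm_ge0 //.
  by apply: le_trans hb _; rewrite ler_piMr.
have -> : A s *m B s - A0 *m B0 - s *: (A0 *m B1 + A1 *m B0) =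
   dA *m B s + A0 *m dB + s ^+ 2 *: (A1 *m B1) + s *: (A1 *m dB).
  by rewrite eA eB mul_first_order_expand.
have sq : s ^+ 2 = `|s| ^+ 2 by rewrite real_normK.
rewrite !mulrDl; apply: le_trans (ler_l1normD _ _) _; apply: lerD.
  apply: le_trans (ler_l1normD _ _) _; apply: lerD.
    apply: le_trans (ler_l1normD _ _) _; apply: lerD; apply: le_trans (ler_l1normM _ _) _.
      rewrite mulrAC ler_pM ?l1norm_ge0 //.
    by rewrite -mulrA ler_wpM2l ?l1norm_ge0.
  by rewrite l1normZ normrX mulrC ler_wpM2r ?exprn_ge0 // ler_l1normM.
rewrite l1normZ -mulrA; apply: le_trans (_ : l1norm (A1 *m dB) <= _).
  by rewrite ler_piMl ?l1norm_ge0.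
by apply: le_trans (ler_l1normM _ _) _; rewrite ler_wpM2l ?l1norm_ge0.
Qed.

Lemma first_order_ext m n (A B : C -> 'M[C]_(m, n)) A0 A1 :
  (forall s, s \is Num.real -> A s = B s) -> first_order A A0 A1 -> first_order B A0 A1.
Proof. by move=> e [c c0 h]; exists c => // s sr s1; rewrite -e //; apply: h. Qed.

Lemma first_order_adj m n (A : C -> 'M[C]_(m, n)) A0 A1 :
  first_order A A0 A1 -> first_order (fun s => (A s)^t*) (A0^t*) (A1^t*).
Proof.
have l1adj (X : 'M[C]_(m, n)) : l1norm (X^t*) = l1norm X.
  rewrite /l1norm exchange_big; apply: eq_bigr => i _; apply: eq_bigr => j _.
  by rewrite !mxE norm_conjC.
move=> [c c0 h]; exists c => // s sr s1; apply: le_trans (h s sr s1).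
rewrite -l1adj le_eqVlt; apply/orP; left; apply/eqP; congr l1norm.
by apply/matrixP => i j; rewrite !mxE !(rmorphB, rmorphM) /= (CrealP sr).
Qed.

Lemma first_order_linear m n p q (f : {linear 'M[C]_(m, n) -> 'M[C]_(p, q)}) A A0 A1 :
  first_order A A0 A1 -> first_order (fun s => f (A s)) (f A0) (f A1).
Proof.
have bnd (X : 'M_(m, n)) : l1norm (f X) <= (\sum_i \sum_j l1norm (f (delta_mx i j))) * l1norm X.
  have hD (I : finType) (F : I -> 'M[C]_(p, q)) : l1norm (\sum_i F i) <= \sum_i l1norm (F i).
    elim/big_ind2: _ => [|A' a B b hA hB|//]; first by rewrite l1norm0.
    by apply: le_trans (ler_l1normD _ _) _; rewrite lerD.
  rewrite {1}[X]matrix_sum_delta linear_sum; apply: le_trans (hD _ _) _.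
  rewrite mulr_suml; apply: ler_sum => i _; rewrite linear_sum; apply: le_trans (hD _ _) _.
  rewrite mulr_suml; apply: ler_sum => j _; rewrite linearZ l1normZ mulrC.
  by rewrite ler_wpM2l ?l1norm_ge0 // l1norm_ge.
move=> [c c0 h]; exists ((\sum_i \sum_j l1norm (f (delta_mx i j))) * c).
  by rewrite mulr_ge0 // sumr_ge0 // => i _; rewrite sumr_ge0 // => j _; rewrite l1norm_ge0.
move=> s sr s1; rewrite -linearZ -!linearB /=; apply: le_trans (bnd _) _.
rewrite -mulrA ler_wpM2l ?h // sumr_ge0 // => i _.
by rewrite sumr_ge0 // => j _; rewrite l1norm_ge0.
Qed.

Local Notation ii := ('i : C).

(** A rational parametrization of the unit circle that agrees with exp(i x) to first order at 0,
    available over any [numClosedFieldType]. *)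
Definition cayley (x : C) : C := (1 + ii * x / 2) / (1 - ii * x / 2).

Lemma cayley_den x : x \is Num.real -> `|1 - ii * x / 2| >= 1.
Proof.
move=> xr; rewrite -(@expr_ge1 _ 2) // normCK rmorphB rmorph1 !rmorphM /= conjCi (CrealP xr).
rewrite fmorphV /= conjC_nat.
have -> : (1 - ii * x / 2) * (1 - - ii * x / 2) = 1 - ii ^+ 2 * (x / 2) ^+ 2 by field.
by rewrite sqrCi mulN1r opprK lerDl real_exprn_even_ge0 // realM // realV realn.
Qed.

Lemma cayley_den_neq0 x : x \is Num.real -> 1 - ii * x / 2 != 0.
Proof.
move=> xr; rewrite -normr_eq0 gt_eqF //; exact: lt_le_trans ltr01 (cayley_den xr).
Qed.

Lemma cayley_den2_neq0 x : x \is Num.real -> 2 - ii * x != 0.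
Proof.
move=> /cayley_den_neq0; apply: contra => /eqP h.
have -> : 1 - ii * x / 2 = (2 - ii * x) / 2 by field.
by rewrite h mul0r.
Qed.

Lemma norm_cayley x : x \is Num.real -> `|cayley x| = 1.
Proof.
move=> xr; have n0 := cayley_den_neq0 xr; rewrite /cayley normrM normfV.
have -> : 1 + ii * x / 2 = (1 - ii * x / 2)^*.
  by rewrite rmorphB rmorph1 !rmorphM /= conjCi (CrealP xr) fmorphV /= conjC_nat !mulNr opprK.
by rewrite norm_conjC mulfV // normr_eq0.
Qed.

Lemma cayley_sub1 x : x \is Num.real -> `|cayley x - 1| <= `|x|.
Proof.
move=> xr; have n0 := cayley_den_neq0 xr.
have -> : cayley x - 1 = ii * x / (1 - ii * x / 2) by rewrite /cayley; field; rewrite ?cayley_den2_neq0.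
rewrite !normrM normCi mul1r normfV ler_piMr //.
by rewrite invf_le1 ?cayley_den // (lt_le_trans ltr01 (cayley_den xr)).
Qed.

Lemma cayley_first_order x : x \is Num.real -> `|cayley x - 1 - ii * x| <= `|x| ^+ 2.
Proof.
move=> xr; have n0 := cayley_den_neq0 xr.
have -> : cayley x - 1 - ii * x = (ii * x) ^+ 2 / 2 / (1 - ii * x / 2).
  by rewrite /cayley; field; rewrite ?cayley_den2_neq0.
rewrite normrM normfV normrM normfV normrX normrM normCi mul1r -mulrA ler_piMr ?exprn_ge0 //.
apply: mulr_ile1; rewrite ?invr_ge0 //.
  by rewrite invf_le1 ger0_norm ?ler1n ?ltr0n.
by rewrite invf_le1 ?cayley_den // (lt_le_trans ltr01 (cayley_den xr)).
Qed.

(** For natural exponents the constant [k ^ 2] comes from induction. A negative exponent is reduced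
    to the inverse of [t], and replacing the inverse minus 1 by [- (t - 1)] costs the extra
    [|k|]. *)
Lemma exprz_first_order (t : C) (k : int) : `|t| = 1 ->
  `|exprz t k - 1 - k%:~R * (t - 1)| <= (`|k| ^ 2 + `|k|)%N%:R * `|t - 1| ^+ 2.
Proof.
have nat_case (u : C) (m : nat) : `|u| = 1 ->
    `|u ^+ m - 1 - m%:R * (u - 1)| <= (m ^ 2)%:R * `|u - 1| ^+ 2.
  move=> u1; elim: m => [|m IH]; first by rewrite expr0 subrr mul0r subr0 normr0 mul0r.
  have -> : u ^+ m.+1 - 1 - m.+1%:R * (u - 1) =
            u * (u ^+ m - 1 - m%:R * (u - 1)) + m%:R * (u - 1) ^+ 2.
    by rewrite exprS; ring.
  apply: le_trans (ler_normD _ _) _; rewrite normrM u1 mul1r [X in _ + X]normrM normrX.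
  apply: le_trans (lerD IH (lexx _)) _; rewrite -mulrDl ler_wpM2r ?exprn_ge0 //.
  by rewrite ger0_norm // -natrD ler_nat; lia.
move=> t1; have t0 : t != 0 by rewrite -normr_eq0 t1 oner_eq0.
case: k => m.
  apply: le_trans (nat_case t m t1) _; rewrite ler_wpM2r ?exprn_ge0 // ler_nat leq_addr //.
rewrite NegzE abszN absz_nat; set q := m.+1; have u1 : `|t^-1| = 1 by rewrite normfV t1 invr1.
have -> : exprz t (- q%:Z) - 1 - (- q%:Z)%:~R * (t - 1) =
   (t^-1 ^+ q - 1 - q%:R * (t^-1 - 1)) + q%:R * ((t - 1) ^+ 2 * t^-1).
  have -> : exprz t (- q%:Z) = t^-1 ^+ q by rewrite exprVn.
  by rewrite mulrNz -pmulrn; field.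
apply: le_trans (ler_normD _ _) _; apply: le_trans (lerD (nat_case _ q u1) (lexx _)) _.
have -> : `|t^-1 - 1| = `|t - 1|.
  have -> : t^-1 - 1 = - (t - 1) * t^-1 by field.
  by rewrite normrM u1 mulr1 normrN.
by rewrite [X in _ + X]normrM normrM normrX u1 mulr1 ger0_norm // -mulrDl natrD.
Qed.

End FirstOrder.

(** * Circle subgroups and their generators *)

Section Generators.
Variable C : numClosedFieldType.
Local Notation ii := ('i : C).

Definition circle_pow d (P : 'M[C]_d) (kap : 'I_d -> int) (t : C) : 'M[C]_d :=
  P^t* *m diag_mx (\row_a exprz t (kap a)) *m P.

(** The Hermitian generator of [circle_pow]: the derivative with respect to the angle is ['i] times
    it. *)
Definition circle_gen d (P : 'M[C]_d) (kap : 'I_d -> int) : 'M[C]_d :=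
  P^t* *m diag_mx (\row_a (kap a)%:~R) *m P.

Lemma l1norm_diag_mx d (D : 'rV[C]_d) : l1norm (diag_mx D) = \sum_a `|D 0 a|.
Proof.
apply: eq_bigr => i _; rewrite (bigD1 i) //= mxE eqxx mulr1n big1 ?addr0 // => j ji.
by rewrite mxE eq_sym (negPf ji) mulr0n normr0.
Qed.

Lemma circle_pow_sub1 d (P : 'M[C]_d) kap t : P \is unitarymx ->
  circle_pow P kap t - 1%:M = P^t* *m diag_mx (\row_a (exprz t (kap a) - 1)) *m P.
Proof.
move=> uP; have -> : \row_a (exprz t (kap a) - 1) = \row_a exprz t (kap a) - const_mx 1 :> 'rV[C]_d.
  by apply/rowP => a; rewrite !mxE.
rewrite linearB /= mulmxBr mulmxBl diag_const_mx mulmx1 adjmx_unitary //.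
Qed.

Lemma first_order_circle_pow d (P : 'M[C]_d) kap c :
  P \is unitarymx -> c \is Num.real ->
  first_order (fun s => circle_pow P kap (cayley (c * s))) 1%:M ((ii * c) *: circle_gen P kap).
Proof.
move=> uP cr.
pose b a : C := (`|kap a| ^ 2 + `|kap a|)%N%:R * `|c| ^+ 2 + `|(kap a)%:~R| * `|c| ^+ 2.
exists (l1norm (P^t*) * (\sum_a b a) * l1norm P).
  rewrite !mulr_ge0 ?l1norm_ge0 // sumr_ge0 // => a _.
  by rewrite addr_ge0 // mulr_ge0 ?exprn_ge0.
move=> s sr s1; set t := cayley _; have csr : c * s \is Num.real by apply: rpredM.
have t1 : `|t| = 1 by exact: norm_cayley.
rewrite circle_pow_sub1 // /circle_gen.
pose D : 'rV[C]_d := \row_a (exprz t (kap a) - 1 - s * (ii * c * (kap a)%:~R)).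
have -> : P^t* *m diag_mx (\row_a (exprz t (kap a) - 1)) *m P
   - s *: ((ii * c) *: (P^t* *m diag_mx (\row_a (kap a)%:~R) *m P)) = P^t* *m diag_mx D *m P.
  rewrite scalerA scalemxAl scalemxAr -mulmxBl -mulmxBr -linearZ -linearB /=.
  by congr (_ *m diag_mx _ *m _); apply/rowP => a; rewrite !mxE -!mulrA.
apply: le_trans (ler_l1normM _ _) _; rewrite [leRHS]mulrAC ler_wpM2r ?l1norm_ge0 //.
apply: le_trans (ler_l1normM _ _) _; rewrite -mulrA ler_wpM2l ?l1norm_ge0 //.
rewrite l1norm_diag_mx mulr_suml; apply: ler_sum => a _; rewrite mxE.
have -> : exprz t (kap a) - 1 - s * (ii * c * (kap a)%:~R) =
   (exprz t (kap a) - 1 - (kap a)%:~R * (t - 1)) + (kap a)%:~R * (t - 1 - ii * (c * s)) by ring.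
have e : `|c| ^+ 2 * `|s| ^+ 2 = `|c * s| ^+ 2 by rewrite normrM exprMn.
apply: le_trans (ler_normD _ _) _.
rewrite /b mulrDl -[X in _ <= X + _]mulrA -[X in _ <= _ + X]mulrA e.
apply: lerD.
  apply: le_trans (exprz_first_order _ t1) _; rewrite ler_wpM2l // lerXn2r ?nnegrE //.
  exact: cayley_sub1.
by rewrite normrM ler_wpM2l // cayley_first_order.
Qed.

Lemma circle_gen_adj d (P : 'M[C]_d) kap : (circle_gen P kap)^t* = circle_gen P kap.
Proof.
rewrite /circle_gen !adjmxM trmxCK tr_diag_mx map_diag_mx mulmxA.
congr (_ *m diag_mx _ *m _); apply/rowP => a; rewrite !mxE.
by rewrite rmorph_int.
Qed.

Definition unit_cV n (u : 'cV[C]_n) := u^t* *m u = 1%:M.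

(** For a unit vector [u], multiplication by [t] on the line of [u] and the identity on its
    orthogonal. These elements generate U(n), and their generators [u *m u^t*] span all matrices. *)
Definition circle_of n (u : 'cV[C]_n) t : 'M[C]_n := 1%:M + (t - 1) *: (u *m u^t*).

Lemma circle_of_mul n (u : 'cV[C]_n) s t : unit_cV u ->
  circle_of u s *m circle_of u t = circle_of u (s * t).
Proof.
move=> u1; rewrite /circle_of mulmxDl mul1mx mulmxDr mulmx1 -scalemxAl -scalemxAr.
have -> : u *m u^t* *m (u *m u^t*) = u *m u^t*.
  by rewrite !mulmxA -(mulmxA u) u1 mulmx1.
rewrite scalerA -addrA; congr (_ + _); rewrite -!scalerDl; congr (_ *: _); ring.
Qed.

Lemma circle_of1 n (u : 'cV[C]_n) : circle_of u 1 = 1%:M.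
Proof. by rewrite /circle_of subrr scale0r addr0. Qed.

Lemma unitary_circle_of n (u : 'cV[C]_n) t : unit_cV u -> `|t| = 1 ->
  circle_of u t \is unitarymx.
Proof.
move=> u1 t1; apply/unitarymxP.
have -> : (circle_of u t)^t* = circle_of u (t^*).
  rewrite /circle_of linearD linearZ /= map_mxD map_mxZ /= adjmx1 adjmxM trmxCK.
  by rewrite rmorphB /= conjC1.
by rewrite circle_of_mul // -normCK t1 expr1n circle_of1.
Qed.

Lemma circle_of_conj n (h : 'M[C]_n) (u : 'cV[C]_n) t : h \is unitarymx ->
  h *m circle_of u t *m h^t* = circle_of (h *m u) t.
Proof.
move=> uh; rewrite /circle_of mulmxDr mulmx1 mulmxDl (unitarymxP uh); congr (_ + _).
by rewrite -scalemxAr -scalemxAl adjmxM !mulmxA.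
Qed.

Lemma unit_cV_mul n (h : 'M[C]_n) (u : 'cV[C]_n) : h \is unitarymx -> unit_cV u ->
  unit_cV (h *m u).
Proof.
by move=> uh u1; rewrite /unit_cV adjmxM mulmxA -(mulmxA (u^t*)) adjmx_unitary // mulmx1.
Qed.

Lemma first_order_circle_of n (u : 'cV[C]_n) c : c \is Num.real ->
  first_order (fun s => circle_of u (cayley (c * s))) 1%:M ((ii * c) *: (u *m u^t*)).
Proof.
move=> cr; exists (`|c| ^+ 2 * l1norm (u *m u^t*)); first by rewrite mulr_ge0 ?exprn_ge0 ?l1norm_ge0.
move=> s sr s1; rewrite /circle_of [X in l1norm (X - _)]addrAC subrr add0r scalerA -scalerBl l1normZ.
rewrite mulrAC -exprMn -normrM ler_wpM2r ?l1norm_ge0 //.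
have -> : s * (ii * c) = ii * (c * s) by ring.
by apply: cayley_first_order; rewrite rpredM.
Qed.

Lemma unitary_diagonalize n (g : 'M[C]_n) : g \is unitarymx ->
  exists P (t : 'rV[C]_n), [/\ P \is unitarymx, (forall a, `|t 0 a| = 1) &
    g = P^t* *m diag_mx t *m P].
Proof.
move=> ug; have /orthomx_spectralP : g \is normalmx.
  by apply/normalmxP; rewrite (unitarymxP ug) adjmx_unitary.
set P := spectralmx g; set t := spectral_diag g => e.
have uP : P \is unitarymx by exact: spectral_unitarymx.
rewrite invmx_unitary // in e; exists P, t; split=> // a.
have : diag_mx t \is unitarymx.
  have -> : diag_mx t = P *m g *m P^t*.
    by rewrite e !mulmxA (unitarymxP uP) mul1mx -mulmxA (unitarymxP uP) mulmx1.
  by rewrite !mul_unitarymx ?trmxC_unitary.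
move=> /unitarymxP /matrixP /(_ a a); rewrite tr_diag_mx map_diag_mx mulmx_diag !mxE eqxx !mulr1n.
by rewrite -normCK => /eqP; rewrite sqrp_eq1 // => /eqP.
Qed.

Lemma diag_mx_circle_of n (t : 'rV[C]_n) :
  diag_mx t = \big[mulmx/1%:M]_(a < n) circle_of (delta_mx a 0) (t 0 a).
Proof.
have cE (a : 'I_n) x : circle_of (delta_mx a 0) x = diag_mx (\row_b (if b == a then x else 1)).
  apply/matrixP => i j; rewrite !mxE big_ord1 !mxE !eqxx !andbT conjC_nat.
  have [<-|ij] := eqVneq i j; last first.
    rewrite /= !mulr0n add0r; have [ia|_] := eqVneq i a; have [ja|_] := eqVneq j a; rewrite /= ?mulr0 ?mul0r ?mulr0 //.
    by rewrite ia ja eqxx in ij.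
  rewrite /= ?mulr1n; case: (i == a); rewrite /= ?mulr1 ?mulr0 ?addr0 //. by rewrite addrC subrK.
under eq_bigr do rewrite cE.
suff H (s : seq 'I_n) : uniq s -> \big[mulmx/1%:M]_(a <- s) diag_mx (\row_b (if b == a then t 0 a else 1))
   = diag_mx (\row_b (if b \in s then t 0 b else 1)).
  rewrite H ?index_enum_uniq //; congr diag_mx.
  by apply/rowP => b; rewrite mxE mem_index_enum.
elim: s => [|a s IH] /=.
  by rewrite big_nil => _; rewrite -diag_const_mx; congr diag_mx; apply/rowP => b; rewrite !mxE.
move=> /andP[as_ us]; rewrite big_cons IH // mulmx_diag; congr diag_mx.
apply/rowP => b; rewrite !mxE inE; have [->|_] /= := eqVneq b a; last by rewrite mul1r.
by rewrite (negPf as_) mulr1.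
Qed.

End Generators.

Lemma l1norm_unitarymxl (C : numClosedFieldType) m n p (P : 'M[C]_(m, n)) (A : 'M[C]_(n, p)) :
  P \is unitarymx -> l1norm (P *m A) <= (m * n)%:R * l1norm A.
Proof.
move=> uP; apply: le_trans (ler_l1normM _ _) _.
by rewrite ler_wpM2r ?l1norm_ge0 // l1norm_unitarymx.
Qed.

Lemma l1norm_unitarymxr (C : numClosedFieldType) m n p (A : 'M[C]_(m, n)) (P : 'M[C]_(n, p)) :
  P \is unitarymx -> l1norm (A *m P) <= (n * p)%:R * l1norm A.
Proof.
move=> uP; apply: le_trans (ler_l1normM _ _) _.
by rewrite mulrC ler_wpM2r ?l1norm_ge0 // l1norm_unitarymx.
Qed.

Lemma circle_pow_lipschitz (C : numClosedFieldType) d (P : 'M[C]_d) kap : P \is unitarymx ->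
  exists2 c : C, 0 <= c & forall t, `|t| = 1 -> l1norm (circle_pow P kap t - 1%:M) <= c * `|t - 1|.
Proof.
move=> uP; pose b a : C := 2 * (`|kap a| ^ 2 + `|kap a|)%N%:R + `|(kap a)%:~R|.
exists ((d * d)%:R * ((d * d)%:R * \sum_a b a)).
  by rewrite !mulr_ge0 // sumr_ge0 // => a _; rewrite addr_ge0 // mulr_ge0.
move=> t t1; rewrite circle_pow_sub1 // -!mulrA.
apply: le_trans (l1norm_unitarymxr _ uP) _; rewrite ler_wpM2l //.
apply: le_trans (l1norm_unitarymxl _ _) _; first by rewrite trmxC_unitary.
rewrite ler_wpM2l // l1norm_diag_mx mulr_suml; apply: ler_sum => a _; rewrite mxE.
have -> : exprz t (kap a) - 1 = (exprz t (kap a) - 1 - (kap a)%:~R * (t - 1)) + (kap a)%:~R * (t - 1).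
  by rewrite subrK.
apply: le_trans (ler_normD _ _) _; rewrite /b mulrDl lerD ?normrM //.
apply: le_trans (exprz_first_order _ t1) _; rewrite expr2 mulrA ler_wpM2r //.
rewrite mulrC ler_wpM2r //; apply: le_trans (ler_normB _ _) _.
by rewrite t1 normr1.
Qed.

Lemma prod_unitarymx (C : numClosedFieldType) d (T : Type) (s : seq T) (A : T -> 'M[C]_d) :
  (forall k, A k \is unitarymx) -> \big[mulmx/1%:M]_(k <- s) A k \is unitarymx.
Proof.
move=> uA; elim/big_ind: _ => // [|X Y]; last exact: mul_unitarymx.
by apply/unitarymxP; rewrite adjmx1 mulmx1.
Qed.

Lemma prod_unitarymx_sub1 (C : numClosedFieldType) d (T : Type) (s : seq T) (A : T -> 'M[C]_d) :
  (forall k, A k \is unitarymx) ->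
  l1norm (\big[mulmx/1%:M]_(k <- s) A k - 1%:M) <= (d * d)%:R * \sum_(k <- s) l1norm (A k - 1%:M).
Proof.
move=> uA; elim: s => [|k s IH].
  by rewrite !big_nil subrr l1norm0 mulr0.
rewrite !big_cons mulrDr; set B := \big[_/_]_(_ <- _) _ in IH *.
have -> : A k *m B - 1%:M = (A k - 1%:M) *m B + (B - 1%:M).
  by rewrite mulmxBl mul1mx addrA subrK.
apply: le_trans (ler_l1normD _ _) _; rewrite lerD //.
by apply: l1norm_unitarymxr; apply: prod_unitarymx.
Qed.

(** The algebraic substitute for continuity: every circle subgroup acts diagonally with integer
    exponents. Continuous representations satisfy it by [unitary_rep_circle_diagonal]. *)
Definition circle_diagonal (C : numClosedFieldType) n d (rho : 'M[C]_n -> 'M[C]_d) :=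
  [/\ forall g, g \is unitarymx -> rho g \is unitarymx,
      rho 1%:M = 1%:M,
      forall g h, g \is unitarymx -> h \is unitarymx -> rho (g *m h) = rho g *m rho h
    & forall u : 'cV[C]_n, unit_cV u -> exists P : 'M[C]_d, exists2 kap : 'I_d -> int,
        P \is unitarymx & forall t, `|t| = 1 -> rho (circle_of u t) = circle_pow P kap t].

(** * The derivative of a representation *)

Section Infinitesimal.
Variables (C : numClosedFieldType) (n d : nat) (rho : 'M[C]_n -> 'M[C]_d).
Hypothesis rhoC : circle_diagonal rho.
Local Notation ii := ('i : C).

Let rho_u : forall g, g \is unitarymx -> rho g \is unitarymx. Proof. by case: rhoC. Qed.
Let rho1 : rho 1%:M = 1%:M. Proof. by case: rhoC. Qed.
Let rhoM : forall g h, g \is unitarymx -> h \is unitarymx -> rho (g *m h) = rho g *m rho h.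
Proof. by case: rhoC. Qed.

Lemma rho_prod (T : Type) (s : seq T) (A : T -> 'M[C]_n) : (forall k, A k \is unitarymx) ->
  rho (\big[mulmx/1%:M]_(k <- s) A k) = \big[mulmx/1%:M]_(k <- s) rho (A k).
Proof.
move=> uA; elim: s => [|k s IH]; rewrite ?big_nil // !big_cons rhoM ?IH //.
exact: prod_unitarymx.
Qed.

Lemma rho_adj g : g \is unitarymx -> rho (g^t*) = (rho g)^t*.
Proof.
move=> ug; have ug' : g^t* \is unitarymx by rewrite trmxC_unitary.
have := rhoM ug ug'; rewrite (unitarymxP ug) rho1 => /(congr1 (mulmx ((rho g)^t*))).
by rewrite mulmx1 mulmxA adjmx_unitary ?rho_u // mul1mx.
Qed.

Lemma unit_delta (k : 'I_n) : unit_cV (delta_mx k 0 : 'cV[C]_n).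
Proof.
apply/matrixP => i j; rewrite !ord1 !mxE (bigD1 k) //= big1 => [|l lk].
  by rewrite !mxE !eqxx /= conjC1 mulr1 addr0.
by rewrite !mxE (negPf lk) mulr0.
Qed.

(** After diagonalization [g] is a product of coordinate circle elements up to unitary conjugation,
    and [rho] is Lipschitz on each of these circles. *)
Lemma rho_lipschitz : exists2 c : C, 0 <= c &
  forall g, g \is unitarymx -> l1norm (rho g - 1%:M) <= c * l1norm (g - 1%:M).
Proof.
have hk (k : 'I_n) : exists2 c : C, 0 <= c & forall t, `|t| = 1 ->
    l1norm (rho (circle_of (delta_mx k 0) t) - 1%:M) <= c * `|t - 1|.
  have [_ _ _ /(_ _ (unit_delta k))[P [kap uP h]]] := rhoC.
  by have [c c0 hc] := circle_pow_lipschitz kap uP; exists c => // t t1; rewrite h // hc.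
have [c c0 hc] := fin_all_exists2 hk.
pose N : C := (d * d)%:R; pose M : C := (n * n)%:R.
exists (N * (N * (N * ((\sum_k c k) * (M * M))))).
  by rewrite !mulr_ge0 // sumr_ge0.
move=> g ug; have [P [t [uP t1 ge]]] := unitary_diagonalize ug.
have uP' : P^t* \is unitarymx by rewrite trmxC_unitary.
have uD : diag_mx t \is unitarymx.
  rewrite diag_mx_circle_of prod_unitarymx // => k.
  by rewrite unitary_circle_of //; apply: unit_delta.
have -> : rho g - 1%:M = (rho P)^t* *m (rho (diag_mx t) - 1%:M) *m rho P.
  rewrite ge rhoM ?mul_unitarymx // rhoM // rho_adj // mulmxBr mulmx1 mulmxBl.
  by rewrite adjmx_unitary ?rho_u.
rewrite -!mulrA; apply: le_trans (l1norm_unitarymxr _ (rho_u uP)) _; rewrite ler_wpM2l //.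
apply: le_trans (l1norm_unitarymxl _ _) _; first by rewrite trmxC_unitary rho_u.
rewrite ler_wpM2l // diag_mx_circle_of rho_prod; last first.
  by move=> k; rewrite unitary_circle_of //; apply: unit_delta.
apply: le_trans (prod_unitarymx_sub1 _ _) _.
  by move=> k; rewrite rho_u // unitary_circle_of //; apply: unit_delta.
rewrite ler_wpM2l // mulr_suml; apply: ler_sum => k _.
apply: le_trans (hc k _ (t1 k)) _; rewrite ler_wpM2l //.
have -> : t 0 k - 1 = (diag_mx t - 1%:M) k k by rewrite !mxE eqxx mulr1n.
apply: le_trans (l1norm_ge _ _ _) _.
have -> : diag_mx t - 1%:M = P *m (g - 1%:M) *m P^t*.
  rewrite mulmxBr mulmx1 mulmxBl (unitarymxP uP) ge !mulmxA (unitarymxP uP) mul1mx.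
  by rewrite -mulmxA (unitarymxP uP) mulmx1.
apply: le_trans (l1norm_unitarymxr _ uP') _; rewrite ler_wpM2l //.
exact: l1norm_unitarymxl.
Qed.

Let genP (u : 'cV[C]_n) : exists K : 'M[C]_d, unit_cV u -> exists P : 'M[C]_d,
  exists2 kap : 'I_d -> int, P \is unitarymx & K = circle_gen P kap /\
    forall t, `|t| = 1 -> rho (circle_of u t) = circle_pow P kap t.
Proof.
have [u1|nu] := pselect (unit_cV u); last by exists 0.
have [_ _ _ /(_ _ u1)[P [kap uP h]]] := rhoC.
by exists (circle_gen P kap) => _; exists P, kap.
Qed.

Definition line_gen (u : 'cV[C]_n) : 'M[C]_d := projT1 (cid (genP u)).

Lemma line_genP u : unit_cV u -> exists P : 'M[C]_d,
  exists2 kap : 'I_d -> int, P \is unitarymx & line_gen u = circle_gen P kap /\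
    forall t, `|t| = 1 -> rho (circle_of u t) = circle_pow P kap t.
Proof. exact: (projT2 (cid (genP u))). Qed.

Lemma line_gen_adj u : unit_cV u -> (line_gen u)^t* = line_gen u.
Proof. by move=> /line_genP[P [kap _ [-> _]]]; apply: circle_gen_adj. Qed.

Lemma first_order_rho_circle u c : unit_cV u -> c \is Num.real ->
  first_order (fun s => rho (circle_of u (cayley (c * s)))) 1%:M ((ii * c) *: line_gen u).
Proof.
move=> /line_genP[P [kap uP [-> h]]] cr.
apply: first_order_ext (first_order_circle_pow kap uP cr) => s sr.
by rewrite h // norm_cayley // rpredM.
Qed.

(** Conjugating the circle of [u] by [h] gives the circle of [h *m u]; uniqueness of first-order
    terms passes this to the generators. *)
Lemma line_gen_conj h u : h \is unitarymx -> unit_cV u ->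
  line_gen (h *m u) = rho h *m line_gen u *m (rho h)^t*.
Proof.
move=> uh u1; have u1' := unit_cV_mul uh u1.
have r1 : (1 : C) \is Num.real by exact: rpred1.
have := first_order_rho_circle u1' r1; rewrite mulr1 => h1.
have := first_order_mul (first_order_mul (first_order_const (rho h)) (first_order_rho_circle u1 r1))
          (first_order_const ((rho h)^t*)).
rewrite mulr1 !mulmx0 !mul0mx !addr0 add0r => h2.
have h3 := first_order_uniq h1 (first_order_ext _ h2).
have : ii *: line_gen (h *m u) = ii *: (rho h *m line_gen u *m (rho h)^t*).
  rewrite h3 -?scalemxAr -?scalemxAl // => s sr.
  have t1 : `|cayley (1 * s)| = 1 by rewrite norm_cayley // rpredM.
  rewrite -rho_adj // -rhoM ?unitary_circle_of // -rhoM ?mul_unitarymx ?unitary_circle_of ?trmxC_unitary //.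
  by rewrite circle_of_conj.
by move/scalerI; apply; apply: neq0Ci.
Qed.

(* [infinitesimal X Z]: Z is the value at X forced by linearity from the generators
   of the circle subgroups. *)
Definition infinitesimal (X : 'M[C]_n) (Z : 'M[C]_d) := exists s : seq (C * 'cV[C]_n),
  [/\ forall p, p \in s -> unit_cV p.2, X = \sum_(p <- s) p.1 *: (p.2 *m p.2^t*)
    & Z = \sum_(p <- s) p.1 *: line_gen p.2].

(** The product [G x] of circle elements with parameters proportional to [x] has derivative 0, so
    [G x] is 1 up to a quadratic error. By [rho_lipschitz] so is [rho (G x)], whose derivative is
    the combination of the generators. *)
Let relation_real (s : seq (C * 'cV[C]_n)) :
  (forall p, p \in s -> unit_cV p.2 /\ p.1 \is Num.real) ->
  \sum_(p <- s) p.1 *: (p.2 *m p.2^t*) = 0 -> \sum_(p <- s) p.1 *: line_gen p.2 = 0.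
Proof.
move=> hs X0.
pose G x := \big[mulmx/1%:M]_(p <- s) circle_of p.2 (cayley (p.1 * x)).
have [uG [fG fR]] : (forall x, x \is Num.real -> G x \is unitarymx) /\
   first_order G 1%:M (ii *: \sum_(p <- s) p.1 *: (p.2 *m p.2^t*)) /\
   first_order (fun x => rho (G x)) 1%:M (ii *: \sum_(p <- s) p.1 *: line_gen p.2).
  rewrite /G {X0 G}; elim: s hs => [|p s IH] hs.
    split; first by move=> x _; rewrite big_nil; apply/unitarymxP; rewrite adjmx1 mulmx1.
    rewrite !big_nil scaler0; split; first by apply: first_order_ext (first_order_const _) => x _; rewrite big_nil.
    by rewrite scaler0; apply: first_order_ext (first_order_const _) => x _; rewrite big_nil rho1.
  have [u1 cr] := hs p (mem_head _ _).
  have [|uG [fG fR]] := IH; first by move=> q qs; apply: hs; rewrite inE qs orbT.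
  have uC x : x \is Num.real -> circle_of p.2 (cayley (p.1 * x)) \is unitarymx.
    by move=> xr; rewrite unitary_circle_of // norm_cayley // rpredM.
  split; first by move=> x xr; rewrite big_cons mul_unitarymx ?uC ?uG.
  rewrite !big_cons !scalerDr !scalerA; split.
    have := first_order_mul (first_order_circle_of p.2 cr) fG; rewrite mulmx1 !mul1mx mulmx1 addrC => h.
    by apply: first_order_ext h => x xr; rewrite big_cons.
  have := first_order_mul (first_order_rho_circle u1 cr) fR; rewrite mulmx1 !mul1mx mulmx1 addrC => h.
  by apply: first_order_ext h => x xr; rewrite big_cons rhoM ?uC ?uG.
rewrite X0 scaler0 in fG.
have fR0 : first_order (fun x => rho (G x)) 1%:M 0.
  have [c c0 hc] := rho_lipschitz; have [b b0 hb] := fG.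
  exists (c * b); first by rewrite mulr_ge0.
  move=> x xr x1; rewrite scaler0 subr0; apply: le_trans (hc _ (uG x xr)) _.
  by rewrite -mulrA ler_wpM2l //; have := hb x xr x1; rewrite scaler0 subr0.
have := first_order_uniq fR fR0 => /eqP.
by rewrite scaler_eq0 (negPf (neq0Ci _)) /= => /eqP.
Qed.

(** A complex relation and its adjoint yield relations with the real parts and with the imaginary
    parts of the coefficients, to which [relation_real] applies. *)
Lemma infinitesimal_inj0 Z : infinitesimal 0 Z -> Z = 0.
Proof.
move=> [s [us X0 ->]].
have adj0 : \sum_(p <- s) p.1^* *: (p.2 *m p.2^t*) = 0.
  transitivity ((\sum_(p <- s) p.1 *: (p.2 *m p.2^t*))^t*); last by rewrite -X0 trmx0 map_mx0.
  rewrite linear_sum raddf_sum; apply: eq_bigr => p _.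
  by rewrite linearZ /= map_mxZ /= adjmxM trmxCK.
have part (f : C -> C) : (forall c, f c \is Num.real) -> (exists a b, forall c, f c = a * c + b * c^*) ->
    \sum_(p <- s) f p.1 *: line_gen p.2 = 0.
  move=> fr [a [b fE]].
  have := relation_real (s := [seq (f p.1, p.2) | p <- s]); rewrite !big_map; apply.
    by move=> p /mapP[q qs ->] /=; split; [apply: us | apply: fr].
  transitivity (a *: \sum_(p <- s) p.1 *: (p.2 *m p.2^t*) + b *: \sum_(p <- s) p.1^* *: (p.2 *m p.2^t*)).
    rewrite !scaler_sumr -big_split; apply: eq_bigr => p _ /=.
    by rewrite !scalerA -scalerDl fE.
  by rewrite -X0 adj0 !scaler0 addr0.
transitivity (\sum_(p <- s) 'Re p.1 *: line_gen p.2 + ii *: \sum_(p <- s) 'Im p.1 *: line_gen p.2).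
  rewrite scaler_sumr -big_split; apply: eq_bigr => p _ /=.
  by rewrite scalerA -scalerDl -Crect.
have exRe : exists a b : C, forall c : C, 'Re c = a * c + b * c^*.
  by exists (1 / 2), (1 / 2) => c; rewrite ReE; field.
have exIm : exists a b : C, forall c : C, 'Im c = a * c + b * c^*.
  by exists (- ii / 2), (ii / 2) => c; rewrite ImE; field.
by rewrite (part _ (@Creal_Re C) exRe) (part _ (@Creal_Im C) exIm) scaler0 addr0.
Qed.

Lemma infinitesimalD a X Y Z W : infinitesimal X Z -> infinitesimal Y W ->
  infinitesimal (a *: X + Y) (a *: Z + W).
Proof.
move=> [s [us -> ->]] [s' [us' -> ->]].
exists ([seq (a * p.1, p.2) | p <- s] ++ s'); split.
- move=> p; rewrite mem_cat => /orP[/mapP[q qs ->]|]; [exact: (us q) | exact: us'].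
- rewrite big_cat big_map /= scaler_sumr; congr (_ + _).
  by apply: eq_bigr => p _; rewrite scalerA.
rewrite big_cat big_map /= scaler_sumr; congr (_ + _).
by apply: eq_bigr => p _; rewrite scalerA.
Qed.

Lemma infinitesimal_unit u : unit_cV u -> infinitesimal (u *m u^t*) (line_gen u).
Proof.
move=> u1; exists [:: (1, u)]; split; rewrite ?big_seq1 ?scale1r //.
by move=> p; rewrite inE => /eqP ->.
Qed.

Lemma infinitesimal_delta i j : exists Z, infinitesimal (delta_mx i j) Z.
Proof.
pose e (k : 'I_n) : 'cV[C]_n := delta_mx k 0.
have eadj k : (e k)^t* = delta_mx 0 k :> 'rV[C]_n.
  by apply/matrixP => a b; rewrite !mxE conjC_nat andbC.
have ee k l : e k *m (e l)^t* = delta_mx k l by rewrite eadj mul_delta_mx.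
have [<-|ij] := eqVneq i j.
  by exists (line_gen (e i)); rewrite -ee; apply: infinitesimal_unit; apply: unit_delta.
have dot k l : (e k)^t* *m e l = (k == l)%:R%:M.
  rewrite eadj; have [->|kl] := eqVneq k l; first by rewrite mul_delta_mx; apply/matrixP=> a b; rewrite !ord1 !mxE.
  by rewrite mul_delta_mx_0 // ; apply/matrixP => a b; rewrite !mxE mul0rn.
(* 3/5, 4/5 avoid square roots in the polarization identity *)
pose u (w : C) : 'cV[C]_n := 5^-1 *: (3 *: e i + (4 * w) *: e j).
have uadj w : (u w)^t* = 5^-1 *: (3 *: (e i)^t* + (4 * w^*) *: (e j)^t*).
  by rewrite /u linearZ /= linearD !linearZ /= map_mxZ map_mxD !map_mxZ /= rmorphM fmorphV /= !conjC_nat.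
have u1 w : `|w| = 1 -> unit_cV (u w).
  move=> w1; rewrite /unit_cV uadj -!scalemxAl !mulmxDl -!scalemxAl -!scalemxAr.
  rewrite !mulmxDr -!scalemxAr !dot !eqxx (negPf ij) eq_sym (negPf ij).
  apply/matrixP => a b; rewrite !ord1 !mxE /=.
  have ww : w^* * w = 1 by rewrite mulrC -normCK w1 expr1n.
  rewrite !(mulr1n, mulr0n, mulr0, addr0, add0r, mulr1).
  have -> : 5^-1 * (3 * (5^-1 * 3) + 4 * w^* * (5^-1 * (4 * w))) = (9 + 16 * (w^* * w)) / 25 :> C by field.
  by rewrite ww; field.
have inf w : `|w| = 1 -> infinitesimal (u w *m (u w)^t*) (line_gen (u w)).
  by move=> w1; apply/infinitesimal_unit/u1.
have inf0 : infinitesimal 0 0 by exists [::]; split; rewrite ?big_nil.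
have n1 : `|1 : C| = 1 by exact: normr1.
have ni : `|ii| = 1 by exact: normCi.
have nN1 : `|- 1 : C| = 1 by rewrite normrN1.
have nNi : `|- ii| = 1 by rewrite normrN.
exists ((25 / 48) *: line_gen (u 1) + ((25 / 48 * ii) *: line_gen (u ii) +
   ((- (25 / 48)) *: line_gen (u (- 1)) + ((- (25 / 48) * ii) *: line_gen (u (- ii)) + 0)))).
have -> : delta_mx i j = (25 / 48) *: (u 1 *m (u 1)^t*) + ((25 / 48 * ii) *: (u ii *m (u ii)^t*) +
   ((- (25 / 48)) *: (u (- 1) *m (u (- 1))^t*) + ((- (25 / 48) * ii) *: (u (- ii) *m (u (- ii))^t*) + 0))).
  have uu w : u w *m (u w)^t* = (25^-1) *: (9 *: delta_mx i i + (12 * w^*) *: delta_mx i j +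
      (12 * w) *: delta_mx j i + (16 * (w * w^*)) *: delta_mx j j).
    rewrite uadj -!scalemxAl !mulmxDl -!scalemxAl -!scalemxAr.
    rewrite !mulmxDr -!scalemxAr !ee.
    move: (delta_mx i i) (delta_mx i j) (delta_mx j i) (delta_mx j j) => x y z t.
    by apply/matrixP => a b; rewrite !mxE; field.
  rewrite !uu !rmorphN /= rmorph1 conjCi.
  move: (delta_mx i i) (delta_mx i j) (delta_mx j i) (delta_mx j j) => x y z t.
  have h : ii * ii = -1 by rewrite -expr2 sqrCi.
  apply/matrixP => a b; rewrite !mxE.
  have -> : 25 / 48 * ii * (25^-1 * (9 * x a b + 12 * - ii * y a b + 12 * ii * z a b + 16 * (ii * - ii) * t a b))
    = (ii * 9 * x a b - 12 * (ii * ii) * y a b + 12 * (ii * ii) * z a b - 16 * (ii * ii) * ii * t a b) / 48 by field.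
  have -> : - (25 / 48) * ii * (25^-1 * (9 * x a b + 12 * - - ii * y a b + 12 * - ii * z a b + 16 * (- ii * - - ii) * t a b))
    = (- ii * 9 * x a b - 12 * (ii * ii) * y a b + 12 * (ii * ii) * z a b + 16 * (ii * ii) * ii * t a b) / 48 by field.
  by rewrite h; field.
by do 4!(apply: infinitesimalD; first exact: inf).
Qed.

Lemma infinitesimal_total X : exists Z, infinitesimal X Z.
Proof.
rewrite [X]matrix_sum_delta; elim/big_ind: _ => [|A B [a ha] [b hb]|i _].
- by exists 0, [::]; split; rewrite ?big_nil.
- by exists (1 *: a + b); rewrite -[A]scale1r; apply: infinitesimalD.
elim/big_ind: _ => [|A B [a ha] [b hb]|j _].
- by exists 0, [::]; split; rewrite ?big_nil.
- by exists (1 *: a + b); rewrite -[A]scale1r; apply: infinitesimalD.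
have [Z hZ] := infinitesimal_delta i j; exists (X i j *: Z + 0).
by rewrite -[_ *: delta_mx i j]addr0; apply: infinitesimalD => //; exists [::]; split; rewrite ?big_nil.
Qed.

Lemma infinitesimal_uniq X Z Z' : infinitesimal X Z -> infinitesimal X Z' -> Z = Z'.
Proof.
move=> h h'; have := infinitesimalD (-1) h' h; rewrite scaleN1r addNr => /infinitesimal_inj0.
by rewrite scaleN1r addrC => /eqP; rewrite subr_eq0 => /eqP.
Qed.

Definition diff_rep X : 'M[C]_d := projT1 (cid (infinitesimal_total X)).

Lemma diff_repP X : infinitesimal X (diff_rep X).
Proof. exact: (projT2 (cid (infinitesimal_total X))). Qed.

Lemma diff_repE X Z : infinitesimal X Z -> diff_rep X = Z.
Proof. exact: infinitesimal_uniq (diff_repP X). Qed.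

Lemma diff_rep_is_linear : linear diff_rep.
Proof. by move=> a X Y; apply/diff_repE/infinitesimalD; apply: diff_repP. Qed.

HB.instance Definition _ := GRing.isLinear.Build C 'M[C]_n 'M[C]_d _ diff_rep diff_rep_is_linear.

Lemma diff_rep_unit u : unit_cV u -> exists P : 'M[C]_d, exists2 kap : 'I_d -> int,
  P \is unitarymx & diff_rep (u *m u^t*) = circle_gen P kap /\
    forall t, `|t| = 1 -> rho (circle_of u t) = circle_pow P kap t.
Proof. by move=> u1; rewrite (diff_repE (infinitesimal_unit u1)); apply: line_genP. Qed.

Lemma diff_rep_adj X : diff_rep (X^t*) = (diff_rep X)^t*.
Proof.
have [s [us eX eZ]] := diff_repP X; apply: diff_repE; rewrite eZ {1}eX.
exists [seq (p.1^*, p.2) | p <- s]; split.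
- by move=> p /mapP[q qs ->]; apply: (us q).
- rewrite big_map /= linear_sum raddf_sum; apply: eq_bigr => p _.
  by rewrite linearZ /= map_mxZ /= adjmxM trmxCK.
rewrite big_map /= linear_sum raddf_sum !big_seq; apply: eq_bigr => p /us up.
by rewrite linearZ /= map_mxZ /= line_gen_adj.
Qed.

Lemma diff_rep_conj h X : h \is unitarymx ->
  diff_rep (h *m X *m h^t*) = rho h *m diff_rep X *m (rho h)^t*.
Proof.
move=> uh; have [s [us eX eZ]] := diff_repP X; apply: diff_repE; rewrite eZ {1}eX.
exists [seq (p.1, h *m p.2) | p <- s]; split.
- by move=> p /mapP[q qs ->]; apply: unit_cV_mul => //; apply: (us q).
- rewrite big_map mulmx_sumr mulmx_suml; apply: eq_bigr => p _ /=.
  by rewrite -scalemxAr -scalemxAl adjmxM !mulmxA.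
rewrite big_map mulmx_sumr mulmx_suml !big_seq; apply: eq_bigr => p /us up /=.
by rewrite -scalemxAr -scalemxAl line_gen_conj.
Qed.

(** Differentiate the equivariance [diff_rep_conj] along the circle of [u], then expand [X] on the
    matrices [u *m u^t*]. *)
Lemma diff_rep_bracket X Y : diff_rep (X *m Y - Y *m X) =
  diff_rep X *m diff_rep Y - diff_rep Y *m diff_rep X.
Proof.
have main u : unit_cV u -> diff_rep (u *m u^t* *m Y - Y *m (u *m u^t*)) =
   line_gen u *m diff_rep Y - diff_rep Y *m line_gen u.
  move=> u1; have r1 : (1 : C) \is Num.real by exact: rpred1.
  have f1 := first_order_circle_of u r1; rewrite mulr1 in f1.
  have f2 := first_order_rho_circle u1 r1; rewrite mulr1 in f2.
  have := first_order_linear diff_rep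
    (first_order_mul (first_order_mul f1 (first_order_const Y)) (first_order_adj f1)).
  have := first_order_mul (first_order_mul f2 (first_order_const (diff_rep Y))) (first_order_adj f2).
  rewrite !adjmx1 !(mulmx0, mul0mx, addr0, add0r, mulmx1, mul1mx).
  rewrite !linearZ /= !map_mxZ /= conjCi adjmxM trmxCK line_gen_adj // => g1 g2.
  have e s : s \is Num.real -> rho (circle_of u (cayley (1 * s))) *m diff_rep Y *m (rho (circle_of u (cayley (1 * s))))^t*
     = diff_rep (circle_of u (cayley (1 * s)) *m Y *m (circle_of u (cayley (1 * s)))^t*).
    by move=> sr; rewrite diff_rep_conj // unitary_circle_of // norm_cayley // rpredM.
  have := first_order_uniq (first_order_ext e g1) g2.
  rewrite -!scalemxAr -!scalemxAl !scaleNr -scalerN -scalerDr addrC.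
  rewrite !linearD !linearN !linearZ /=.
  by rewrite -!scalerDr => /scalerI -> //; rewrite ?neq0Ci // addrC.
have [s [us eX eZ]] := diff_repP X; rewrite eZ {1 2}eX.
rewrite !mulmx_suml !mulmx_sumr -!sumrB linear_sum !big_seq; apply: eq_bigr => p /us up.
by rewrite -!scalemxAl -!scalemxAr -!scalerBr linearZ /= main.
Qed.

End Infinitesimal.

(** * Intertwiners and tensor products *)

Section Intertwine.
Variable C : numClosedFieldType.

(** In eigenbases, [T] has nonzero entries only between equal integer weights, and there the powers
    of [t] coincide. *)
Lemma circle_gen_intertwine d e (T : 'M[C]_(e, d)) (P : 'M[C]_d) kap (Q : 'M[C]_e) kap' t :
  P \is unitarymx -> Q \is unitarymx ->
  T *m circle_gen P kap = circle_gen Q kap' *m T ->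
  T *m circle_pow P kap t = circle_pow Q kap' t *m T.
Proof.
move=> uP uQ h.
have conj (D : 'M[C]_d) (D' : 'M[C]_e) :
   T *m (P^t* *m D *m P) = Q^t* *m D' *m Q *m T <->
   (Q *m T *m P^t*) *m D = D' *m (Q *m T *m P^t*).
  split=> [E|E].
    have := congr1 (fun X => Q *m X *m P^t*) E.
    rewrite !mulmxA (unitarymxP uQ) mul1mx -!mulmxA (unitarymxP uP) mulmx1 !mulmxA.
    by [].
  have := congr1 (fun X => Q^t* *m X *m P) E.
  rewrite !mulmxA adjmx_unitary // mul1mx => ->.
  by rewrite -!mulmxA adjmx_unitary // mulmx1.
apply/conj; move: h => /conj; set Y := Q *m T *m P^t* => h.
apply/matrixP => i j; have /matrixP /(_ i j) := h.
rewrite !mul_mx_diag !mul_diag_mx ![(\matrix_(_, _) _) _ _]mxE => E.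
have [->|k] := eqVneq (kap j) (kap' i); first by rewrite mulrC.
suff -> : Y i j = 0 by rewrite mul0r mulr0.
apply/eqP; move/eqP: E; rewrite mulrC -subr_eq0 -mulrBl mulf_eq0 => /orP[|//].
by rewrite subr_eq0 eqr_int (negPf k).
Qed.

Lemma diff_rep_intertwine n d e (rho : 'M[C]_n -> 'M[C]_d) (rho' : 'M[C]_n -> 'M[C]_e)
    (h : circle_diagonal rho) (h' : circle_diagonal rho') (T : 'M[C]_(e, d)) :
  (forall i j, T *m diff_rep h (delta_mx i j) = diff_rep h' (delta_mx i j) *m T) ->
  forall g, g \is unitarymx -> T *m rho g = rho' g *m T.
Proof.
move=> hT; have hX X : T *m diff_rep h X = diff_rep h' X *m T.
  rewrite [X]matrix_sum_delta !linear_sum /= mulmx_suml; apply: eq_bigr => i _.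
  rewrite !linear_sum /= mulmx_suml; apply: eq_bigr => j _.
  by rewrite !linearZ /= -scalemxAl hT.
have hc u t : unit_cV u -> `|t| = 1 -> T *m rho (circle_of u t) = rho' (circle_of u t) *m T.
  move=> u1 t1; have [P [kap uP [e1 e2]]] := diff_rep_unit h u1.
  have [Q [kap' uQ [e1' e2']]] := diff_rep_unit h' u1.
  by rewrite e2 // e2' //; apply: circle_gen_intertwine => //; rewrite -e1 -e1' hX.
move=> g /unitary_diagonalize[P [t [uP t1 ->]]].
have uPa : P^t* \is unitarymx by rewrite trmxC_unitary.
pose c a : 'M[C]_n := circle_of (P^t* *m delta_mx a 0) (t 0 a).
have uc a : c a \is unitarymx.
  by apply: unitary_circle_of => //; apply: unit_cV_mul => //; apply: unit_delta.
have -> : P^t* *m diag_mx t *m P = \big[mulmx/1%:M]_a c a.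
  rewrite diag_mx_circle_of.
  elim: (index_enum _) => [|a s IH]; first by rewrite !big_nil mulmx1 adjmx_unitary.
  rewrite !big_cons -IH /c -circle_of_conj // trmxCK.
  by rewrite !mulmxA -(mulmxA _ P) (unitarymxP uP) mulmx1.
rewrite !(rho_prod h, rho_prod h') //.
elim: (index_enum _) => [|a s IH]; first by rewrite !big_nil mulmx1 mul1mx.
rewrite !big_cons mulmxA hc // -?mulmxA ?IH //.
by apply: unit_cV_mul => //; apply: unit_delta.
Qed.

Lemma circle_gen_uniq d (P Q : 'M[C]_d) kap kap' : P \is unitarymx -> Q \is unitarymx ->
  (forall t, `|t| = 1 -> circle_pow P kap t = circle_pow Q kap' t) ->
  circle_gen P kap = circle_gen Q kap'.
Proof.
move=> uP uQ h; have r1 : (1 : C) \is Num.real by exact: rpred1.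
have f1 := first_order_circle_pow kap uP r1; have f2 := first_order_circle_pow kap' uQ r1.
have := first_order_uniq f1 (first_order_ext _ f2); rewrite mulr1.
have e s : s \is Num.real -> circle_pow Q kap' (cayley (1 * s)) = circle_pow P kap (cayley (1 * s)).
  by move=> sr; rewrite h // norm_cayley // rpredM.
by move=> /(_ e) /scalerI; apply; apply: neq0Ci.
Qed.

Lemma adj_tensmx m n p q (A : 'M[C]_(m, n)) (B : 'M[C]_(p, q)) :
  (A *t B)^t* = A^t* *t B^t*.
Proof. by rewrite trmx_tens map_mxT. Qed.

Lemma tensmx11 m n : (1%:M : 'M[C]_m) *t (1%:M : 'M[C]_n) = 1%:M.
Proof.
apply/matrixP => p q; rewrite -[p]mxtens_unindexK -[q]mxtens_unindexK.
case: (mxtens_unindex p) (mxtens_unindex q) => [a b] [a' b'] /=.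
rewrite tensmxE !mxE (can_eq (@mxtens_indexK _ _)) xpair_eqE -natrM mulnb //.
Qed.

Lemma tens_diag_mx m n (D : 'rV[C]_m) (E : 'rV[C]_n) :
  diag_mx D *t diag_mx E =
  diag_mx (\row_k (D 0 (mxtens_unindex k).1 * E 0 (mxtens_unindex k).2)).
Proof.
apply/matrixP => p q; rewrite -[p]mxtens_unindexK -[q]mxtens_unindexK.
case: (mxtens_unindex p) (mxtens_unindex q) => [a b] [a' b'] /=.
have := mxtens_indexK (a, b); rewrite /mxtens_unindex => -[e1 e2].
rewrite tensmxE !mxE e1 e2 (can_eq (@mxtens_indexK _ _)) xpair_eqE.
by case: (a =P a') => [->|_]; case: (b =P b') => [->|_];
  rewrite /= ?mulr1n ?mulr0n ?mulr0 ?mul0r.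
Qed.

Definition tens_kap m n (kap : 'I_m -> int) (kap' : 'I_n -> int) (k : 'I_(m * n)) : int :=
  kap (mxtens_unindex k).1 + kap' (mxtens_unindex k).2.

Lemma circle_pow_tens m n (P : 'M[C]_m) kap (Q : 'M[C]_n) kap' t : `|t| = 1 ->
  circle_pow P kap t *t circle_pow Q kap' t = circle_pow (P *t Q) (tens_kap kap kap') t.
Proof.
move=> t1; have t0 : t != 0 by rewrite -normr_eq0 t1 oner_eq0.
rewrite /circle_pow -!tensmx_mul -adj_tensmx tens_diag_mx.
congr (_ *m diag_mx _ *m _); apply/rowP => k; rewrite !mxE.
by rewrite -expfzDr.
Qed.

Lemma circle_gen_tens m n (P : 'M[C]_m) kap (Q : 'M[C]_n) kap' :
  P \is unitarymx -> Q \is unitarymx ->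
  circle_gen P kap *t 1%:M + 1%:M *t circle_gen Q kap' =
  circle_gen (P *t Q) (tens_kap kap kap').
Proof.
move=> uP uQ; pose D : 'rV[C]_m := \row_a (kap a)%:~R; pose E : 'rV[C]_n := \row_a (kap' a)%:~R.
have e1 : circle_gen P kap *t 1%:M = (P *t Q)^t* *m (diag_mx D *t 1%:M) *m (P *t Q).
  by rewrite adj_tensmx !tensmx_mul mulmx1 adjmx_unitary.
have e2 : 1%:M *t circle_gen Q kap' = (P *t Q)^t* *m (1%:M *t diag_mx E) *m (P *t Q).
  by rewrite adj_tensmx !tensmx_mul mulmx1 adjmx_unitary.
rewrite e1 e2 -mulmxDl -mulmxDr -!diag_const_mx !tens_diag_mx -linearD /=.
congr (_ *m diag_mx _ *m _); apply/rowP => k; rewrite !mxE mulr1 mul1r.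
by rewrite -intrD.
Qed.

Lemma tens_unitarymx m n (P : 'M[C]_m) (Q : 'M[C]_n) :
  P \is unitarymx -> Q \is unitarymx -> P *t Q \is unitarymx.
Proof.
move=> uP uQ; apply/unitarymxP.
by rewrite adj_tensmx tensmx_mul (unitarymxP uP) (unitarymxP uQ) tensmx11.
Qed.

Section Tensor.
Variables (n d1 d2 : nat) (rho1 : 'M[C]_n -> 'M[C]_d1) (rho2 : 'M[C]_n -> 'M[C]_d2).
Hypotheses (h1 : circle_diagonal rho1) (h2 : circle_diagonal rho2).

Lemma tensor_circle_diagonal : circle_diagonal (fun g => rho1 g *t rho2 g).
Proof.
have [u1 o1 m1 c1] := h1; have [u2 o2 m2 c2] := h2; split.
- by move=> g ug; apply: tens_unitarymx; rewrite ?u1 ?u2.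
- by rewrite o1 o2 tensmx11.
- by move=> g h ug uh; rewrite m1 // m2 // tensmx_mul.
move=> u uu; have [P [kap uP hP]] := c1 u uu; have [Q [kap' uQ hQ]] := c2 u uu.
exists (P *t Q), (tens_kap kap kap'); first exact: tens_unitarymx.
by move=> t t1; rewrite hP // hQ // circle_pow_tens.
Qed.

(** The Leibniz rule, checked on circle generators, where weights add. *)
Lemma diff_rep_tensor (h12 : circle_diagonal (fun g => rho1 g *t rho2 g)) X :
  diff_rep h12 X = diff_rep h1 X *t 1%:M + 1%:M *t diff_rep h2 X.
Proof.
have main u : unit_cV u -> diff_rep h12 (u *m u^t*) =
    diff_rep h1 (u *m u^t*) *t 1%:M + 1%:M *t diff_rep h2 (u *m u^t*).
  move=> uu; have [P [kap uP [-> hP]]] := diff_rep_unit h1 uu.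
  have [Q [kap' uQ [-> hQ]]] := diff_rep_unit h2 uu.
  have [W [kw uW [-> hW]]] := diff_rep_unit h12 uu.
  rewrite circle_gen_tens //; apply: circle_gen_uniq => // [|t t1].
    exact: tens_unitarymx.
  by rewrite -hW // hP // hQ // circle_pow_tens.
have [s [us eX _]] := diff_repP h12 X; rewrite eX big_seq.
elim/big_rec: _ => [|p Y /us up IH].
  rewrite !linear0; apply/matrixP => i j; rewrite !mxE.
  by rewrite mul0r mulr0 addr0.
rewrite !linearD !linearZ /= IH main //.
by apply/matrixP => i j; rewrite !mxE; ring.
Qed.

End Tensor.
End Intertwine.

(** * Cyclic submodules generated by words *)

Section Words.
Variables (C : numClosedFieldType) (G : Type).

Definition word_act d (op : G -> 'M[C]_d) (w : seq G) (v : 'cV[C]_d) : 'cV[C]_d :=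
  foldr (fun g x => op g *m x) v w.

Lemma word_act_cat d (op : G -> 'M[C]_d) w w' v :
  word_act op (w ++ w') v = word_act op w (word_act op w' v).
Proof. exact: foldr_cat. Qed.

Lemma word_act_linear d (op : G -> 'M[C]_d) w : linear (word_act op w).
Proof.
by move=> a x y; elim: w => //= g w ->; rewrite mulmxDr scalemxAr.
Qed.

HB.instance Definition _ d (op : G -> 'M[C]_d) w :=
  GRing.isLinear.Build C 'cV[C]_d 'cV[C]_d _ (word_act op w) (word_act_linear op w).

Definition in_words d (op : G -> 'M[C]_d) (v x : 'cV[C]_d) :=
  exists l : seq (C * seq G), x = \sum_(p <- l) p.1 *: word_act op p.2 v.

Lemma in_wordsD d (op : G -> 'M[C]_d) v a x y :
  in_words op v x -> in_words op v y -> in_words op v (a *: x + y).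
Proof.
move=> [l ->] [l' ->]; exists ([seq (a * p.1, p.2) | p <- l] ++ l').
rewrite big_cat big_map /= scaler_sumr; congr (_ + _).
by apply: eq_bigr => p _; rewrite scalerA.
Qed.

Lemma in_words0 d (op : G -> 'M[C]_d) v : in_words op v 0.
Proof. by exists [::]; rewrite big_nil. Qed.

(* The words applied to v span a subspace stable under the self-adjoint family of
   operators, hence its orthogonal projection commutes with them. *)
Lemma words_projection d (op : G -> 'M[C]_d) (adj : G -> G) (v : 'cV[C]_d) :
  (forall g, (op g)^t* = op (adj g)) ->
  exists Q : 'M[C]_d, [/\ Q *m v = v, forall g, Q *m op g = op g *m Q &
    forall x : 'cV_d, in_words op v (Q *m x)].
Proof.
move=> hadj; have [ws hws] := @span_family _ _ _ (fun w => word_act op w v).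
pose B : 'M[C]_(size ws, d) := \matrix_(k < size ws) (word_act op (nth [::] ws k) v)^T.
have inB w : ((word_act op w v)^T <= B)%MS.
  have := @coord_span _ _ _ (in_tuple [seq word_act op w v | w <- ws]) _ (hws w).
  rewrite /= => ->; rewrite linear_sum; apply: summx_sub => k _.
  rewrite linearZ /=; apply: scalemx_sub.
  have kw : (k < size ws)%N by have := ltn_ord k; rewrite [X in (_ < X)%N]size_map.
  rewrite (nth_map [::]) //; have := row_sub (Ordinal kw) B; by rewrite rowK.
have [U uU eU] := unitary_basis B.
pose V := U^T; have VV : V^t* *m V = 1%:M.
  have -> : V^t* = (U^t*)^T by apply/matrixP => i j; rewrite !mxE.
  by rewrite -trmx_mul (unitarymxP uU) trmx1.
have opV g : exists L, op g *m V = V *m L.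
  have /submxP[Y eY] : (U <= B)%MS by rewrite eU.
  have : (B *m (op g)^T <= U)%MS.
    rewrite eU; apply/row_subP => k; rewrite row_mul rowK -trmx_mul.
    exact: (inB (g :: nth [::] ws k)).
  move=> /submxP[L eL]; exists ((Y *m L)^T).
  by rewrite /V -trmx_mul -mulmxA -eL mulmxA -eY trmx_mul trmxK.
have [Q eQ] : exists Q, Q = V *m V^t* by eexists.
have Qh : Q^t* = Q by rewrite eQ adjmxM trmxCK.
have QV : Q *m V = V by rewrite eQ -mulmxA VV mulmx1.
have stab g : Q *m op g *m Q = op g *m Q.
  have [L eL] := opV g.
  by rewrite {2 3}eQ !mulmxA -(mulmxA _ (op g)) eL !mulmxA QV.
have Qop g : Q *m op g = op g *m Q.
  rewrite -stab; have := congr1 (fun X => X^t*) (stab (adj g)).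
  by rewrite !adjmxM Qh -hadj trmxCK mulmxA => ->.
exists Q; split=> //.
  have /submxP[D eD] : (v^T <= U)%MS by rewrite eU; apply: (inB [::]).
  have -> : v = V *m D^T by rewrite -[v]trmxK eD trmx_mul.
  by rewrite mulmxA QV.
move=> x; have /submxP[Y eY] : (U <= B)%MS by rewrite eU.
have -> : Q *m x = B^T *m (Y^T *m (V^t* *m x)).
  by rewrite eQ !mulmxA -trmx_mul -eY.
move: (Y^T *m _) => z.
have -> : B^T *m z = \sum_k z k 0 *: word_act op (nth [::] ws k) v.
  apply/matrixP => i j; rewrite summxE !mxE; apply: eq_bigr => k _.
  by rewrite !mxE ord1 mulrC.
elim/big_ind: _ => [|a b ha hb|k _]; first exact: in_words0.
  by rewrite -[a]scale1r; apply: in_wordsD.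
by exists [:: (z k 0, nth [::] ws k)]; rewrite big_seq1.
Qed.

End Words.

(** * Inner products in highest weight modules *)

Section Gram.
Variables (C : numClosedFieldType) (G : eqType) (K : finType) (gen : K -> G).
Variables (adj : G -> G) (br : G -> G -> K -> C) (chi : G -> option C) (raising : pred G).
Hypothesis tri : forall g, [|| raising g, raising (adj g) | chi g != None].

(** A highest weight module reduced to what the computation of inner products uses: adjoints,
    structure constants [br] on the generators [gen], raising letters killing [v], and eigenvalues
    [chi]. The hypothesis [tri] is the triangular decomposition. *)
Definition hw_module d (op : G -> 'M[C]_d) (v : 'cV[C]_d) :=
  [/\ forall g, (op g)^t* = op (adj g),
      forall g h, op g *m op h = op h *m op g + \sum_k br g h k *: op (gen k),
      forall g, raising g -> op g *m v = 0
    & forall g c, chi g = Some c -> op g *m v = c *: v].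

Definition cdot d (x y : 'cV[C]_d) : C := (y^t* *m x) 0 0.

Section Module.
Variables (d : nat) (op : G -> 'M[C]_d) (v : 'cV[C]_d).

Definition moment (w : seq G) : C := cdot (word_act op w v) v.

Hypothesis hm : hw_module op v.

Lemma cdot_op g (x y : 'cV[C]_d) : cdot (op g *m x) y = cdot x (op (adj g) *m y).
Proof.
have [h _ _ _] := hm; rewrite /cdot adjmxM -h trmxCK mulmxA //.
Qed.

Lemma moment_swap u g h w : moment (u ++ g :: h :: w) =
  moment (u ++ h :: g :: w) + \sum_k br g h k * moment (u ++ gen k :: w).
Proof.
have [_ hb _ _] := hm; rewrite /moment !word_act_cat /= mulmxA hb mulmxDl linearD.
rewrite /cdot mulmxDr mxE -!mulmxA; congr (_ + _).
rewrite mulmx_suml linear_sum mulmx_sumr summxE; apply: eq_bigr => k _.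
by rewrite -scalemxAl linearZ /= -scalemxAr mxE word_act_cat.
Qed.

Lemma moment_raising u g : raising g -> moment (rcons u g) = 0.
Proof.
have [_ _ hr _] := hm => /hr e; rewrite /moment -cats1 word_act_cat /= e linear0.
by rewrite /cdot mulmx0 mxE.
Qed.

Lemma moment_diag u g c : chi g = Some c -> moment (rcons u g) = c * moment u.
Proof.
have [_ _ _ hc] := hm => /hc e; rewrite /moment -cats1 word_act_cat /= e linearZ /=.
by rewrite /cdot -scalemxAr mxE.
Qed.

Lemma moment_lowering u g : raising (adj g) -> moment (g :: u) = 0.
Proof.
have [_ _ hr _] := hm => /hr e; rewrite /moment /= cdot_op e.
by rewrite /cdot trmx0 map_mx0 mul0mx mxE.
Qed.

End Module.

Section Two.
Variables (d d' : nat) (op : G -> 'M[C]_d) (v : 'cV[C]_d) (op' : G -> 'M[C]_d') (v' : 'cV[C]_d').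
Hypotheses (hm : hw_module op v) (hm' : hw_module op' v').

(** Induction on length. A raising last letter gives 0, a diagonal one a scalar, and a lowering one
    is commuted to the front, where its adjoint kills [v]; each swap produces shorter words. Both
    modules obey this same recursion and differ only by the squared norm of the vector. *)
Lemma moment_eq w : moment op v w * cdot v' v' = moment op' v' w * cdot v v.
Proof.
have [m] := ubnP (size w); elim: m w => // m IH w; rewrite ltnS => sw.
case: (lastP w) sw => [_|u g]; first by rewrite /moment /= mulrC.
rewrite size_rcons => su.
case/or3P: (tri g) => [hg|hg|].
- by rewrite (moment_raising hm) // (moment_raising hm') // !mul0r.
- rewrite -cats1.
  suff low t : (size u + size t < m)%N ->
      moment op v (u ++ g :: t) * cdot v' v' = moment op' v' (u ++ g :: t) * cdot v v.
    by apply: low; rewrite addn0.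
  elim/last_ind: u t {su} => [|u h IHu] t.
    by rewrite /= (moment_lowering hm) // (moment_lowering hm') // !mul0r.
  rewrite size_rcons addSnnS => st; rewrite cat_rcons (moment_swap hm) (moment_swap hm').
  rewrite !mulrDl IHu //; congr (_ + _); rewrite !mulr_suml; apply: eq_bigr => k _.
  by rewrite -!mulrA IH // size_cat.
case: (chi g) (moment_diag hm u (g := g)) (moment_diag hm' u (g := g)) => // c h1 h2 _.
by rewrite (h1 _ erefl) (h2 _ erefl) -!mulrA IH.
Qed.

Lemma cdot_words (w1 w2 : seq G) : cdot (word_act op w1 v) (word_act op w2 v) =
  moment op v (rev (map adj w2) ++ w1).
Proof.
elim: w2 w1 => [|g w2 IH] w1 //=.
have [ha _ _ _] := hm.
rewrite rev_cons cat_rcons -[RHS]/(moment op v (rev (map adj w2) ++ (adj g :: w1))) -IH /=.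
by rewrite /cdot adjmxM ha mulmxA.
Qed.

End Two.

Lemma adjmx_sum (J : Type) (s : seq J) (P : pred J) m d (f : J -> 'M[C]_(m, d)) :
  (\sum_(i <- s | P i) f i)^t* = \sum_(i <- s | P i) (f i)^t*.
Proof. by rewrite linear_sum /= raddf_sum. Qed.

Lemma adjmxZ m d (c : C) (A : 'M[C]_(m, d)) : (c *: A)^t* = c^* *: A^t*.
Proof. by apply/matrixP => i j; rewrite !mxE rmorphM. Qed.

Lemma cdot_eq0 d (x : 'cV[C]_d) : cdot x x = 0 -> x = 0.
Proof.
rewrite /cdot mxE => h; apply/matrixP => i j; rewrite ord1 [RHS]mxE; apply/eqP.
have : \sum_i `|x i 0| ^+ 2 == 0.
  by apply/eqP; rewrite -[RHS]h; apply: eq_bigr => k _; rewrite !mxE normCK mulrC.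
rewrite psumr_eq0 => [/allP /(_ i)|k _]; last by rewrite exprn_ge0.
by rewrite mem_index_enum sqrf_eq0 normr_eq0 => /(_ isT).
Qed.

(* All the inner products of words are determined by the highest weight, hence so
   are all the linear relations between them. *)
Lemma highest_weight_relations d d' (op : G -> 'M[C]_d) (v : 'cV[C]_d)
    (op' : G -> 'M[C]_d') (v' : 'cV[C]_d') (l : seq (C * seq G)) :
  hw_module op v -> hw_module op' v' -> v != 0 ->
  \sum_(p <- l) p.1 *: word_act op p.2 v = 0 ->
  \sum_(p <- l) p.1 *: word_act op' p.2 v' = 0.
Proof.
move=> hm hm' v0 rel.
have vv0 : cdot v v != 0 by apply: contra v0 => /eqP /cdot_eq0 ->.
have expand e (o : G -> 'M[C]_e) (y : 'cV[C]_e) : hw_module o y ->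
    cdot (\sum_(p <- l) p.1 *: word_act o p.2 y) (\sum_(p <- l) p.1 *: word_act o p.2 y) =
    \sum_(q <- l) \sum_(p <- l) q.1^* * p.1 * moment o y (rev (map adj q.2) ++ p.2).
  move=> ho; rewrite {1}/cdot adjmx_sum mulmx_suml summxE.
  apply: eq_bigr => q _; rewrite mulmx_sumr summxE; apply: eq_bigr => p _.
  rewrite adjmxZ -scalemxAl -scalemxAr 2!mxE.
  by rewrite -(cdot_words ho) /cdot mulrA mxE.
apply: cdot_eq0; apply: (mulIf vv0); rewrite mul0r expand // mulr_suml.
have cdot0 : cdot (0 : 'cV[C]_d) 0 = 0 by rewrite /cdot mulmx0 mxE.
have := expand _ _ _ hm; rewrite rel cdot0 => /(congr1 ( *%R^~ (cdot v' v'))).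
rewrite mul0r mulr_suml => e; rewrite [RHS]e.
apply: eq_bigr => q _; rewrite !mulr_suml; apply: eq_bigr => p _.
by rewrite -!mulrA (moment_eq hm hm').
Qed.

End Gram.

Definition gl_family (C : numClosedFieldType) (I : eqType) n d (op : I -> 'M[C]_n -> 'M[C]_d) :=
  [/\ forall a, linear (op a),
      forall a X Y, op a X *m op a Y = op a Y *m op a X + op a (X *m Y - Y *m X),
      forall a b X Y, a != b -> op a X *m op b Y = op b Y *m op a X
    & forall a X, (op a X)^t* = op a (X^t*)].

(** * Operators on tensor powers *)

Section Tensors.
Variables (C : numClosedFieldType) (n N : nat).
Local Notation S := {ffun 'I_N -> 'I_n}.
Implicit Types (s t f : S) (A B : 'I_N -> 'M[C]_n) (X Y : 'M[C]_n).

(** The tensor product of the [A x]. Basis tensors are functions from sites to indices, enumerated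
    by [enum_val]. *)
Definition tens_act A : 'M[C]_#|S| :=
  \matrix_(p, q) \prod_x A x ((enum_val p : S) x) ((enum_val q : S) x).

Definition pure s : 'cV[C]_#|S| := delta_mx (enum_rank s) 0.

Lemma sum_enum_val (V : nmodType) (F : S -> V) :
  \sum_(p < #|S|) F (enum_val p) = \sum_s F s.
Proof. by rewrite -(big_enum_val F). Qed.

Lemma eq_tens_act A B : A =1 B -> tens_act A = tens_act B.
Proof. by move=> e; apply/matrixP => p q; rewrite !mxE; apply: eq_bigr => x _; rewrite e. Qed.

Lemma tens_act_mul A B : tens_act A *m tens_act B = tens_act (fun x => A x *m B x).
Proof.
apply/matrixP => p q; rewrite !mxE.
under [RHS]eq_bigr do rewrite mxE.
rewrite bigA_distr_bigA /= -(sum_enum_val (fun f : S => _)).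
by apply: eq_bigr => k _; rewrite !mxE big_split.
Qed.

Lemma tens_act1 A : (forall x, A x = 1%:M) -> tens_act A = 1%:M.
Proof.
move=> hA; apply/matrixP => p q; rewrite !mxE.
have [<-|pq] := eqVneq p q; first by rewrite big1 // => x _; rewrite hA mxE eqxx.
have [x hx] : exists x, (enum_val p : S) x != (enum_val q : S) x.
  apply/existsP; apply: contraR pq; rewrite negb_exists => /forallP e.
  by apply/eqP/enum_val_inj/ffunP => x; apply/eqP; have := e x; rewrite negbK.
by rewrite (bigD1 x) //= hA mxE (negPf hx) mul0r.
Qed.

Lemma tens_act_adj A : (tens_act A)^t* = tens_act (fun x => (A x)^t*).
Proof.
apply/matrixP => p q; rewrite !mxE rmorph_prod; apply: eq_bigr => x _.
by rewrite !mxE.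
Qed.

Lemma tens_act_unitary A : (forall x, A x \is unitarymx) -> tens_act A \is unitarymx.
Proof.
move=> uA; apply/unitarymxP; rewrite tens_act_adj tens_act_mul tens_act1 // => x.
exact: (unitarymxP (uA x)).
Qed.

Definition upd f p i : S := [ffun x => if x == p then i else f x].

Definition site p X : 'M[C]_#|S| := tens_act (fun x => if x == p then X else 1%:M).

Lemma siteE p X (k l : 'I_#|S|) : site p X k l =
  X ((enum_val k : S) p) ((enum_val l : S) p) *
  ((enum_val k : S) == upd (enum_val l) p ((enum_val k : S) p))%:R.
Proof.
rewrite mxE (bigD1 p) //= eqxx; congr (_ * _).
set s : S := enum_val k; set t : S := enum_val l.
case: eqP => [e|/eqP ne].
  rewrite big1 // => x xp; rewrite (negPf xp) mxE.
  by have := congr1 (fun f : S => f x) e; rewrite ffunE (negPf xp) => ->; rewrite eqxx.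
have [x hx] : exists x, s x != upd t p (s p) x.
  apply/existsP; apply: contraR ne; rewrite negb_exists => /forallP e.
  by apply/eqP/ffunP => x; apply/eqP; have := e x; rewrite negbK.
move: hx; rewrite ffunE; have [->|xp hx] := eqVneq x p; first by rewrite eqxx.
by rewrite (bigD1 x) //= (negPf xp) mxE (negPf hx) mul0r.
Qed.

Lemma site_is_linear p : linear (site p).
Proof. by move=> a X Y; apply/matrixP => k l; rewrite siteE [RHS]mxE [X in _ = X + _]mxE !siteE !mxE mulrDl mulrA. Qed.

HB.instance Definition _ p := GRing.isLinear.Build C _ _ _ (site p) (site_is_linear p).

Lemma site_mul p X Y : site p X *m site p Y = site p (X *m Y).
Proof.
by rewrite tens_act_mul; apply: eq_tens_act => x; case: eqP => // _; rewrite mulmx1.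
Qed.

Lemma site_comm p q X Y : p != q -> site p X *m site q Y = site q Y *m site p X.
Proof.
move=> pq; rewrite !tens_act_mul; apply: eq_tens_act => x.
have [->|_] := eqVneq x p; first by rewrite (negPf pq) mulmx1 mul1mx.
by case: eqP; rewrite ?mulmx1 ?mul1mx.
Qed.

Lemma site_adj p X : (site p X)^t* = site p (X^t*).
Proof. by rewrite tens_act_adj; apply: eq_tens_act => x; case: eqP; rewrite ?adjmx1. Qed.

Lemma site_conj A p X : (forall x, A x \is unitarymx) ->
  tens_act A *m site p X *m (tens_act A)^t* = site p (A p *m X *m (A p)^t*).
Proof.
move=> uA; rewrite tens_act_adj !tens_act_mul; apply: eq_tens_act => x.
by case: eqP => [->//|_]; rewrite mulmx1 (unitarymxP (uA x)).
Qed.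

Lemma site_pure p X f : site p X *m pure f = \sum_i X i (f p) *: pure (upd f p i).
Proof.
apply/matrixP => k z; rewrite ord1 {z} -colE mxE siteE enum_rankK summxE.
rewrite (bigD1 ((enum_val k : S) p)) //= big1 ?addr0 => [|i ip].
  rewrite !mxE eqxx andbT; congr (_ * _%:R).
  by rewrite -(inj_eq (@enum_val_inj _ S)) enum_rankK.
rewrite !mxE andbT; case: eqP => [e|_]; last by rewrite mulr0.
by move: ip; rewrite e enum_rankK ffunE !eqxx.
Qed.

Lemma site_delta_pure p i j f :
  site p (delta_mx i j) *m pure f = (f p == j)%:R *: pure (upd f p i).
Proof.
rewrite site_pure (bigD1 i) //= big1 ?addr0 => [|k ki]; first by rewrite mxE eqxx.
by rewrite mxE (negPf ki) scale0r.
Qed.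

Section Families.
Variables (I : finType) (fam : 'I_N -> I).

Definition fam_op a X : 'M[C]_#|S| := \sum_(p | fam p == a) site p X.

Lemma fam_op_gl : gl_family fam_op.
Proof.
split=> [a c X Y|a X Y|a b X Y ab|a X].
- rewrite /fam_op scaler_sumr -big_split; apply: eq_bigr => p _.
  by rewrite linearD linearZ.
- have expand Z Z' : fam_op a Z *m fam_op a Z' =
      \sum_(p | fam p == a) site p (Z *m Z') +
      \sum_(p | fam p == a) \sum_(q | (fam q == a) && (q != p)) site p Z *m site q Z'.
    rewrite mulmx_suml -big_split; apply: eq_bigr => p pa.
    by rewrite mulmx_sumr (bigD1 p) //= site_mul.
  rewrite !expand addrAC; congr (_ + _).
    by rewrite /fam_op -big_split; apply: eq_bigr => p _ /=; rewrite -raddfD /= addrC subrK.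
  rewrite (exchange_big_dep (fun p => fam p == a)) => [|p q _ /andP[]//].
  apply: eq_bigr => p pa; apply: eq_big => [q|q /andP[_ /andP[_ qp]]]; first by rewrite pa (eq_sym p).
  by rewrite site_comm // eq_sym.
- rewrite /fam_op mulmx_suml; under eq_bigr do rewrite mulmx_sumr.
  rewrite exchange_big mulmx_suml; apply: eq_bigr => q /eqP qb.
  rewrite mulmx_sumr; apply: eq_bigr => p /eqP pa; rewrite site_comm //.
  by apply: contra ab => /eqP e; rewrite -pa -qb e.
by rewrite /fam_op adjmx_sum; apply: eq_bigr => p _; rewrite site_adj.
Qed.

End Families.
End Tensors.

(** * The commutant of the infinitesimal action on tensors *)

Section TensorCommutant.
Variables (C : numClosedFieldType) (n N : nat) (I : finType) (fam : 'I_N -> I).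
Local Notation S := {ffun 'I_N -> 'I_n}.

Definition occ a k (s : S) := #|[pred x | (fam x == a) && (s x == k)]|.

Lemma natr_occ a k s : (occ a k s)%:R = \sum_(x | fam x == a) (s x == k)%:R :> C.
Proof.
rewrite /occ -(sum1_card [pred x | _]) natr_sum big_mkcondr /=.
by apply: eq_bigr => x _; case: eqP.
Qed.

Lemma fam_op_delta a k : fam_op fam a (delta_mx k k : 'M[C]_n) =
  diag_mx (\row_p (occ a k (enum_val p))%:R).
Proof.
apply/matrixP => p q; rewrite summxE !mxE.
have [<-|pq] := eqVneq p q; rewrite ?mulr1n ?mulr0n.
  rewrite natr_occ; apply: eq_bigr => x _; rewrite siteE mxE andbb.
  have -> : enum_val p == upd (enum_val p : S) x ((enum_val p : S) x).
    by apply/eqP/ffunP => y; rewrite ffunE; case: eqP => [->|].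
  by rewrite mulr1; case: eqP.
apply: big1 => x _; rewrite siteE mxE; case: eqP => [e1|_]; last by rewrite mul0r.
case: eqP => [e2|_]; last by rewrite mul0r.
case: eqP => [e3|_]; last by rewrite mulr0.
case/eqP: pq; apply/(@enum_val_inj _ S); rewrite e3; apply/ffunP => y; rewrite ffunE e1 -e2.
by case: eqP => [->|].
Qed.

Lemma tens_act_diag (t : I -> 'rV[C]_n) : tens_act (fun x => diag_mx (t (fam x))) =
  diag_mx (\row_p \prod_(u : I * 'I_n) t u.1 0 u.2 ^+ occ u.1 u.2 (enum_val p)).
Proof.
apply/matrixP => p q; rewrite !mxE.
have [<-|pq] := eqVneq p q; rewrite ?mulr1n ?mulr0n.
  rewrite (partition_big (fun x => (fam x, (enum_val p : S) x)) xpredT) //=.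
  apply: eq_bigr => -[a k] _ /=; rewrite /occ -prodr_const; apply: eq_big => x.
    by rewrite inE xpair_eqE.
  by rewrite xpair_eqE => /andP[/eqP -> /eqP ->]; rewrite mxE eqxx mulr1n.
have [x hx] : exists x, (enum_val p : S) x != (enum_val q : S) x.
  apply/existsP; apply: contraR pq; rewrite negb_exists => /forallP e.
  by apply/eqP/(@enum_val_inj _ S)/ffunP => x; apply/eqP; have := e x; rewrite negbK.
by rewrite (bigD1 x) //= mxE (negPf hx) mulr0n mul0r.
Qed.

Lemma fam_op_conj (P : I -> 'M[C]_n) a X : (forall a, P a \is unitarymx) ->
  tens_act (fun x => P (fam x)) *m fam_op fam a X *m (tens_act (fun x => P (fam x)))^t* =
  fam_op fam a (P a *m X *m (P a)^t*).
Proof.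
move=> uP; rewrite /fam_op mulmx_sumr mulmx_suml; apply: eq_bigr => x /eqP <-.
by rewrite site_conj.
Qed.

(* In a basis diagonalizing the A a, the operators of the family count the
   occurrences of each index, and these determine the eigenvalues of tens_act A. *)
Lemma tens_act_commute (A : I -> 'M[C]_n) (Q : 'M[C]_#|S|) :
  (forall a, A a \is unitarymx) ->
  (forall a X, Q *m fam_op fam a X = fam_op fam a X *m Q) ->
  Q *m tens_act (fun x => A (fam x)) = tens_act (fun x => A (fam x)) *m Q.
Proof.
move=> uA hQ.
have hP a : {Pt : 'M[C]_n * 'rV[C]_n | Pt.1 \is unitarymx /\
    A a = Pt.1^t* *m diag_mx Pt.2 *m Pt.1}.
  by apply: cid; have [P [t [uP _ e]]] := unitary_diagonalize (uA a); exists (P, t).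
pose P a := (projT1 (hP a)).1; pose t a := (projT1 (hP a)).2.
have uP a : P a \is unitarymx by have [] := projT2 (hP a).
have eA a : A a = (P a)^t* *m diag_mx (t a) *m P a by have [] := projT2 (hP a).
have [R eR] : exists R, R = tens_act (fun x => P (fam x)) by eexists.
have uR : R \is unitarymx by rewrite eR; apply: tens_act_unitary.
have [Q' eQ'] : exists Q', Q' = R *m Q *m R^t* by eexists.
have hQ' a X : Q' *m fam_op fam a X = fam_op fam a X *m Q'.
  have -> : X = P a *m ((P a)^t* *m X *m P a) *m (P a)^t*.
    by rewrite !mulmxA (unitarymxP (uP a)) mul1mx -mulmxA (unitarymxP (uP a)) mulmx1.
  rewrite -fam_op_conj // -eR eQ' !mulmxA -(mulmxA _ (R^t*) R) adjmx_unitary // mulmx1.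
  by rewrite -(mulmxA _ (R^t*) R) adjmx_unitary // mulmx1 -!(mulmxA R) hQ !mulmxA.
have hocc p q : Q' p q != 0 -> forall a k, occ a k (enum_val p) = occ a k (enum_val q).
  move=> pq a k; have := hQ' a (delta_mx k k); rewrite fam_op_delta => /matrixP /(_ p q).
  rewrite mul_mx_diag mul_diag_mx !mxE mulrC => /(mulIf pq) /eqP.
  by rewrite eqr_nat => /eqP.
have hD : Q' *m tens_act (fun x => diag_mx (t (fam x))) =
    tens_act (fun x => diag_mx (t (fam x))) *m Q'.
  rewrite tens_act_diag; apply/matrixP => p q; rewrite mul_mx_diag mul_diag_mx !mxE mulrC.
  have [->|pq] := eqVneq (Q' p q) 0; first by rewrite !mulr0.
  by congr (_ * _); apply: eq_bigr => u _; rewrite (hocc p q pq).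
have -> : tens_act (fun x => A (fam x)) =
    R^t* *m tens_act (fun x => diag_mx (t (fam x))) *m R.
  by rewrite eR tens_act_adj !tens_act_mul; apply: eq_tens_act => x; rewrite eA.
have -> : Q = R^t* *m Q' *m R.
  by rewrite eQ' !mulmxA adjmx_unitary // mul1mx -mulmxA adjmx_unitary // mulmx1.
have RR Z W : R^t* *m Z *m R *m (R^t* *m W *m R) = R^t* *m (Z *m W) *m R.
  by rewrite !mulmxA -(mulmxA _ R) (unitarymxP uR) mulmx1.
by rewrite !RR hD.
Qed.

End TensorCommutant.

(** * Column antisymmetrization *)

Section Alternation.
Variables (C : numClosedFieldType) (n N : nat) (K : eqType) (col : 'I_N -> K).
Local Notation S := {ffun 'I_N -> 'I_n}.

Definition keeps (s : 'S_N) := [forall x, col (s x) == col x].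

Definition permute (f : S) (s : 'S_N) : S := [ffun x => f (s x)].

(** The column antisymmetrizer of Young applied to a basis tensor: up to the order of the sites, a
    tensor product of exterior products, one for each value of [col]. *)
Definition alternate (f : S) : 'cV[C]_#|S| :=
  \sum_(s | keeps s) (-1) ^+ s *: pure C (permute f s).

Lemma keepsV s : keeps s -> forall x, col ((s^-1)%g x) = col x.
Proof. by move=> /forallP h x; have /eqP := h ((s^-1)%g x); rewrite permKV. Qed.

Lemma alternate_eq0 (f : S) b c : b != c -> col b = col c -> f b = f c -> alternate f = 0.
Proof.
move=> bc colbc fbc.
have keepsM s : keeps (s * tperm b c) = keeps s.
  apply: eq_forallb => x; rewrite permM.
  by case: tpermP => [->|->|//]; rewrite colbc.
have : alternate f = - alternate f.
  rewrite {1}/alternate (reindex_inj (mulIg (tperm b c))) /= (eq_bigl _ _ keepsM) -sumrN.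
  apply: eq_bigr => s _; rewrite odd_permM odd_tperm bc addbT -signr_odd.
  have -> : permute f (s * tperm b c) = permute f s.
    by apply/ffunP => x; rewrite !ffunE permM; case: tpermP => [->|->|].
  by case: (odd_perm s); rewrite /= ?expr1 ?expr0 ?scaleN1r ?scale1r ?opprK.
move/eqP; rewrite -subr_eq0 opprK -mulr2n -scaler_nat scaler_eq0 pnatr_eq0 /=.
by move/eqP.
Qed.

(** As [fam] factors through [col], the permutations preserving columns preserve families, so
    [fam_op] commutes with antisymmetrization and acts by the Leibniz rule. *)
Lemma fam_op_alternate (I : finType) (fam : 'I_N -> I) (g : K -> I) a i j (f : S) :
  (forall x, fam x = g (col x)) ->
  fam_op fam a (delta_mx i j) *m alternate f =
  \sum_(c | (fam c == a) && (f c == j)) alternate (upd f c i).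
Proof.
move=> hg; rewrite /alternate mulmx_sumr exchange_big; apply: eq_bigr => s ks.
rewrite -scalemxAr -scaler_sumr; congr (_ *: _); rewrite mulmx_suml.
rewrite [RHS](reindex_inj (@perm_inj _ s)) /=.
rewrite [LHS](eq_bigr (fun p => (f (s p) == j)%:R *: pure C (upd (permute f s) p i))); last first.
  by move=> p _; rewrite site_delta_pure [permute f s p]ffunE.
have fs p : fam (s p) = fam p by rewrite !hg; have /forallP/(_ p)/eqP -> := ks.
rewrite [RHS](eq_bigl (fun p => (fam p == a) && (f (s p) == j))); last by move=> p; rewrite fs.
rewrite big_mkcondr; apply: eq_bigr => p _ /=; case: (f (s p) == j); rewrite ?scale0r // scale1r.
congr (pure C _); apply/ffunP => x; rewrite !ffunE (inj_eq perm_inj).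
by case: eqP.
Qed.

End Alternation.

(** * A determinantal semi-invariant *)

(** Jacobi's formula for the derivative of the determinant of [M *m (1 + t Z)] at 0, row by row. *)
Lemma sum_det_row (C : comNzRingType) N (M Z : 'M[C]_N) :
  \sum_p \det (\matrix_(x, q) (if x == p then (M *m Z) x q else M x q)) = \tr Z * \det M.
Proof.
transitivity (\tr (M *m Z *m \adj M)).
  apply: eq_bigr => p _; rewrite (expand_det_row _ p) [RHS]mxE; apply: eq_bigr => q _.
  rewrite mxE eqxx [\adj M q p]mxE; congr (_ * _); rewrite /cofactor; congr (_ * \det _).
  by apply/matrixP => x y; rewrite !mxE eq_sym (negPf (neq_lift _ _)).
by rewrite mxtrace_mulC mulmxA mul_adj_mx mul_scalar_mx linearZ /= mulrC.
Qed.

Lemma sum_mxvec_index (V : nmodType) n r (F : 'I_(n * r) -> V) :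
  \sum_q F q = \sum_i \sum_j F (mxvec_index i j).
Proof.
rewrite pair_bigA (reindex _ (curry_mxvec_bij n r)).
by apply: eq_bigr => -[].
Qed.

Lemma mxtrace_lin_mulmx (C : comNzRingType) n r (X : 'M[C]_n) :
  \tr (lin_mulmx X : 'M_(n * r)) = r%:R * \tr X.
Proof.
rewrite /mxtrace sum_mxvec_index mulr_sumr; apply: eq_bigr => i _.
rewrite (eq_bigr (fun=> X i i)) => [|j _]; last first.
  transitivity (row (mxvec_index i j) (lin_mulmx X) 0 (mxvec_index i j)); first by rewrite [RHS]mxE.
  rewrite rowE -mxvec_delta mul_vec_lin mxvecE /= mxE (bigD1 i) //= mxE !eqxx mulr1.
  by rewrite big1 ?addr0 // => k ki; rewrite mxE (negPf ki) mulr0.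
by rewrite sumr_const card_ord mulr_natl.
Qed.

Section Determinant.
Variables (C : numClosedFieldType) (n r : nat) (m : 'I_(n * r) -> 'rV[C]_r).
Local Notation N := (n * r)%N.
Local Notation S := {ffun 'I_N -> 'I_n}.

Definition tens_mx (c : 'I_N -> 'cV[C]_n) : 'M[C]_N :=
  \matrix_(p, q) mxvec (c p *m m p) 0 q.

(** The functional sending a pure tensor with factors c_p to the determinant of the vectors c_p ⊗
    m_p. The number of factors must be n r = dim (C^n ⊗ C^r). *)
Definition det_row : 'rV[C]_#|S| :=
  \row_p \det (tens_mx (fun x => delta_mx ((enum_val p : S) x) 0)).

Lemma det_row_act (A : 'I_N -> 'M[C]_n) (f : S) :
  (det_row *m (tens_act A *m pure C f)) 0 0 =
  \det (tens_mx (fun x => A x *m delta_mx (f x) 0)).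
Proof.
rewrite mxE.
transitivity (\sum_(s : S) \det (tens_mx (fun x => delta_mx (s x) 0)) * \prod_x A x (s x) (f x)).
  rewrite -(sum_enum_val (fun s : S => _ * _)); apply: eq_bigr => p _.
  by rewrite mxE; congr (_ * _); rewrite -colE mxE mxE enum_rankK.
have hE x q : tens_mx (fun x => A x *m delta_mx (f x) 0) x q =
    \sum_i A x i (f x) * mxvec (delta_mx i 0 *m m x) 0 q.
  rewrite mxE; have -> : A x *m delta_mx (f x) 0 =
      \sum_i A x i (f x) *: delta_mx i 0 :> 'cV[C]_n.
    rewrite -colE [LHS]matrix_sum_delta; apply: eq_bigr => i _.
    by rewrite big_ord1 mxE.
  rewrite mulmx_suml linear_sum summxE; apply: eq_bigr => i _.
  by rewrite -scalemxAl linearZ mxE.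
rewrite [RHS]/determinant.
under [RHS]eq_bigr => s _.
  under eq_bigr do rewrite hE.
  rewrite bigA_distr_bigA mulr_sumr /=.
  over.
rewrite exchange_big /=; apply: eq_bigr => t _; rewrite /determinant mulr_suml.
apply: eq_bigr => s _; rewrite big_split /= -mulrA; congr (_ * _); rewrite mulrC.
by congr (_ * _); apply: eq_bigr => x _; rewrite mxE.
Qed.

(** The infinitesimal form of the fact that g ⊗ 1 on C^n ⊗ C^r has determinant det(g)^r. *)
Lemma det_row_invariant (X : 'M[C]_n) (z : 'cV[C]_#|S|) :
  det_row *m ((\sum_p site p X) *m z) = (r%:R * \tr X) *: (det_row *m z).
Proof.
suff h f : (det_row *m ((\sum_p site p X) *m pure C f)) 0 0 =
    (r%:R * \tr X) * (det_row *m pure C f) 0 0.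
  apply/matrixP => i j; rewrite !ord1 [RHS]mxE.
  have -> : z = \sum_p z p 0 *: pure C (enum_val p : S).
    rewrite [LHS]matrix_sum_delta; apply: eq_bigr => p _.
    by rewrite big_ord1 /pure enum_valK.
  rewrite !mulmx_sumr !summxE mulr_sumr; apply: eq_bigr => p _.
  by rewrite -!scalemxAr [LHS]mxE h [in RHS]mxE mulrCA.
have act1 g : pure C g = tens_act (fun=> 1%:M) *m pure C g by rewrite tens_act1 // mul1mx.
rewrite [in RHS]act1 det_row_act mulmx_suml mulmx_sumr summxE.
set M := tens_mx _.
rewrite -mxtrace_lin_mulmx -sum_det_row; apply: eq_bigr => p _.
rewrite det_row_act; congr (\det _); apply/matrixP => x q; rewrite !mxE.
case: eqP => _ //.
have -> : \sum_j M x j * (lin_mulmx X : 'M_(n * r)) j q =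
    (row x M *m (lin_mulmx X : 'M_(n * r))) 0 q.
  by rewrite [RHS]mxE; apply: eq_bigr => j _; rewrite [in RHS]mxE.
have -> : row x M = mxvec (delta_mx (f x) 0 *m m x).
  by apply/rowP => j; rewrite !mxE mul1mx.
by rewrite mul_vec_lin /= mulmxA.
Qed.

Lemma tens_mx_unit (c : 'I_N -> 'cV[C]_n) :
  (forall phi : 'M[C]_(n, r), (forall p, (c p)^T *m phi *m (m p)^T = 0) -> phi = 0) ->
  \det (tens_mx c) != 0.
Proof.
move=> h; rewrite -unitfE -unitmxE -unitmx_tr -row_free_unit -kermx_eq0.
apply/rowV0P => v /sub_kermxP hv.
rewrite -(vec_mxK v) (h (vec_mx v)) ?linear0 // => p.
apply/matrixP => i j; rewrite !ord1 [RHS]mxE.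
have /rowP /(_ p) := hv; rewrite !mxE => e; rewrite -[RHS]e.
rewrite sum_mxvec_index exchange_big; apply: eq_bigr => k _; rewrite !mxE mulr_suml; apply: eq_bigr => l _.
by rewrite !mxE mxvecE mxE big_ord1 mulrCA mulrA.
Qed.

End Determinant.

(** * Highest weight vectors for several copies of gl_n *)

Section HighestWeightFamilies.
Variables (C : numClosedFieldType) (I : finType) (n : nat).
Local Notation G := (I * 'I_n * 'I_n)%type.
Variables (kap : I -> 'I_n -> nat) (up : I -> bool).

(** The Borel subalgebra may differ between copies: the dual representation is handled with the
    opposite one. *)
Definition raises a (i j : 'I_n) := if up a then (i < j)%N else (j < i)%N.

Definition hw_family d (op : I -> 'M[C]_n -> 'M[C]_d) (v : 'cV[C]_d) :=
  [/\ gl_family op, forall a i j, raises a i j -> op a (delta_mx i j) *m v = 0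
    & forall a i, op a (delta_mx i i) *m v = (kap a i)%:R *: v].

Definition unit_op d (op : I -> 'M[C]_n -> 'M[C]_d) (g : G) := op g.1.1 (delta_mx g.1.2 g.2).

Definition gl_adj (g : G) : G := (g.1.1, g.2, g.1.2).

Definition gl_bracket (g h k : G) : C := if g.1.1 == h.1.1 then
  ((g.2 == h.1.2) && (k == (g.1.1, g.1.2, h.2)))%:R -
  ((h.2 == g.1.2) && (k == (g.1.1, h.1.2, g.2)))%:R else 0.

Definition gl_weight (g : G) : option C :=
  if g.1.2 == g.2 then Some (kap g.1.1 g.2)%:R else None.

Definition gl_raising (g : G) := raises g.1.1 g.1.2 g.2.

Lemma hw_family_module d (op : I -> 'M[C]_n -> 'M[C]_d) v : hw_family op v ->
  hw_module id gl_adj gl_bracket gl_weight gl_raising (unit_op op) v.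
Proof.
move=> [[lin brk com adj] rai wt]; split.
- move=> g; rewrite /unit_op adj; congr op; apply/matrixP => i j.
  by rewrite !mxE conjC_nat andbC.
- move=> [[a i j]] [[b k l]]; rewrite /unit_op /gl_bracket /=.
  case: eqP => [<-|/eqP ab]; last first.
    by rewrite com // big1 ?addr0 // => c _; rewrite scale0r.
  rewrite brk; congr (_ + _).
  have opB X Y : op a (X - Y) = op a X - op a Y.
    by have := lin a (-1) Y X; rewrite !scaleN1r [_ + X]addrC [_ + op a X]addrC.
  have op0 : op a 0 = 0 by have := opB 0 0; rewrite !subrr.
  have opMn X (c : bool) : op a (X *+ c) = op a X *+ c by case: c; rewrite ?mulr1n ?mulr0n.
  rewrite opB !mul_delta_mx_cond !opMn /=.
  under eq_bigr do rewrite scalerBl.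
  have pick (c : bool) (h : G) : \sum_(g : G) (c && (g == h))%:R *: unit_op op g =
      unit_op op h *+ c.
    case: c => /=; last by rewrite big1 // => g _; rewrite scale0r.
    rewrite (bigD1 h) //= eqxx scale1r big1 ?addr0 // => g /negPf ->.
    by rewrite scale0r.
  by rewrite big_split sumrN /= !pick.
- by move=> g; apply: rai.
by move=> g c; rewrite /gl_weight; case: eqP => // e [<-]; rewrite /unit_op e wt.
Qed.

Lemma gl_triangular (g : G) : [|| gl_raising g, gl_raising (gl_adj g) | gl_weight g != None].
Proof.
rewrite /gl_raising /raises /gl_weight /=.
by case: (up _); case: ltngtP => //= /val_inj ->; rewrite eqxx.
Qed.

End HighestWeightFamilies.

Lemma card_boxes_sum (I J : finType) (kap : I -> J -> nat) K :
  (forall a j, (kap a j <= K)%N) ->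
  #|[pred x : I * J * 'I_K | (x.2 < kap x.1.1 x.1.2)%N]| = (\sum_a \sum_j kap a j)%N.
Proof.
move=> hK; rewrite -sum1_card big_mkcond.
rewrite -(pair_bigA _ (fun x l => if (x, l) \in [pred x : I * J * 'I_K | (x.2 < kap x.1.1 x.1.2)%N]
  then 1 else 0)%N) /= [RHS]pair_bigA; apply: eq_bigr => -[a j] _ /=.
rewrite -big_mkcond /= -[RHS]card_ord -[RHS]sum1_card (big_ord_widen K (fun=> 1%N)) //.
Qed.

(** * A module carrying a nonzero semi-invariant *)

Section TensorModel.
Variables (C : numClosedFieldType) (I : finType) (n r : nat).
Variables (kap : I -> 'I_n -> nat) (up : I -> bool).
Hypothesis kap_up : forall a i j, raises up a i j -> (kap a j <= kap a i)%N.
Hypothesis sum_kap : (\sum_a \sum_j kap a j = n * r)%N.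
Variables (A : I -> 'M[C]_n) (m : I -> nat -> 'rV[C]_r).
Hypothesis A_unitary : forall a, A a \is unitarymx.
Hypothesis full_rank : forall phi : 'M[C]_(n, r), (forall a j l, (l < kap a j)%N ->
      row j (A a) *m phi *m (m a l)^T = 0) -> phi = 0.
Local Notation N := (n * r)%N.
Local Notation S := {ffun 'I_N -> 'I_n}.

(** Boxes (a, j, l) of the Young diagrams of the [kap a], with row [j] and column [l]. There are n r
    of them, and they label the sites of the tensor power; the type ['I_N] bounds [l], since
    [kap a j <= N]. *)
Let boxes := [pred x : I * 'I_n * 'I_N | (x.2 < kap x.1.1 x.1.2)%N].

Let kap_le a j : (kap a j <= N)%N.
Proof. by rewrite -sum_kap (bigD1 a) //= (bigD1 j) //= -addnA leq_addr. Qed.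

Let card_boxes : N = #|boxes|.
Proof. by rewrite -[LHS]sum_kap; apply/esym/card_boxes_sum. Qed.

Let box (p : 'I_N) := enum_val (cast_ord card_boxes p).
Let fam p := (box p).1.1.
Let row_of p := (box p).1.2.
Let lev p : nat := (box p).2.
Let col p := (fam p, lev p).

Let lev_lt p : (lev p < kap (fam p) (row_of p))%N.
Proof. by have := enum_valP (cast_ord card_boxes p); rewrite inE. Qed.

Let box_inj p q : col p = col q -> row_of p = row_of q -> p = q.
Proof.
rewrite /col /fam /lev /row_of => -[ef el] er.
apply/(@cast_ord_inj _ _ card_boxes)/enum_val_inj; rewrite -/(box p) -/(box q).
move: (box p) (box q) ef el er => [[a j] l] [[b k] l'] /= -> el ->.
by congr (_, _); apply: val_inj.
Qed.

Let box_ex a j l : (l < kap a j)%N -> exists p, [/\ fam p = a, row_of p = j & lev p = l].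
Proof.
move=> lk; have lN : (l < N)%N by apply: leq_trans lk (kap_le a j).
have hx : (a, j, Ordinal lN) \in boxes by rewrite inE.
exists (cast_ord (esym card_boxes) (enum_rank_in hx (a, j, Ordinal lN))).
by rewrite /fam /row_of /lev /box cast_ordKV enum_rankK_in.
Qed.

Let v0 : 'cV[C]_#|S| := alternate C col [ffun p => row_of p].

(** Each term replaces an entry [j] of a column by [i]. As [kap a j <= kap a i], that column also
    has a box in row [i], so the entry is repeated and the antisymmetrization vanishes. *)
Let v0_raising a i j : raises up a i j -> fam_op fam a (delta_mx i j) *m v0 = 0.
Proof.
move=> rij; have ij : i != j.
  by apply: contraTneq rij => ->; rewrite /raises; case: (up a); rewrite ltnn.
rewrite (@fam_op_alternate _ _ _ _ _ _ _ fst) // big1 // => c /andP[/eqP ca].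
rewrite ffunE => /eqP cj.
have lc : (lev c < kap a i)%N.
  by apply: leq_trans (kap_up rij); rewrite -ca -cj.
have [b [ba bi bl]] := box_ex lc.
have bc : b != c by apply: contra ij => /eqP e; rewrite -bi e cj.
apply: (@alternate_eq0 _ _ _ _ _ _ b c) => //; first by rewrite /col ba bl ca.
by rewrite !ffunE eqxx (negPf bc) bi.
Qed.

Let v0_weight a i : fam_op fam a (delta_mx i i) *m v0 = (kap a i)%:R *: v0.
Proof.
rewrite (@fam_op_alternate _ _ _ _ _ _ _ fst) //.
rewrite (eq_bigr (fun=> v0)) => [|c /andP[_ /eqP ci]]; last first.
  congr (alternate _ _ _); apply/ffunP => x; rewrite ffunE; case: eqP => // ->.
  by rewrite -ci.
rewrite sumr_const scaler_nat; congr (_ *+ _).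
set P := (X in #|X|).
have <- : size [seq lev c | c <- enum P] = kap a i.
  rewrite -(size_iota 0 (kap a i)); apply/perm_size/uniq_perm.
  - rewrite map_inj_in_uniq ?enum_uniq // => c c'; rewrite !mem_enum /P -!topredE /= !ffunE.
    move=> /andP[/eqP ca /eqP ci] /andP[/eqP ca' /eqP ci'] el.
    by apply: box_inj; rewrite /col ?ca ?ca' ?el ?ci ?ci'.
  - exact: iota_uniq.
  move=> l; rewrite mem_iota /= add0n; apply/mapP/idP => [[c]|].
    rewrite mem_enum /P -topredE /= ffunE => /andP[/eqP ca /eqP ci] ->.
    by have := lev_lt c; rewrite ca ci.
  move=> /box_ex[c [ca ci cl]]; exists c => //.
  by rewrite mem_enum /P -topredE /= ffunE ca ci !eqxx.
by rewrite size_map cardE.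
Qed.

Let z0 : 'cV[C]_#|S| := tens_act (fun p => (A (fam p))^T) *m v0.

(** The projection on the cyclic submodule commutes with [fam_op], hence with the group elements
    [tens_act] by [tens_act_commute], so translates of [v0] stay in that submodule. *)
Let z0_words : in_words (unit_op (fam_op fam)) v0 z0.
Proof.
have fam_gl := fam_op_gl C n fam.
have hadj (g : I * 'I_n * 'I_n) :
    (unit_op (fam_op fam) g)^t* = unit_op (fam_op fam) (gl_adj g) :> 'M[C]_#|S|.
  by have [ha _ _ _] := hw_family_module (And3 fam_gl v0_raising v0_weight).
have [Q [Qv Qc Qw]] := words_projection v0 hadj.
suff -> : z0 = Q *m z0 by exact: Qw.
rewrite /z0 mulmxA (@tens_act_commute _ _ _ _ fam (fun a => (A a)^T)) => [|a|a X].
- by rewrite -mulmxA Qv.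
- by rewrite trmx_unitary.
rewrite [X]matrix_sum_delta; have [lin _ _ _] := fam_gl.
have fam0 : fam_op fam a 0 = 0 :> 'M[C]_#|S|.
  by rewrite /fam_op big1 // => p _; rewrite linear0.
elim/big_ind: _ => [|Y Z hY hZ|i _].
- by rewrite fam0 mul0mx mulmx0.
- by have := lin a 1 Y Z; rewrite !scale1r => ->; rewrite mulmxDl mulmxDr hY hZ.
elim/big_ind: _ => [|Y Z hY hZ|j _].
- by rewrite fam0 mul0mx mulmx0.
- by have := lin a 1 Y Z; rewrite !scale1r => ->; rewrite mulmxDl mulmxDr hY hZ.
have := lin a (X i j) (delta_mx i j) 0; rewrite fam0 !addr0 => ->.
by rewrite -scalemxAl -scalemxAr (Qc (a, i, j)).
Qed.

Let mbox p := m (fam p) (lev p).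

(** The vectors [mbox] depend only on the column of a box, so each column permutation permutes rows
    of one determinant and its sign cancels the one in [alternate]. All terms are equal, and
    [full_rank] makes the determinant nonzero. *)
Let det_z0 : (det_row mbox *m z0) 0 0 != 0.
Proof.
pose F := tens_mx mbox (fun x => (A (fam x))^T *m delta_mx (row_of x) 0).
have -> : (det_row mbox *m z0) 0 0 = #|[pred s : 'S_N | keeps col s]|%:R * \det F.
  rewrite /z0 /v0 /alternate !mulmx_sumr summxE.
  rewrite -(sum1_card [pred s : 'S_N | keeps col s]) natr_sum mulr_suml.
  apply: eq_bigr => s ks; rewrite mul1r -!scalemxAr mxE det_row_act.
  have -> : tens_mx mbox (fun x => (A (fam x))^T *m
      delta_mx (permute [ffun p => row_of p] s x) 0) = row_perm s F.
    apply/matrixP => p q; rewrite !mxE !ffunE.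
    by have /forallP /(_ p) /eqP [e1 e2] := ks; rewrite /mbox e1 e2.
  by rewrite row_permE det_mulmx det_perm mulrA -expr2 sqrr_sign mul1r.
rewrite mulf_neq0 //.
  rewrite pnatr_eq0 -lt0n; apply/card_gt0P; exists 1%g.
  by apply/forallP => x; rewrite perm1.
apply: tens_mx_unit => phi hphi; apply: full_rank => a j l /box_ex[p [pa pj pl]].
have := hphi p; rewrite trmx_mul trmxK trmx_delta -rowE /mbox.
by rewrite pa pj pl.
Qed.

Theorem tensor_highest_weight_model :
  exists d (op : I -> 'M[C]_n -> 'M[C]_d) (v : 'cV[C]_d) (L : 'rV[C]_d),
  [/\ hw_family kap up op v,
      forall X (z : 'cV[C]_d), L *m ((\sum_a op a X) *m z) = (r%:R * \tr X) *: (L *m z)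
    & exists2 z : 'cV[C]_d, in_words (unit_op op) v z & L *m z != 0].
Proof.
exists #|S|, (fam_op fam), v0, (det_row mbox); split.
- by split; [exact: fam_op_gl | exact: v0_raising | exact: v0_weight].
- move=> X z; rewrite -det_row_invariant; congr (_ *m (_ *m _)).
  rewrite /fam_op (exchange_big_dep xpredT) //=; apply: eq_bigr => p _.
  by rewrite (big_pred1 (fam p)) // => a; rewrite /= eq_sym.
exists z0; first exact: z0_words.
by apply: contra det_z0 => /eqP ->; rewrite mxE.
Qed.

End TensorModel.

(** * Weights of the torus and of its Lie algebra *)

Section CircleWeights.
Variables (C : numClosedFieldType).
Local Notation ii := ('i : C).

Lemma unit_circle_pow (k : int) t :
  circle_pow (1%:M : 'M[C]_1) (fun=> k) t = (exprz t k)%:M.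
Proof.
rewrite /circle_pow adjmx1 mul1mx mulmx1; apply/matrixP => a b.
by rewrite !ord1 !mxE eqxx !mulr1n.
Qed.

Lemma unit_circle_gen (k : int) : circle_gen (1%:M : 'M[C]_1) (fun=> k) = k%:~R%:M.
Proof.
rewrite /circle_gen adjmx1 mul1mx mulmx1; apply/matrixP => a b.
by rewrite !ord1 !mxE eqxx !mulr1n.
Qed.

Lemma unitary1 n : (1%:M : 'M[C]_n) \is unitarymx.
Proof. by apply/unitarymxP; rewrite adjmx1 mulmx1. Qed.

Lemma circle_gen_weight d (P : 'M[C]_d) kap (v : 'cV[C]_d) (k : int) : P \is unitarymx ->
  (forall t, `|t| = 1 -> circle_pow P kap t *m v = exprz t k *: v) ->
  circle_gen P kap *m v = k%:~R *: v.
Proof.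
move=> uP h; have r1 : (1 : C) \is Num.real by exact: rpred1.
have f1 := first_order_mul (first_order_circle_pow kap uP r1) (first_order_const v).
have f2 := first_order_mul (first_order_const v)
  (first_order_circle_pow (fun=> k) (unitary1 1) r1).
have := first_order_uniq f1 (first_order_ext _ f2).
rewrite mulmx0 add0r mul0mx addr0 mulr1 unit_circle_gen -scalemxAl -scalemxAr mul_mx_scalar.
move=> e; have /e /(scalerI (neq0Ci _)) : forall s : C, s \is Num.real ->
    v *m circle_pow 1%:M (fun=> k) (cayley (1 * s)) = circle_pow P kap (cayley (1 * s)) *m v.
  by move=> s sr; rewrite unit_circle_pow mul_mx_scalar h // norm_cayley ?mul1r.
exact.
Qed.

End CircleWeights.

Section DiffWeights.
Variables (C : numClosedFieldType) (n d : nat) (rho : 'M[C]_n -> 'M[C]_d).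
Hypothesis h : circle_diagonal rho.

Definition ediff i j : 'M[C]_d := diff_rep h (delta_mx i j).

Lemma delta_unit (i : 'I_n) : (delta_mx i 0 : 'cV[C]_n) *m (delta_mx i 0 : 'cV[C]_n)^t* = delta_mx i i.
Proof.
have -> : (delta_mx i 0 : 'cV[C]_n)^t* = delta_mx 0 i.
  by apply/matrixP => a b; rewrite !mxE conjC_nat andbC.
by rewrite mul_delta_mx.
Qed.

Lemma ediff_adj i j : (ediff i j)^t* = ediff j i.
Proof.
rewrite -diff_rep_adj; congr (diff_rep h _).
by apply/matrixP => a b; rewrite !mxE conjC_nat andbC.
Qed.

Lemma ediff_bracket i j k l : ediff i j *m ediff k l = ediff k l *m ediff i j +
  (ediff i l *+ (j == k) - ediff k j *+ (l == i)).
Proof.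
have -> : ediff i l *+ (j == k) - ediff k j *+ (l == i) =
    diff_rep h (delta_mx i j *m delta_mx k l - delta_mx k l *m delta_mx i j).
  by rewrite !mul_delta_mx_cond linearB /= !raddfMn.
by rewrite diff_rep_bracket addrC subrK.
Qed.

Lemma torus_weight (kap : 'I_n -> int) (v : 'cV[C]_d) :
  (forall t : 'rV[C]_n, (forall i, `|t 0 i| = 1) ->
     rho (diag_mx t) *m v = (\prod_i exprz (t 0 i) (kap i)) *: v) <->
  (forall i, ediff i i *m v = (kap i)%:~R *: v).
Proof.
split=> [hv i|hv t t1].
  have [P [k uP [e hP]]] := diff_rep_unit h (unit_delta C i).
  rewrite /ediff -delta_unit e; apply: circle_gen_weight => // t t1.
  rewrite -hP //; pose u : 'rV[C]_n := \row_j (if j == i then t else 1).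
  have -> : circle_of (delta_mx i 0) t = diag_mx u.
    apply/matrixP => a b; rewrite /circle_of delta_unit !mxE.
    have [<-|ab] := eqVneq a b; rewrite ?mulr1n ?mulr0n.
      by rewrite andbb; case: eqP; rewrite ?mulr1 ?mulr0 ?addr0 // addrC subrK.
    rewrite add0r; case: eqP => [ai|]; last by rewrite mulr0.
    by case: eqP => [bi|]; [rewrite ai bi eqxx in ab | rewrite mulr0].
  rewrite hv => [|j]; last by rewrite mxE; case: eqP; rewrite ?normr1.
  rewrite (bigD1 i) //= mxE eqxx big1 ?mulr1 // => j ji.
  by rewrite mxE (negPf ji) exp1rz.
rewrite diag_mx_circle_of (rho_prod h) => [|a]; last first.
  by apply: unitary_circle_of => //; apply: unit_delta.
elim: (index_enum _) => [|i s IH]; first by rewrite !big_nil mul1mx scale1r.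
rewrite !big_cons -mulmxA IH -scalemxAr mulrC -scalerA; congr (_ *: _).
have [P [k uP [e hP]]] := diff_rep_unit h (unit_delta C i).
rewrite hP //; have := hv i; rewrite /ediff -delta_unit e => ei.
(* The eigenvector [v] is viewed as an intertwiner from the one-dimensional representation of weight
   [kap i]. *)
have := @circle_gen_intertwine _ _ _ v _ (fun=> kap i) P k (t 0 i) (unitary1 C 1) uP.
rewrite unit_circle_gen unit_circle_pow !mul_mx_scalar => -> //.
Qed.

End DiffWeights.

(** * Diagonalizing a Hermitian matrix with a given spectrum *)

Section IntegralSpectrum.
Variables (C : numClosedFieldType) (n : nat).

Lemma char_poly_unitary_conj (U A : 'M[C]_n) : U \is unitarymx ->
  char_poly (U^t* *m A *m U) = char_poly A.
Proof.
move=> uU; have UU := adjmx_unitary uU.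
have UP : map_mx polyC (U^t*) *m map_mx polyC U = 1%:M by rewrite -map_mxM UU map_mx1.
have -> : char_poly (U^t* *m A *m U) =
    \det (map_mx polyC (U^t*) *m char_poly_mx A *m map_mx polyC U).
  congr (\det _); rewrite /char_poly_mx mulmxBr mulmxBl !map_mxM.
  by rewrite mul_mx_scalar -scalemxAl UP scalemx1.
by rewrite !det_mulmx mulrAC -det_mulmx UP det1 mul1r.
Qed.

Lemma char_poly_diag (D : 'rV[C]_n) : char_poly (diag_mx D) = \prod_i ('X - (D 0 i)%:P).
Proof.
rewrite char_poly_trig ?diag_mx_is_trig //; apply: eq_bigr => i _.
by rewrite mxE eqxx mulr1n.
Qed.

Lemma hermitian_spectrum (H : 'M[C]_n) (lam : 'I_n -> C) : H \is hermsymmx ->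
  char_poly H = \prod_i ('X - (lam i)%:P) ->
  exists2 U : 'M[C]_n, U \is unitarymx & H = U^t* *m diag_mx (\row_j lam j) *m U.
Proof.
move=> /hermitian_normalmx /orthomx_spectralP.
have uP := spectral_unitarymx H; rewrite (invmx_unitary uP).
move: (spectralmx H) (spectral_diag H) uP => P D uP eH.
rewrite eH char_poly_unitary_conj // char_poly_diag => e.
have /tuple_permP[p hp] : perm_eq [tuple lam i | i < n] [tuple D 0 i | i < n].
  apply: prod_XsubC_eq; rewrite !big_tuple; under eq_bigr do rewrite tnth_mktuple.
  by under [RHS]eq_bigr do rewrite tnth_mktuple.
have lamE i : lam i = D 0 (p i).
  have /(congr1 (fun s => nth 0 s i)) := hp.
  by rewrite -!tnth_nth !tnth_mktuple.
exists (row_perm p P).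
  apply/unitarymxP; rewrite row_permE adjmxM -mulmxA (mulmxA P) (unitarymxP uP) mul1mx.
  by rewrite tr_perm_mx map_perm_mx -perm_mxM mulgV perm_mx1.
rewrite !mul_mx_diag; apply/matrixP => i j; rewrite !mxE [LHS](reindex_inj (@perm_inj _ p)) /=.
by apply: eq_bigr => k _; rewrite !mxE lamE.
Qed.

End IntegralSpectrum.

Lemma in_words_ind (C : numClosedFieldType) (G : Type) d (op : G -> 'M[C]_d) v (P : 'cV[C]_d -> Prop) :
  P v -> P 0 -> (forall a x y, P x -> P y -> P (a *: x + y)) ->
  (forall g x, P x -> P (op g *m x)) -> forall x, in_words op v x -> P x.
Proof.
move=> Pv P0 PD Pop x [l ->]; elim: l => [|p l IH]; first by rewrite big_nil.
rewrite big_cons; apply: PD => //.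
by elim: p.2 => //= g w IHw; apply: Pop.
Qed.

(** * Morphisms out of a cyclic highest weight module *)

Section Transport.
Variables (C : numClosedFieldType) (G : eqType) (K : finType) (gen : K -> G).
Variables (adj : G -> G) (br : G -> G -> K -> C) (chi : G -> option C) (raising : pred G).
Hypothesis tri : forall g, [|| raising g, raising (adj g) | chi g != None].

(** [T] sends a combination of words on [v] to the same combination on [v']; this is well defined
    since [highest_weight_relations] carries relations over. *)
Lemma hw_module_morphism d d' (op : G -> 'M[C]_d) (v : 'cV[C]_d)
    (op' : G -> 'M[C]_d') (v' : 'cV[C]_d') :
  hw_module gen adj br chi raising op v -> hw_module gen adj br chi raising op' v' ->
  v != 0 -> (forall x, in_words op v x) ->
  exists T : 'M[C]_(d', d), T *m v = v' /\ forall g, T *m op g = op' g *m T.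
Proof.
move=> hm hm' v0 span.
pose comb e (o : G -> 'M[C]_e) (y : 'cV[C]_e) l := \sum_(p <- l) p.1 *: word_act o p.2 y.
have hl k : {l | delta_mx k 0 = comb d op v l} by apply: cid; exact: span.
pose T : 'M[C]_(d', d) := \matrix_(i, k) comb d' op' v' (projT1 (hl k)) i 0.
have TE l : T *m comb d op v l = comb d' op' v' l.
  pose x := comb d op v l.
  have Tx : T *m x = \sum_k x k 0 *: comb d' op' v' (projT1 (hl k)).
    apply/matrixP => i j; rewrite ord1 mxE summxE; apply: eq_bigr => k _.
    by rewrite !mxE mulrC.
  (* The relation expressing that [l] and the chosen expansion of its value on the standard basis
     represent the same vector. *)
  pose L := flatten [seq [seq (x k 0 * p.1, p.2) | p <- projT1 (hl k)] | k <- index_enum (ordinal d)]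
    ++ [seq (- p.1, p.2) | p <- l].
  have combL e (o : G -> 'M[C]_e) (y : 'cV[C]_e) :
      comb e o y L = (\sum_k x k 0 *: comb e o y (projT1 (hl k))) - comb e o y l.
    rewrite /comb big_cat big_flatten !big_map -sumrN /=; congr (_ + _).
      apply: eq_bigr => k _; rewrite big_map scaler_sumr; apply: eq_bigr => p _.
      by rewrite scalerA.
    by apply: eq_bigr => p _; rewrite scaleNr.
  have := highest_weight_relations tri (l := L) hm hm' v0.
  rewrite -!/(comb _ _ _ _) !combL -Tx => h; apply/eqP; rewrite -subr_eq0 h //.
  rewrite -/x [X in _ - X]matrix_sum_delta -sumrB big1 // => k _.
  by rewrite big_ord1 -(projT2 (hl k)) subrr.
exists T; split.
  have e1 e (o : G -> 'M[C]_e) (y : 'cV[C]_e) : comb e o y [:: (1, [::])] = y.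
    by rewrite /comb big_seq1 scale1r.
  by have := TE [:: (1, [::])]; rewrite !e1.
move=> g; suff hk k : T *m op g *m delta_mx k 0 = op' g *m T *m delta_mx k 0 :> 'cV[C]_d'.
  by apply/matrixP => i k; have /matrixP /(_ i 0) := hk k; rewrite -!colE ![col _ _ _ _]mxE.
have eg e (o : G -> 'M[C]_e) (y : 'cV[C]_e) l :
    o g *m comb e o y l = comb e o y [seq (p.1, g :: p.2) | p <- l].
  rewrite /comb mulmx_sumr big_map; apply: eq_bigr => p _.
  by rewrite scalemxAr.
by rewrite -!mulmxA (projT2 (hl k)) eg !TE eg.
Qed.

End Transport.

(** * Shifts and duals of representations of gl_n *)

Section GlRep.
Variables (C : numClosedFieldType) (n : nat).

Definition gl_rep d (pi : 'M[C]_n -> 'M[C]_d) :=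
  [/\ linear pi, forall X Y, pi X *m pi Y = pi Y *m pi X + pi (X *m Y - Y *m X)
    & forall X, (pi X)^t* = pi (X^t*)].

Definition hw_vector d (kap : 'I_n -> nat) (up : bool) (pi : 'M[C]_n -> 'M[C]_d) (v : 'cV[C]_d) :=
  (forall i j : 'I_n, (if up then i < j else j < i)%N -> pi (delta_mx i j) *m v = 0) /\
  forall i, pi (delta_mx i i) *m v = (kap i)%:R *: v.

Definition rep_words d (pi : 'M[C]_n -> 'M[C]_d) (v x : 'cV[C]_d) :=
  in_words (fun g : 'I_n * 'I_n => pi (delta_mx g.1 g.2)) v x.

Lemma gl_rep_diff d (rho : 'M[C]_n -> 'M[C]_d) (h : circle_diagonal rho) : gl_rep (diff_rep h).
Proof.
split=> [|X Y|X]; first exact: diff_rep_is_linear.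
  by rewrite diff_rep_bracket addrC subrK.
by rewrite diff_rep_adj.
Qed.

(** The derivative of the twist by the [c]-th power of the determinant, which makes highest weights
    nonnegative. *)
Definition shift_rep d (pi : 'M[C]_n -> 'M[C]_d) (c : nat) X := pi X + (c%:R * \tr X) *: 1%:M.

Definition dual_rep d (pi : 'M[C]_n -> 'M[C]_d) X := - (pi X)^T.

Lemma gl_rep_shift d (pi : 'M[C]_n -> 'M[C]_d) c : gl_rep pi -> gl_rep (shift_rep pi c).
Proof.
move=> [lin brk adj]; split=> [a X Y|X Y|X]; rewrite /shift_rep.
- by rewrite lin linearP /= mulrDr scalerDl scalerDr scalerA mulrCA addrACA.
- rewrite linearB /= [\tr (Y *m X)]mxtrace_mulC subrr mulr0 scale0r addr0.
  rewrite !mulmxDl !mulmxDr brk -!scalemxAl -!scalemxAr !mulmx1 !mul1mx -!addrA; congr (_ + _).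
  rewrite addrC !addrA; congr (_ + _); rewrite !scalerA [_ * (c%:R * \tr Y)]mulrC.
  by congr (_ + _); rewrite addrC.
rewrite linearD linearZ /= map_mxD map_mxZ /= adjmx1 adj; congr (_ + _ *: _).
by rewrite rmorphM rmorph_nat trace_map_mx mxtrace_tr.
Qed.

Lemma gl_rep_dual d (pi : 'M[C]_n -> 'M[C]_d) : gl_rep pi -> gl_rep (dual_rep pi).
Proof.
move=> [lin brk adj]; split=> [a X Y|X Y|X]; rewrite /dual_rep.
- by rewrite lin linearP /= opprD scalerN.
- have pi0 : pi 0 = 0 by have := lin (-1) 0 0; rewrite scaler0 addr0 scaleN1r addNr.
  have piN Z : pi (- Z) = - pi Z by have := lin (-1) Z 0; rewrite !scaleN1r pi0 !addr0.
  rewrite !mulNmx !mulmxN !opprK -!trmx_mul -linearN -linearD /=; congr (_^T).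
  by rewrite (brk Y X) -piN opprB.
by apply/matrixP => i j; rewrite -adj !mxE rmorphN.
Qed.

Lemma in_words_op (G : Type) d (op : G -> 'M[C]_d) v g x :
  in_words op v x -> in_words op v (op g *m x).
Proof.
move=> [l ->]; exists [seq (p.1, g :: p.2) | p <- l].
rewrite big_map mulmx_sumr; apply: eq_bigr => p _.
by rewrite scalemxAr.
Qed.

Lemma in_words_nil (G : Type) d (op : G -> 'M[C]_d) v : in_words op v v.
Proof. by exists [:: (1, [::])]; rewrite big_seq1 scale1r. Qed.

Lemma rep_words_shift d (pi : 'M[C]_n -> 'M[C]_d) c v x :
  rep_words pi v x -> rep_words (shift_rep pi c) v x.
Proof.
apply: in_words_ind => [||a y z|[i j] y hy] /=.
- exact: in_words_nil.
- exact: in_words0.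
- exact: in_wordsD.
have -> : pi (delta_mx i j) *m y = - (c%:R * \tr (delta_mx i j : 'M[C]_n)) *: y +
    shift_rep pi c (delta_mx i j) *m y.
  by rewrite mulmxDl -scalemxAl mul1mx scaleNr addrC addrK.
by apply: in_wordsD => //; apply: (in_words_op (i, j)).
Qed.

Lemma rep_words_dual d (pi : 'M[C]_n -> 'M[C]_d) v : gl_rep pi ->
  (forall x, rep_words pi v x) -> forall x, rep_words (dual_rep pi) (map_mx Num.conj v) x.
Proof.
move=> [_ _ adj] hw x.
have -> : x = map_mx Num.conj (map_mx Num.conj x).
  by apply/matrixP => i j; rewrite !mxE conjCK.
apply: (in_words_ind (P := fun y => rep_words (dual_rep pi) (map_mx Num.conj v) (map_mx Num.conj y)))
  (hw (map_mx Num.conj x)) => [||a y z hy hz|[i j] y hy] /=.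
- exact: in_words_nil.
- by rewrite map_mx0; apply: in_words0.
- by rewrite map_mxD map_mxZ; apply: in_wordsD.
have -> : map_mx Num.conj (pi (delta_mx i j) *m y) =
    -1 *: (dual_rep pi (delta_mx j i) *m map_mx Num.conj y) + 0.
  rewrite map_mxM addr0 scaleN1r mulNmx opprK; congr (_ *m _).
  rewrite -[LHS]trmxK map_trmx adj; congr ((pi _)^T).
  by apply/matrixP => a b; rewrite !mxE conjC_nat andbC.
apply: in_wordsD; last exact: in_words0.
exact: (in_words_op (j, i)).
Qed.

Lemma trace_delta_mx (i j : 'I_n) : \tr (delta_mx i j : 'M[C]_n) = (i == j)%:R.
Proof.
rewrite /mxtrace (bigD1 i) //= mxE eqxx big1 ?addr0 // => k /negPf ki.
by rewrite mxE ki.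
Qed.

Lemma hw_vector_shift d (pi : 'M[C]_n -> 'M[C]_d) (c : nat) (v : 'cV[C]_d) (lam : 'I_n -> int)
    (kap : 'I_n -> nat) (up : bool) :
  (forall i j : 'I_n, (if up then i < j else j < i)%N -> pi (delta_mx i j) *m v = 0) ->
  (forall i, pi (delta_mx i i) *m v = (lam i)%:~R *: v) ->
  (forall i, lam i + c%:Z = (kap i)%:Z) -> hw_vector kap up (shift_rep pi c) v.
Proof.
move=> h1 h2 e; split=> [i j ij|i]; rewrite mulmxDl -scalemxAl mul1mx.
  rewrite h1 // add0r trace_delta_mx; have -> : (i == j) = false.
    by apply: contraTF ij => /eqP ->; rewrite ltnn if_same.
  by rewrite mulr0 scale0r.
rewrite h2 trace_delta_mx eqxx mulr1 -scalerDl; congr (_ *: _).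
by have := congr1 (fun z : int => z%:~R : C) (e i); rewrite /= intrD.
Qed.

(** Since [pi] respects adjoints, conjugation turns [pi (delta_mx j i)] into minus the dual action
    of [delta_mx i j]: weights change sign and raising becomes lowering. *)
Lemma hw_vector_dual d (pi : 'M[C]_n -> 'M[C]_d) (v : 'cV[C]_d) (lam : 'I_n -> int) : gl_rep pi ->
  (forall i j : 'I_n, (i < j)%N -> pi (delta_mx i j) *m v = 0) ->
  (forall i, pi (delta_mx i i) *m v = (lam i)%:~R *: v) ->
  (forall i j : 'I_n, (j < i)%N -> dual_rep pi (delta_mx i j) *m map_mx Num.conj v = 0) /\
  (forall i, dual_rep pi (delta_mx i i) *m map_mx Num.conj v = (- lam i)%:~R *: map_mx Num.conj v).
Proof.
move=> [_ _ adj] h1 h2.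
have e i j : dual_rep pi (delta_mx i j) *m map_mx Num.conj v =
    - map_mx Num.conj (pi (delta_mx j i) *m v).
  rewrite mulNmx map_mxM; congr (- (_ *m _)); rewrite -[RHS]trmxK map_trmx adj.
  by congr ((pi _)^T); apply/matrixP => a b; rewrite !mxE conjC_nat andbC.
split=> [i j ij|i]; rewrite e; first by rewrite h1 // map_mx0 oppr0.
by rewrite h2 map_mxZ rmorph_int /= -scaleNr -intrN.
Qed.

End GlRep.

Definition pick3 (T : Type) (x y z : T) (a : 'I_3) : T :=
  match val a with 0%N => x | 1%N => y | _ => z end.

(** * Triple tensor products *)

Section TensorTriple.
Variable C : numClosedFieldType.

Definition tensv d1 d2 (x : 'cV[C]_d1) (y : 'cV[C]_d2) : 'cV[C]_(d1 * d2) :=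
  \col_k (x (mxtens_unindex k).1 0 * y (mxtens_unindex k).2 0).

Lemma tensmx_tensv d1 d2 (A : 'M[C]_d1) (B : 'M[C]_d2) (x : 'cV[C]_d1) (y : 'cV[C]_d2) :
  (A *t B) *m tensv x y = tensv (A *m x) (B *m y).
Proof.
apply/matrixP => k j; rewrite ord1 !mxE mulr_sum; apply: eq_bigr => l _.
by rewrite !mxE mulrACA.
Qed.

Lemma tensv_linl d1 d2 a (x x' : 'cV[C]_d1) (y : 'cV[C]_d2) :
  tensv (a *: x + x') y = a *: tensv x y + tensv x' y.
Proof. by apply/matrixP => k j; rewrite !mxE mulrDl mulrA. Qed.

Lemma tensv_linr d1 d2 a (x : 'cV[C]_d1) (y y' : 'cV[C]_d2) :
  tensv x (a *: y + y') = a *: tensv x y + tensv x y'.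
Proof. by apply/matrixP => k j; rewrite !mxE mulrDr mulrCA. Qed.

Lemma tensv0l d1 d2 (y : 'cV[C]_d2) : tensv (0 : 'cV[C]_d1) y = 0.
Proof. by apply/matrixP => k j; rewrite !mxE mul0r. Qed.

Lemma tensv0r d1 d2 (x : 'cV[C]_d1) : tensv x (0 : 'cV[C]_d2) = 0.
Proof. by apply/matrixP => k j; rewrite !mxE mulr0. Qed.

Lemma tensvZl d1 d2 a (x : 'cV[C]_d1) (y : 'cV[C]_d2) : tensv (a *: x) y = a *: tensv x y.
Proof. by rewrite -[a *: x]addr0 tensv_linl tensv0l addr0. Qed.

Lemma tensvZr d1 d2 a (x : 'cV[C]_d1) (y : 'cV[C]_d2) : tensv x (a *: y) = a *: tensv x y.
Proof. by rewrite -[a *: y]addr0 tensv_linr tensv0r addr0. Qed.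

Lemma tensv_eq0 d1 d2 (x : 'cV[C]_d1) (y : 'cV[C]_d2) : x != 0 -> y != 0 -> tensv x y != 0.
Proof.
move=> /cV0Pn[i xi] /cV0Pn[j yj]; apply/cV0Pn; exists (mxtens_index (i, j)).
by rewrite mxE mxtens_indexK mulf_neq0.
Qed.

Lemma tensv_span d1 d2 (z : 'cV[C]_(d1 * d2)) :
  z = \sum_k z k 0 *: tensv (delta_mx (mxtens_unindex k).1 0) (delta_mx (mxtens_unindex k).2 0).
Proof.
rewrite {1}[z]matrix_sum_delta; apply: eq_bigr => k _; rewrite big_ord1; congr (_ *: _).
apply/matrixP => l j; rewrite [j]ord1 !mxE !andbT -natrM mulnb; congr (_%:R).
by rewrite -[in RHS]xpair_eqE -!surjective_pairing (can_eq (@mxtens_unindexK _ _)).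
Qed.

Lemma tensmx_linl m1 n1 m2 n2 a (A A' : 'M[C]_(m1, n1)) (B : 'M[C]_(m2, n2)) :
  (a *: A + A') *t B = a *: (A *t B) + A' *t B.
Proof. by apply/matrixP => i j; rewrite !mxE mulrDl mulrA. Qed.

Lemma tensmx_linr m1 n1 m2 n2 a (A : 'M[C]_(m1, n1)) (B B' : 'M[C]_(m2, n2)) :
  A *t (a *: B + B') = a *: (A *t B) + A *t B'.
Proof. by apply/matrixP => i j; rewrite !mxE mulrDr mulrCA. Qed.

Variables (n d1 d2 d3 : nat) (p1 : 'M[C]_n -> 'M[C]_d1) (p2 : 'M[C]_n -> 'M[C]_d2).
Variable p3 : 'M[C]_n -> 'M[C]_d3.

Definition triple (a : 'I_3) (X : 'M[C]_n) : 'M[C]_(d1 * d2 * d3) :=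
  pick3 ((p1 X *t 1%:M) *t 1%:M) ((1%:M *t p2 X) *t 1%:M) (1%:M *t p3 X) a.

Lemma triple_gl : gl_rep p1 -> gl_rep p2 -> gl_rep p3 -> gl_family triple.
Proof.
move=> [l1 b1 a1] [l2 b2 a2] [l3 b3 a3]; split.
- move=> [[|[|[|//]]] ia] a X Y; rewrite /triple /pick3 /=.
  + by rewrite l1 !tensmx_linl.
  + by rewrite l2 tensmx_linr tensmx_linl.
  + by rewrite l3 tensmx_linr.
- move=> [[|[|[|//]]] ia] X Y; rewrite /triple /pick3 /= !tensmx_mul ?mulmx1.
  + by rewrite b1 -[p1 Y *m p1 X]scale1r !tensmx_linl !scale1r.
  + by rewrite b2 -[p2 Y *m p2 X]scale1r tensmx_linr tensmx_linl !scale1r.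
  + by rewrite b3 -[p3 Y *m p3 X]scale1r tensmx_linr !scale1r.
- by move=> [[|[|[|//]]] ia] [[|[|[|//]]] ib] X Y // _;
    rewrite /triple /pick3 /= -?tensmx11 !tensmx_mul ?mulmx1 ?mul1mx.
by move=> [[|[|[|//]]] ia] X; rewrite /triple /pick3 /= !adj_tensmx ?a1 ?a2 ?a3 !adjmx1.
Qed.

Variables (v1 : 'cV[C]_d1) (v2 : 'cV[C]_d2) (v3 : 'cV[C]_d3).

Lemma triple_hw k1 k2 k3 u1 u2 u3 : gl_rep p1 -> gl_rep p2 -> gl_rep p3 ->
  hw_vector k1 u1 p1 v1 -> hw_vector k2 u2 p2 v2 -> hw_vector k3 u3 p3 v3 ->
  hw_family (pick3 k1 k2 k3) (pick3 u1 u2 u3) triple (tensv (tensv v1 v2) v3).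
Proof.
move=> g1 g2 g3 [h1 w1] [h2 w2] [h3 w3]; split; first exact: triple_gl.
- move=> [[|[|[|//]]] ia] i j; rewrite /raises /triple /pick3 /= => ij; rewrite !tensmx_tensv.
  + by rewrite h1 // tensv0l tensv0l.
  + by rewrite h2 // tensv0r tensv0l.
  + by rewrite h3 // tensv0r.
move=> [[|[|[|//]]] ia] i; rewrite /triple /pick3 /= !tensmx_tensv !mul1mx.
+ by rewrite w1 !tensvZl.
+ by rewrite w2 tensvZr tensvZl.
+ by rewrite w3 tensvZr.
Qed.

Lemma triple_words : (forall x, rep_words p1 v1 x) -> (forall x, rep_words p2 v2 x) ->
  (forall x, rep_words p3 v3 x) ->
  forall x, in_words (unit_op triple) (tensv (tensv v1 v2) v3) x.
Proof.
move=> s1 s2 s3; set W := in_words _ _.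
have o0 : (0 < 3)%N by []. have o1 : (1 < 3)%N by []. have o2 : (2 < 3)%N by [].
have h1 x : W (tensv (tensv x v2) v3).
  apply: (in_words_ind (P := fun x => W (tensv (tensv x v2) v3))) (s1 x) => [||a y z hy hz|[i j] y hy].
  - exact: in_words_nil.
  - by rewrite !tensv0l; apply: in_words0.
  - by rewrite !tensv_linl; apply: in_wordsD.
  have := in_words_op (Ordinal o0, i, j) hy.
  by rewrite /unit_op /triple /pick3 /= !tensmx_tensv !mul1mx.
have h2 x y : W (tensv (tensv x y) v3).
  apply: (in_words_ind (P := fun y => W (tensv (tensv x y) v3))) (s2 y) => [||a y' z hy hz|[i j] y' hy].
  - exact: h1.
  - by rewrite tensv0r tensv0l; apply: in_words0.
  - by rewrite tensv_linr tensv_linl; apply: in_wordsD.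
  have := in_words_op (Ordinal o1, i, j) hy.
  by rewrite /unit_op /triple /pick3 /= !tensmx_tensv !mul1mx.
have h3 x y z : W (tensv (tensv x y) z).
  apply: (in_words_ind (P := fun z => W (tensv (tensv x y) z))) (s3 z) => [||a z' t hy hz|[i j] z' hz].
  - exact: h2.
  - by rewrite tensv0r; apply: in_words0.
  - by rewrite tensv_linr; apply: in_wordsD.
  have := in_words_op (Ordinal o2, i, j) hz.
  by rewrite /unit_op /triple /pick3 /= !tensmx_tensv !mul1mx.
move=> x; rewrite [x]tensv_span; elim/big_ind: _ => [|a b ha hb|k _]; first exact: in_words0.
  by rewrite -[a]scale1r; apply: in_wordsD.
rewrite -[_ *: _]addr0; apply: in_wordsD; last exact: in_words0.
suff -> : delta_mx (mxtens_unindex k).1 0 =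
    tensv (delta_mx (mxtens_unindex (mxtens_unindex k).1).1 0)
          (delta_mx (mxtens_unindex (mxtens_unindex k).1).2 0) :> 'cV[C]_(d1 * d2) by exact: h3.
rewrite [LHS]tensv_span (bigD1 (mxtens_unindex k).1) //= mxE !eqxx scale1r big1 ?addr0 // => l.
by move=> /negPf lk; rewrite mxE lk scale0r.
Qed.

End TensorTriple.

Lemma addr_shuffle (V : zmodType) (x y z a b c : V) :
  x + a + (y + b + (z - c)) = a + b - c + (x + y + z).
Proof. by rewrite [y + b + _]addrACA [LHS]addrACA [LHS]addrC !addrA. Qed.

(** * From Hermitian matrices to an intertwiner *)

Section HornIntertwiner.
Variables (C : numClosedFieldType) (n : nat).

Lemma eq_mulmx_cV m k (A B : 'M[C]_(m, k)) : (forall z : 'cV[C]_k, A *m z = B *m z) -> A = B.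
Proof.
by move=> h; apply/matrixP => i j; have /matrixP /(_ i 0) := h (delta_mx j 0); rewrite -!colE !mxE.
Qed.

Lemma unitary_diag_shift (U : 'M[C]_n) (lam : 'I_n -> int) (s : int) (c : nat) (kap : 'I_n -> nat) :
  U \is unitarymx -> (forall j, (kap j)%:Z = s * lam j + c%:Z) ->
  U^t* *m diag_mx (\row_j (kap j)%:R) *m U =
  s%:~R *: (U^t* *m diag_mx (\row_j (lam j)%:~R) *m U) + c%:R%:M.
Proof.
move=> uU e; have -> : \row_j (kap j)%:R = s%:~R *: \row_j (lam j)%:~R + const_mx c%:R :> 'rV[C]_n.
  apply/rowP => j; rewrite !mxE; have := congr1 (fun z : int => z%:~R : C) (e j).
  by rewrite /= intrD intrM.
rewrite linearD linearZ /= mulmxDr mulmxDl -scalemxAr -scalemxAl diag_const_mx.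
by rewrite mul_mx_scalar -scalemxAl adjmx_unitary // scalemx1.
Qed.

Definition highest_vector d (pi : 'M[C]_n -> 'M[C]_d) (lam : 'I_n -> int) (v : 'cV[C]_d) :=
  [/\ v != 0, forall i, pi (delta_mx i i) *m v = (lam i)%:~R *: v,
      forall i j : 'I_n, (i < j)%N -> pi (delta_mx i j) *m v = 0 & forall x, rep_words pi v x].

Lemma hw_family_morphism (I : finType) (kap : I -> 'I_n -> nat) (up : I -> bool) d d'
    (op : I -> 'M[C]_n -> 'M[C]_d) v (op' : I -> 'M[C]_n -> 'M[C]_d') v' :
  hw_family kap up op v -> hw_family kap up op' v' -> v != 0 ->
  (forall x, in_words (unit_op op) v x) ->
  exists T : 'M[C]_(d', d), T *m v = v' /\ forall g, T *m unit_op op g = unit_op op' g *m T.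
Proof.
move=> /hw_family_module hm /hw_family_module hm'.
exact: (hw_module_morphism (gl_triangular C kap up) hm hm').
Qed.

Variables (lam mu nu : 'I_n -> int).
Hypothesis lam_sorted : forall i j : 'I_n, (i <= j)%N -> lam j <= lam i.
Hypothesis mu_sorted : forall i j : 'I_n, (i <= j)%N -> mu j <= mu i.
Hypothesis nu_sorted : forall i j : 'I_n, (i <= j)%N -> nu j <= nu i.
Variables (H1 H2 H3 : 'M[C]_n).
Hypotheses (herm1 : H1 \is hermsymmx) (herm2 : H2 \is hermsymmx) (herm3 : H3 \is hermsymmx).
Hypothesis spec1 : char_poly H1 = \prod_i ('X - ((lam i)%:~R)%:P).
Hypothesis spec2 : char_poly H2 = \prod_i ('X - ((mu i)%:~R)%:P).
Hypothesis spec3 : char_poly H3 = \prod_i ('X - ((nu i)%:~R)%:P).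
Hypothesis H123 : H1 + H2 = H3.

Variables (d1 d2 d3 : nat) (p1 : 'M[C]_n -> 'M[C]_d1) (p2 : 'M[C]_n -> 'M[C]_d2).
Variable p3 : 'M[C]_n -> 'M[C]_d3.
Hypotheses (g1 : gl_rep p1) (g2 : gl_rep p2) (g3 : gl_rep p3).
Variables (v1 : 'cV[C]_d1) (v2 : 'cV[C]_d2) (v3 : 'cV[C]_d3).
Hypotheses (hv1 : highest_vector p1 lam v1) (hv2 : highest_vector p2 mu v2).
Hypothesis hv3 : highest_vector p3 nu v3.

(** A morphism [T] takes the shifted V_lam ⊗ V_mu ⊗ V_nu^* to the tensor model, highest weight
    vector to highest weight vector. Its image contains all words on that vector, in particular a
    [z] with [L *m z] nonzero, so [L *m T] is nonzero. *)
Lemma horn_functional : exists2 L : 'rV[C]_(d1 * d2 * d3), L != 0 &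
  forall i j, L *m ((p1 (delta_mx i j) *t 1%:M + 1%:M *t p2 (delta_mx i j)) *t 1%:M) =
    L *m (1%:M *t (p3 (delta_mx i j))^T).
Proof.
(* A shift large enough to make both [l] and [- l] nonnegative. *)
pose tot (l : 'I_n -> int) := (\sum_j `|l j|)%N.
have tot_ge (l : 'I_n -> int) j : `|l j| <= (tot l)%:Z.
  by rewrite lez_nat /tot (bigD1 j) //= leq_addr.
pose c1 := tot lam; pose c2 := tot mu; pose c3 := tot nu.
pose k1 j := absz (lam j + c1%:Z); pose k2 j := absz (mu j + c2%:Z).
pose k3 j := absz (- nu j + c3%:Z).
have kE1 j : (k1 j)%:Z = 1 * lam j + c1%:Z by have := tot_ge lam j; rewrite /k1 /c1; lia.
have kE2 j : (k2 j)%:Z = 1 * mu j + c2%:Z by have := tot_ge mu j; rewrite /k2 /c2; lia.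
have kE3 j : (k3 j)%:Z = -1 * nu j + c3%:Z by have := tot_ge nu j; rewrite /k3 /c3; lia.
have [U1 u1 e1] := hermitian_spectrum herm1 spec1.
have [U2 u2 e2] := hermitian_spectrum herm2 spec2.
have [U3 u3 e3] := hermitian_spectrum herm3 spec3.
pose U := pick3 U1 U2 U3; pose kap := pick3 k1 k2 k3; pose up := pick3 true true false.
pose r := (c1 + c2 + c3)%N.
have uU a : U a \is unitarymx by case: a => [[|[|[|//]]] ia].
have hsum : \sum_a (U a)^t* *m diag_mx (\row_j (kap a j)%:R) *m U a = r%:R%:M.
  rewrite !big_ord_recl big_ord0 /U /kap /pick3 /= addr0.
  rewrite (unitary_diag_shift u1 kE1) (unitary_diag_shift u2 kE2) (unitary_diag_shift u3 kE3).
  rewrite -e1 -e2 -e3 -H123 !scale1r scaleN1r !natrD !raddfD /=.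
  by apply/matrixP => i j; rewrite !mxE; ring.
have kap_up a i j : raises up a i j -> (kap a j <= kap a i)%N.
  case: a => [[|[|[|//]]] ia]; rewrite /raises /kap /up /pick3 /= => /ltnW ij.
  + by have := lam_sorted ij; rewrite -lez_nat !kE1; lia.
  + by have := mu_sorted ij; rewrite -lez_nat !kE2; lia.
  + by have := nu_sorted ij; rewrite -lez_nat !kE3; lia.
(* The third spectrum, [- nu] shifted, is increasing and has to be reversed. *)
pose s : 'I_3 -> 'S_n := pick3 1%g 1%g (perm (@rev_ord_inj n)).
have hs a (j k : 'I_n) : (j <= k)%N -> (kap a (s a k) <= kap a (s a j))%N.
  case: a => [[|[|[|//]]] ia]; rewrite /s /kap /pick3 /= => jk; rewrite ?perm1 ?permE.
  + by have := lam_sorted jk; rewrite -lez_nat !kE1; lia.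
  + by have := mu_sorted jk; rewrite -lez_nat !kE2; lia.
  have kj : (rev_ord k <= rev_ord j)%N by rewrite /= leq_sub2l.
  by have := nu_sorted kj; rewrite -lez_nat !kE3; lia.
have [A [m [uA full]]] := hermitian_sum_unitary_full_rank uU hs hsum.
have [d [op [v [L [hwN inv [z zw zL]]]]]] :=
  tensor_highest_weight_model kap_up (hermitian_sum_trace uU hsum) uA full.
have [w1 t1 r1 s1] := hv1; have [w2 t2 r2 s2] := hv2; have [w3 t3 r3 s3] := hv3.
pose q1 := shift_rep p1 c1; pose q2 := shift_rep p2 c2; pose q3 := shift_rep (dual_rep p3) c3.
have gd3 := gl_rep_dual g3.
have hq1 : hw_vector k1 true q1 v1.
  by apply: hw_vector_shift t1 _ => // i; rewrite kE1 mul1r.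
have hq2 : hw_vector k2 true q2 v2.
  by apply: hw_vector_shift t2 _ => // i; rewrite kE2 mul1r.
have [dr3 dt3] := hw_vector_dual g3 r3 t3.
have hq3 : hw_vector k3 false q3 (map_mx Num.conj v3).
  by apply: (hw_vector_shift (lam := fun i => - nu i)) => // i; rewrite kE3 mulN1r.
have hw := triple_hw (gl_rep_shift c1 g1) (gl_rep_shift c2 g2) (gl_rep_shift c3 gd3) hq1 hq2 hq3.
have span := triple_words (fun x => rep_words_shift c1 (s1 x)) (fun x => rep_words_shift c2 (s2 x))
  (fun x => rep_words_shift c3 (rep_words_dual g3 s3 x)).
have vt0 : tensv (tensv v1 v2) (map_mx Num.conj v3) != 0.
  rewrite !tensv_eq0 //; apply: contra w3 => /eqP e.
  by apply/eqP/matrixP => i j; have /matrixP /(_ i j) := e; rewrite !mxE => /eqP; rewrite conjC_eq0 => /eqP.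
have [T [Tv Top]] := hw_family_morphism hw hwN vt0 span.
exists (L *m T).
  apply: contra zL => /eqP LT; apply/eqP.
  have [x ->] : exists x, z = T *m x.
    apply: (in_words_ind (P := fun z => exists x, z = T *m x)) zw => [||a y y' [x ->] [x' ->]|g y [x ->]].
    - by eexists; rewrite -Tv.
    - by exists 0; rewrite mulmx0.
    - by exists (a *: x + x'); rewrite mulmxDr scalemxAr.
    by exists (unit_op (triple q1 q2 q3) g *m x); rewrite !mulmxA Top.
  by rewrite mulmxA LT mul0mx.
move=> i j.
have inv' X : L *m (\sum_a op a X) = (r%:R * \tr X) *: L.
  by apply: eq_mulmx_cV => y; rewrite -mulmxA inv scalemxAl.
pose t := \tr (delta_mx i j : 'M[C]_n).
have key : L *m T *m (\sum_a triple q1 q2 q3 a (delta_mx i j)) = (r%:R * t) *: (L *m T).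
  rewrite -mulmxA mulmx_sumr.
  rewrite (eq_bigr (fun a => op a (delta_mx i j) *m T)) => [|a _]; last exact: (Top (a, i, j)).
  by rewrite -mulmx_suml mulmxA inv' scalemxAl.
pose M1 := (p1 (delta_mx i j) *t (1%:M : 'M[C]_d2)) *t (1%:M : 'M[C]_d3).
pose M2 := ((1%:M : 'M[C]_d1) *t p2 (delta_mx i j)) *t (1%:M : 'M[C]_d3).
pose M3 := (1%:M : 'M[C]_(d1 * d2)) *t (p3 (delta_mx i j))^T.
(* The three shifts contribute r tr X, exactly the character under which [L] is semi-invariant, so
   the two cancel. *)
have tE : \sum_a triple q1 q2 q3 a (delta_mx i j) = (M1 + M2 - M3) + (r%:R * t) *: 1%:M.
  rewrite !big_ord_recl big_ord0 /triple /pick3 /= addr0 /q1 /q2 /q3 /shift_rep /dual_rep -/t.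
  rewrite [p1 _ + _]addrC [p2 _ + _]addrC [- _ + _]addrC.
  rewrite !(tensmx_linl, tensmx_linr) !tensmx11 -/M1 -/M2.
  have -> : 1%:M *t (- (p3 (delta_mx i j))^T) = - M3.
    by apply/matrixP => x y; rewrite !mxE mulrN.
  rewrite /r !natrD !mulrDl !scalerDl; exact: addr_shuffle.
have -> : (p1 (delta_mx i j) *t 1%:M + 1%:M *t p2 (delta_mx i j)) *t 1%:M = M1 + M2.
  by rewrite -[p1 _ *t _]scale1r tensmx_linl scale1r.
rewrite -/M3; apply/eqP; rewrite -subr_eq0 -mulmxBr.
move: key; rewrite tE mulmxDr -scalemxAr mulmx1 => /eqP.
by rewrite -subr_eq0 addrK.
Qed.

(** The functional on (V_lam ⊗ V_mu) ⊗ V_nu^* is reshaped into an equivariant matrix [M] from V_lam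
    ⊗ V_mu to V_nu. Its adjoint goes the other way, and is equivariant because the representations
    respect adjoints. *)
Theorem horn_intertwiner : exists2 S : 'M[C]_(d1 * d2, d3), S != 0 &
  forall i j, S *m p3 (delta_mx i j) =
    (p1 (delta_mx i j) *t 1%:M + 1%:M *t p2 (delta_mx i j)) *m S.
Proof.
have [L L0 hL] := horn_functional.
pose M : 'M[C]_(d3, d1 * d2) := \matrix_(k, i) L 0 (mxtens_index (i, k)).
have ML (X : 'M[C]_(d1 * d2)) (Y : 'M[C]_d3) : L *m (X *t 1%:M) = L *m (1%:M *t Y^T) ->
    M *m X = Y *m M.
  move=> /rowP e; apply/matrixP => k i; have := e (mxtens_index (i, k)).
  have sumE (F : 'I_(d1 * d2 * d3) -> C) : \sum_l F l = \sum_a \sum_b F (mxtens_index (a, b)).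
    rewrite pair_bigA /= (reindex (@mxtens_index _ _)) /=; first by apply: eq_bigr => -[].
    by exists (@mxtens_unindex _ _) => x _; rewrite ?mxtens_indexK ?mxtens_unindexK.
  rewrite !mxE !sumE.
  under eq_bigr => a _.
    rewrite (bigD1 k) //= big1 ?addr0; last first.
      by move=> b /negPf bk; rewrite tensmxE [1%:M _ _]mxE bk mulr0 mulr0.
    rewrite tensmxE [1%:M _ _]mxE eqxx mulr1.
    over.
  move=> /= e1; transitivity (\sum_a L 0 (mxtens_index (a, k)) * X a i).
    by apply: eq_bigr => a _; rewrite mxE.
  rewrite e1 (bigD1 i) //= [X in _ + X]big1 ?addr0; last first.
    by move=> a /negPf ai; apply: big1 => b _; rewrite tensmxE [1%:M _ _]mxE ai mul0r mulr0.
  by apply: eq_bigr => b _; rewrite tensmxE [1%:M _ _]mxE eqxx mul1r !mxE mulrC.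
exists (M^t*).
  apply: contra L0 => /eqP M0; apply/eqP/rowP => l; rewrite -[l]mxtens_unindexK.
  case: (mxtens_unindex l) => a b; have /matrixP /(_ a b) := M0.
  by rewrite !mxE => /eqP; rewrite conjC_eq0 => /eqP.
move=> i j; have := ML _ _ (hL j i) => /(congr1 (fun X => X^t*)).
have [_ _ a1] := g1; have [_ _ a2] := g2; have [_ _ a3] := g3.
have dE : (delta_mx j i : 'M[C]_n)^t* = delta_mx i j.
  by apply/matrixP => a b; rewrite !mxE conjC_nat andbC.
by rewrite !adjmxM linearD /= map_mxD !adj_tensmx a1 a2 a3 !dE !adjmx1 => ->.
Qed.

End HornIntertwiner.

(** * Critical points of matrix coefficients *)

Section Critical.
Variable C : numClosedFieldType.
Local Notation ii := ('i : C).

Lemma diff_rep_of_intertwine n d e (rho : 'M[C]_n -> 'M[C]_d) (rho' : 'M[C]_n -> 'M[C]_e)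
    (h : circle_diagonal rho) (h' : circle_diagonal rho') (T : 'M[C]_(e, d)) :
  (forall g, g \is unitarymx -> T *m rho g = rho' g *m T) ->
  forall X, T *m diff_rep h X = diff_rep h' X *m T.
Proof.
move=> hT X; have main u : unit_cV u -> T *m diff_rep h (u *m u^t*) = diff_rep h' (u *m u^t*) *m T.
  move=> u1; have [P [kap uP [-> hP]]] := diff_rep_unit h u1.
  have [Q [kap' uQ [-> hQ]]] := diff_rep_unit h' u1.
  have r1 : (1 : C) \is Num.real by exact: rpred1.
  have f1 := first_order_mul (first_order_const T) (first_order_circle_pow kap uP r1).
  have f2 := first_order_mul (first_order_circle_pow kap' uQ r1) (first_order_const T).
  have := first_order_uniq f1 (first_order_ext _ f2).
  rewrite mulmx0 add0r mul0mx addr0 mulr1 -scalemxAl -scalemxAr => e1.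
  have /e1 /(scalerI (neq0Ci _)) // : forall s : C, s \is Num.real ->
      circle_pow Q kap' (cayley (1 * s)) *m T = T *m circle_pow P kap (cayley (1 * s)).
  move=> s sr; have t1 : `|cayley (1 * s)| = 1 by rewrite norm_cayley // mul1r.
  by rewrite -hP // -hQ // hT // unitary_circle_of.
have [s [us eX _]] := diff_repP h X; rewrite eX big_seq.
elim/big_rec: _ => [|p Y /us up IH]; first by rewrite !linear0 mul0mx.
by rewrite !linearD !linearZ /= mulmxDl IH -scalemxAl main.
Qed.

(** Fermat's rule: applying the bound to [s] and to [- s] leaves a linear term of quadratic size. *)
Lemma first_order_max (B : C -> 'M[C]_1) (B0 B1 : 'M[C]_1) : first_order B B0 B1 ->
  B1 0 0 \is Num.real -> (forall s, s \is Num.real -> B s 0 0 <= B0 0 0) -> B1 0 0 = 0.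
Proof.
move=> [c c0 h] br hB; set b := B1 0 0 in br *.
have key s : s \is Num.real -> `|s| <= 1 -> s * b <= c * `|s| ^+ 2.
  move=> sr s1; have := le_trans (l1norm_ge _ 0 0) (h s sr s1).
  have -> : (B s - B0 - s *: B1) 0 0 = B s 0 0 - B0 0 0 - s * b by rewrite !mxE.
  set r := (X in `|X|) => hs.
  have -> : s * b = (B s 0 0 - B0 0 0) - r by rewrite /r; ring.
  have d0 : B s 0 0 - B0 0 0 <= 0 by rewrite subr_le0 hB.
  have rr : - r \is Num.real by rewrite rpredN rpredB ?(ler0_real d0) // rpredM.
  apply: le_trans hs; rewrite -[`|r|]add0r lerD // -normrN.
  exact: real_ler_norm.
have f1 : first_order (fun=> 0 : 'M[C]_1) 0 B1.
  exists c => // s sr s1; rewrite subrr sub0r l1normN l1normZ /l1norm !big_ord1.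
  rewrite -normrM real_ler_norml ?rpredM // key // andbT lerNl -mulNr -normrN.
  by apply: key; rewrite ?rpredN ?normrN.
by rewrite /b (first_order_uniq f1 (first_order_const 0)) mxE.
Qed.

(* The modulus of g |-> Z (rho g) x is critical at 1 along each circle subgroup. *)
Lemma maximal_modulus_real n d (rho : 'M[C]_n -> 'M[C]_d) (h : circle_diagonal rho)
    (Z : 'rV[C]_d) (x : 'cV[C]_d) :
  (forall g, g \is unitarymx -> `|(Z *m rho g *m x) 0 0| <= `|(Z *m x) 0 0|) ->
  (Z *m x) 0 0 != 0 -> forall u, unit_cV u ->
  (Z *m diff_rep h (u *m u^t*) *m x) 0 0 / (Z *m x) 0 0 \is Num.real.
Proof.
move=> hmax nz u u1; have [P [kap uP [-> hP]]] := diff_rep_unit h u1.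
have r1 : (1 : C) \is Num.real by exact: rpred1.
have f1 := first_order_mul (first_order_mul (first_order_const Z) (first_order_circle_pow kap uP r1))
  (first_order_const x).
have f2 := first_order_mul f1 (first_order_adj f1).
move: f2; rewrite !(mulmx0, mulmx1, mul0mx, addr0, add0r) mulr1.
set a := (Z *m x) 0 0 in nz *; set D := circle_gen P kap.
have [w ew] : exists w, w = (Z *m D *m x) 0 0 / a by eexists.
rewrite -ew.
have scal (A : 'M[C]_1) : A = (A 0 0)%:M by rewrite -mx11_scalar.
have eZx : Z *m x = a%:M by apply: scal.
have eZD : Z *m (ii *: D) *m x = (ii * w * a)%:M.
  by rewrite -scalemxAr -scalemxAl [X in ii *: X]scal -mulrA scale_scalar_mx ew divfK //.
rewrite eZx eZD => /first_order_max.
rewrite !tr_scalar_mx !map_scalar_mx -!scalar_mxM -raddfD /= !mxE eqxx !mulr1n !rmorphM /= conjCi.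
(* The derivative of the squared modulus; its vanishing says that [w] is real. *)
have -> : a * (- ii * w^* * a^*) + ii * w * a * a^* = `|a| ^+ 2 * (ii * (w - w^*)).
  by rewrite normCK; ring.
move=> e; apply/CrealP/eqP; rewrite -subr_eq0 -oppr_eq0 opprB.
have /eqP : `|a| ^+ 2 * (ii * (w - w^*)) = 0.
  apply: e => [|s sr].
    rewrite rpredM ?rpredX ?normr_real //; apply/CrealP.
    by rewrite rmorphM /= conjCi rmorphB /= conjCK mulNr -mulrN opprB.
  have t1 : `|cayley (1 * s)| = 1 by rewrite norm_cayley // mul1r.
  have := hmax _ (unitary_circle_of u1 t1); rewrite -hP //.
  move: (Z *m _ *m x) => Y; rewrite [Y]scal; move: (Y 0 0) => y; rewrite -/a.
  rewrite tr_scalar_mx map_scalar_mx -scalar_mxM !mxE eqxx !mulr1n => hy.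
  by rewrite /= -!normCK ler_pXn2r ?nnegrE ?normr_ge0.
by rewrite mulf_eq0 expf_eq0 normr_eq0 (negPf nz) /= mulf_eq0 (negPf (neq0Ci _)).
Qed.

(** Being Hermitian, [phi] vanishes below the diagonal as well as above it, so only the diagonal
    values remain. *)
Lemma triangular_functional n (phi : 'M[C]_n -> C) (lam : 'I_n -> int) :
  (forall a X Y, phi (a *: X + Y) = a * phi X + phi Y) ->
  (forall X, phi (X^t*) = (phi X)^*) ->
  (forall i j : 'I_n, (i < j)%N -> phi (delta_mx i j) = 0) ->
  (forall i, phi (delta_mx i i) = (lam i)%:~R) ->
  forall X, phi X = \tr (diag_mx (\row_j (lam j)%:~R) *m X).
Proof.
move=> lin herm tri dia X.
have phi0 : phi 0 = 0 by have := lin (-1) 0 0; rewrite scaler0 addr0 mulN1r addNr.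
have dE i j : phi (delta_mx i j) = (lam i)%:~R *+ (i == j).
  have [<-|ij] := eqVneq i j; first exact: dia.
  case: (ltngtP i j) => [/tri->|ji|/val_inj e]; rewrite ?mulr0n //; last by rewrite e eqxx in ij.
  have -> : delta_mx i j = (delta_mx j i : 'M[C]_n)^t*.
    by apply/matrixP => a b; rewrite !mxE conjC_nat andbC.
  by rewrite herm tri // conjC0.
have phiS (J : finType) (F : J -> 'M[C]_n) : phi (\sum_k F k) = \sum_k phi (F k).
  elim/big_rec2: _ => // k y Y _ <-; by rewrite -[F k]scale1r lin mul1r scale1r.
have phiZ a Y : phi (a *: Y) = a * phi Y by rewrite -[a *: Y]addr0 lin phi0 addr0.
rewrite {1}[X]matrix_sum_delta phiS; apply: eq_bigr => i _.
rewrite phiS mul_diag_mx !mxE (bigD1 i) //= phiZ dE eqxx big1 ?addr0 1?mulrC // => j ji.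
by rewrite phiZ dE eq_sym (negPf ji) mulr0.
Qed.

Lemma mxtrace_inj n (A B : 'M[C]_n) : (forall X, \tr (A *m X) = \tr (B *m X)) -> A = B.
Proof.
move=> h; apply/matrixP => i j; have := h (delta_mx j i).
have e (D : 'M[C]_n) : \tr (D *m delta_mx j i) = D i j.
  rewrite /mxtrace (bigD1 i) //= mxE (bigD1 j) //= mxE !eqxx mulr1.
  rewrite !big1 ?addr0 // => k ki; last by rewrite mxE (negPf ki) mulr0.
  by rewrite mxE big1 // => l _; rewrite mxE (negPf ki) andbF mulr0.
by rewrite !e.
Qed.

End Critical.

(** * Metric facts on U(n), and the trivial representation *)

Section UnitaryMetric.
Variable C : numClosedFieldType.

Lemma l1norm_adj m n (A : 'M[C]_(m, n)) : l1norm (A^t*) = l1norm A.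
Proof.
rewrite /l1norm exchange_big; apply: eq_bigr => i _; apply: eq_bigr => j _.
by rewrite !mxE norm_conjC.
Qed.

Lemma l1norm_lsubmx m n1 n2 (A : 'M[C]_(m, n1 + n2)) : l1norm (lsubmx A) <= l1norm A.
Proof.
apply: ler_sum => i _; rewrite big_split_ord /=.
under eq_bigr do rewrite mxE.
by rewrite lerDl sumr_ge0.
Qed.

Lemma l1norm_rsubmx m n1 n2 (A : 'M[C]_(m, n1 + n2)) : l1norm (rsubmx A) <= l1norm A.
Proof.
apply: ler_sum => i _; rewrite big_split_ord /=.
under eq_bigr do rewrite mxE.
by rewrite lerDr sumr_ge0.
Qed.

Lemma unitarymx_closed n (X : 'M[C]_n) :
  (forall e, 0 < e -> exists2 Y : 'M[C]_n, Y \is unitarymx & l1norm (X - Y) <= e) ->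
  X \is unitarymx.
Proof.
move=> hX; apply/unitarymxP/eqP; rewrite -subr_eq0; apply/eqP/l1norm_eq0.
set M := l1norm _; have M0 : 0 <= M by apply: l1norm_ge0.
pose k := l1norm (X^t*) + (n * n)%:R + 1.
have k0 : 0 < k by rewrite ltr_wpDl ?addr_ge0 ?l1norm_ge0 ?ler0n.
have [->//|Mn] := eqVneq M 0.
have {}M0 : 0 < M by rewrite lt_def Mn.
have [Y uY hY] := hX _ (divr_gt0 M0 (mulr_gt0 (ltr0Sn C 1) k0)).
have : M <= M / (2 * k) * k.
  have eM : M = l1norm ((X - Y) *m X^t* + Y *m (X - Y)^t*).
    rewrite /M; congr l1norm.
    by rewrite adjmxB mulmxBl mulmxBr (unitarymxP uY) subrKA.
  rewrite {1}eM; apply: le_trans (ler_l1normD _ _) _.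
  have h1 := le_trans (ler_l1normM (X - Y) (X^t*)) (ler_wpM2r (l1norm_ge0 _) hY).
  have h2 : l1norm (Y *m (X - Y)^t*) <= M / (2 * k) * (n * n)%:R.
    apply: le_trans (l1norm_unitarymxl _ uY) _.
    by rewrite l1norm_adj mulrC ler_wpM2r ?ler0n.
  apply: le_trans (lerD h1 h2) _; rewrite -mulrDr ler_wpM2l //; last by rewrite lerDl.
  by rewrite divr_ge0 ?mulr_ge0 ?ltW.
have -> : M / (2 * k) * k = M / 2 by field; rewrite gt_eqF.
by rewrite ler_pdivlMr ?ltr0Sn // mulr_natr mulr2n gerDl => /(lt_le_trans M0); rewrite ltxx.
Qed.

Lemma rho_dist n d (rho : 'M[C]_n -> 'M[C]_d) : circle_diagonal rho ->
  exists2 c : C, 0 <= c & forall g h, g \is unitarymx -> h \is unitarymx ->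
    l1norm (rho g - rho h) <= c * l1norm (g - h).
Proof.
move=> hr; have [c c0 hc] := rho_lipschitz hr.
exists ((d * d)%:R * (c * (n * n)%:R)) => [|g h ug uh]; first by rewrite !mulr_ge0 ?ler0n.
have [ru _ rM _] := hr; have uh' : h^t* \is unitarymx by rewrite trmxC_unitary.
have -> : rho g - rho h = rho h *m (rho (h^t* *m g) - 1%:M).
  rewrite mulmxBr mulmx1 -rM //; last by rewrite mul_unitarymx.
  by rewrite mulmxA (unitarymxP uh) mul1mx.
apply: le_trans (l1norm_unitarymxl _ (ru _ uh)) _.
rewrite -!mulrA ler_wpM2l ?ler0n //; apply: le_trans (hc _ _) _; first by rewrite mul_unitarymx.
rewrite ler_wpM2l //; have -> : h^t* *m g - 1%:M = h^t* *m (g - h).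
  by rewrite mulmxBr adjmx_unitary.
exact: l1norm_unitarymxl.
Qed.

(** Lets the action on a single tensor factor be treated as a tensor product with a trivial
    representation. *)
Lemma trivial_circle_diagonal n d : circle_diagonal (fun _ : 'M[C]_n => 1%:M : 'M[C]_d).
Proof.
split=> // [g _|g h _ _|u _]; rewrite ?mulmx1 ?unitary1 //.
exists 1%:M, (fun=> 0); first exact: unitary1.
move=> t _; rewrite /circle_pow adjmx1 mul1mx mulmx1.
by apply/matrixP => i j; rewrite !mxE.
Qed.

Lemma diff_rep_trivial n d (h : circle_diagonal (fun _ : 'M[C]_n => 1%:M : 'M[C]_d)) X :
  diff_rep h X = 0.
Proof.
have [s [us eX _]] := diff_repP h X; rewrite eX big_seq linear_sum big1 //= => p /us up.
rewrite linearZ /=; have [P [kap uP [-> hP]]] := diff_rep_unit h up.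
rewrite (@circle_gen_uniq _ _ P 1%:M kap (fun=> 0)) ?unitary1 // => [|t t1].
  rewrite /circle_gen adjmx1 mul1mx mulmx1 [X in diag_mx X](_ : _ = 0) ?linear0 ?scaler0 //.
  by apply/rowP => a; rewrite !mxE.
rewrite -hP // /circle_pow adjmx1 mul1mx mulmx1.
by apply/matrixP => i j; rewrite !mxE.
Qed.

Lemma hermitian_functional n d (rho : 'M[C]_n -> 'M[C]_d) (h : circle_diagonal rho)
    (psi : 'M[C]_n -> C) :
  (forall a X Y, psi (a *: X + Y) = a * psi X + psi Y) ->
  (forall u, unit_cV u -> psi (u *m u^t*) \is Num.real) ->
  forall X, psi (X^t*) = (psi X)^*.
Proof.
move=> lin re X; have [s [us -> _]] := diff_repP h X; rewrite big_seq.
have psi0 : psi 0 = 0 by have := lin (-1) 0 0; rewrite scaler0 addr0 mulN1r addNr.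
elim/big_rec: _ => [|p Y /us up IH]; first by rewrite trmx0 map_mx0 psi0 conjC0.
rewrite linearD /= map_mxD adjmxZ adjmxM trmxCK !lin IH rmorphD rmorphM /=.
by rewrite (CrealP (re _ up)).
Qed.

End UnitaryMetric.

(** * The matrix equation at a critical point *)

Section CriticalSum.
Variables (C : numClosedFieldType) (n d1 d2 : nat).
Variables (rho1 : 'M[C]_n -> 'M[C]_d1) (rho2 : 'M[C]_n -> 'M[C]_d2).
Hypotheses (h1 : circle_diagonal rho1) (h2 : circle_diagonal rho2).
Hypothesis h12 : circle_diagonal (fun g => rho1 g *t rho2 g).
Variables (lam mu nu : 'I_n -> int) (v1 : 'cV[C]_d1) (v2 : 'cV[C]_d2) (z : 'cV[C]_(d1 * d2)).
Hypothesis wv1 : forall i, diff_rep h1 (delta_mx i i) *m v1 = (lam i)%:~R *: v1.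
Hypothesis rv1 : forall i j : 'I_n, (i < j)%N -> diff_rep h1 (delta_mx i j) *m v1 = 0.
Hypothesis wv2 : forall i, diff_rep h2 (delta_mx i i) *m v2 = (mu i)%:~R *: v2.
Hypothesis rv2 : forall i j : 'I_n, (i < j)%N -> diff_rep h2 (delta_mx i j) *m v2 = 0.
Hypothesis wz : forall i, diff_rep h12 (delta_mx i i) *m z = (nu i)%:~R *: z.
Hypothesis rz : forall i j : 'I_n, (i < j)%N -> diff_rep h12 (delta_mx i j) *m z = 0.
Variables g1 g2 : 'M[C]_n.
Hypotheses (u1 : g1 \is unitarymx) (u2 : g2 \is unitarymx).
Let x := tensv (rho1 g1 *m v1) (rho2 g2 *m v2).
Hypothesis max1 : forall g, g \is unitarymx ->
  `|(z^t* *m (rho1 g *t 1%:M) *m x) 0 0| <= `|(z^t* *m x) 0 0|.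
Hypothesis max2 : forall g, g \is unitarymx ->
  `|(z^t* *m (1%:M *t rho2 g) *m x) 0 0| <= `|(z^t* *m x) 0 0|.
Hypothesis nz : (z^t* *m x) 0 0 != 0.

(** Normalized matrix coefficient. Restricted to each tensor factor it is a Hermitian functional on
    gl_n, by maximality along that factor. *)
Let phi (A : 'M[C]_(d1 * d2)) : C := (z^t* *m A *m x) 0 0 / (z^t* *m x) 0 0.

Let phi_lin a A B : phi (a *: A + B) = a * phi A + phi B.
Proof. by rewrite /phi mulmxDr mulmxDl -scalemxAr -scalemxAl !mxE mulrDl mulrA. Qed.

Let phi1 X := phi (diff_rep h1 X *t 1%:M).
Let phi2 X := phi (1%:M *t diff_rep h2 X).

Let phi1_lin a X Y : phi1 (a *: X + Y) = a * phi1 X + phi1 Y.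
Proof. by rewrite /phi1 linearP tensmx_linl phi_lin. Qed.

Let phi2_lin a X Y : phi2 (a *: X + Y) = a * phi2 X + phi2 Y.
Proof. by rewrite /phi2 linearP tensmx_linr phi_lin. Qed.

Let phi1_herm X : phi1 (X^t*) = (phi1 X)^*.
Proof.
apply: (hermitian_functional h1) => [a A B|u uu]; first exact: phi1_lin.
pose ht := trivial_circle_diagonal C n d2; pose hr := tensor_circle_diagonal h1 ht.
have := @maximal_modulus_real _ _ _ _ hr _ _ max1 nz _ uu.
rewrite diff_rep_tensor diff_rep_trivial.
have -> : (1%:M : 'M[C]_d1) *t (0 : 'M[C]_d2) = 0 by apply: tensmx0.
by rewrite addr0.
Qed.

Let phi2_herm X : phi2 (X^t*) = (phi2 X)^*.
Proof.
apply: (hermitian_functional h2) => [a A B|u uu]; first exact: phi2_lin.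
pose ht := trivial_circle_diagonal C n d1; pose hr := tensor_circle_diagonal ht h2.
have := @maximal_modulus_real _ _ _ _ hr _ _ max2 nz _ uu.
rewrite diff_rep_tensor diff_rep_trivial.
have -> : (0 : 'M[C]_d1) *t (1%:M : 'M[C]_d2) = 0 by apply: tens0mx.
by rewrite add0r.
Qed.

Let phi_eigen A c : A *m x = c *: x -> phi A = c.
Proof. by rewrite /phi -mulmxA => ->; rewrite -scalemxAr mxE mulfK. Qed.

Let conj_adj (g X : 'M[C]_n) : (g *m X *m g^t*)^t* = g *m X^t* *m g^t*.
Proof. by rewrite !adjmxM trmxCK mulmxA. Qed.

Let conjK (g X : 'M[C]_n) : g \is unitarymx -> g *m (g^t* *m X *m g) *m g^t* = X.
Proof. by move=> ug; rewrite !mulmxA (unitarymxP ug) mul1mx -mulmxA (unitarymxP ug) mulmx1. Qed.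

(** Conjugated by [g1], raising operators kill the first factor of [x] and diagonal ones have
    eigenvalues [lam], so [triangular_functional] applies. *)
Let phi1E X : phi1 X = \tr (g1 *m diag_mx (\row_j (lam j)%:~R) *m g1^t* *m X).
Proof.
have [ru1 _ _ _] := h1; have gu := adjmx_unitary (ru1 _ u1).
have act i j : (diff_rep h1 (g1 *m delta_mx i j *m g1^t*) *t 1%:M) *m x =
    tensv (rho1 g1 *m (diff_rep h1 (delta_mx i j) *m v1)) (rho2 g2 *m v2).
  by rewrite tensmx_tensv mul1mx diff_rep_conj // -!mulmxA (mulmxA _ (rho1 g1)) gu mul1mx.
rewrite -{1}(conjK X u1) (triangular_functional (phi := fun X => phi1 (g1 *m X *m g1^t*)) (lam := lam)).
- by rewrite mxtrace_mulC -!mulmxA mxtrace_mulC !mulmxA -!mulmxA mxtrace_mulC !mulmxA.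
- by move=> a A B; rewrite mulmxDr mulmxDl -scalemxAr -scalemxAl phi1_lin.
- by move=> A; rewrite -conj_adj phi1_herm.
- move=> i j ij; apply: phi_eigen; rewrite act rv1 // mulmx0 tensv0l scale0r //.
by move=> i; apply: phi_eigen; rewrite act wv1 -scalemxAr tensvZl.
Qed.

Let phi2E X : phi2 X = \tr (g2 *m diag_mx (\row_j (mu j)%:~R) *m g2^t* *m X).
Proof.
have [ru2 _ _ _] := h2; have gu := adjmx_unitary (ru2 _ u2).
have act i j : (1%:M *t diff_rep h2 (g2 *m delta_mx i j *m g2^t*)) *m x =
    tensv (rho1 g1 *m v1) (rho2 g2 *m (diff_rep h2 (delta_mx i j) *m v2)).
  by rewrite tensmx_tensv mul1mx diff_rep_conj // -!mulmxA (mulmxA _ (rho2 g2)) gu mul1mx.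
rewrite -{1}(conjK X u2) (triangular_functional (phi := fun X => phi2 (g2 *m X *m g2^t*)) (lam := mu)).
- by rewrite mxtrace_mulC -!mulmxA mxtrace_mulC !mulmxA -!mulmxA mxtrace_mulC !mulmxA.
- by move=> a A B; rewrite mulmxDr mulmxDl -scalemxAr -scalemxAl phi2_lin.
- by move=> A; rewrite -conj_adj phi2_herm.
- move=> i j ij; apply: phi_eigen; rewrite act rv2 // mulmx0 tensv0r scale0r //.
by move=> i; apply: phi_eigen; rewrite act wv2 -scalemxAr tensvZr.
Qed.

(** The two functionals add up to [phi] composed with the derivative of the tensor product, which by
    adjunction acts on the highest weight vector [z]. So the sum is also the trace functional of
    diag(nu). *)
Theorem critical_sum :
  g1 *m diag_mx (\row_j (lam j)%:~R) *m g1^t* + g2 *m diag_mx (\row_j (mu j)%:~R) *m g2^t* =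
  diag_mx (\row_j (nu j)%:~R).
Proof.
apply: mxtrace_inj => X; rewrite mulmxDl linearD /= -phi1E -phi2E.
have herm Y : phi1 (Y^t*) + phi2 (Y^t*) = (phi1 Y + phi2 Y)^*.
  by rewrite phi1_herm phi2_herm rmorphD.
have sumE Y : phi1 Y + phi2 Y = phi (diff_rep h12 Y).
  by rewrite diff_rep_tensor -[diff_rep h1 Y *t _]scale1r phi_lin mul1r.
have adjE i j : phi (diff_rep h12 (delta_mx i j)) =
    ((diff_rep h12 (delta_mx j i) *m z)^t* *m x) 0 0 / (z^t* *m x) 0 0.
  rewrite /phi adjmxM -diff_rep_adj; congr ((_ *m diff_rep h12 _ *m _) 0 0 / _).
  by apply/matrixP => a b; rewrite !mxE conjC_nat andbC.
apply: (triangular_functional (phi := fun Y => phi1 Y + phi2 Y)) => [a A B|A|i j ij|i].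
- by rewrite phi1_lin phi2_lin mulrDr addrACA.
- exact: herm.
- have -> : delta_mx i j = (delta_mx j i : 'M[C]_n)^t*.
    by apply/matrixP => a b; rewrite !mxE conjC_nat andbC.
  by rewrite herm sumE adjE rz // trmx0 map_mx0 mul0mx mxE mul0r conjC0.
rewrite sumE adjE wz adjmxZ -scalemxAl mxE mulfK //.
by rewrite rmorph_int.
Qed.

End CriticalSum.

From mathcomp Require Import complex all_classical all_reals all_analysis.
Import numFieldNormedType.Exports.
Import Order.TTheory GRing.Theory Num.Theory.
Local Close Scope sesquilinear_scope.
Local Open Scope ring_scope.

Lemma unitarymx1 (C : numClosedFieldType) n : (1%:M : 'M[C]_n) \is unitarymx.
Proof. by apply/unitarymxP; rewrite trmx1 map_mx1 mulmx1. Qed.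

Lemma unitary_rep_continuous1 (C : numClosedFieldType) n d (rho : 'M[C]_n -> 'M[C]_d) :
  unitary_rep rho -> forall e : C, 0 < e -> exists2 del : C, 0 < del &
  (forall g : 'M[C]_n, g \is unitarymx -> (forall i j, `|(g - 1%:M) i j| < del) ->
    forall i j, `|(rho g - 1%:M) i j| < e).
Proof.
move=> [_ rho1 _ /subspace_continuousP cont] e e0.
have /cvg_ballP /(_ e e0) := cont 1%:M (unitarymx1 _ _).
rewrite nearE /within /= => /nbhs_ballP[del /= del0 hdel].
exists del => // g ug hg i j.
have hb : ball (1%:M : 'M[C]_n) del g.
  by split=> // a b; have := hg a b; rewrite !mxE distrC.
have [_ /(_ i j)] := hdel g hb ug.
by rewrite /from_subspace rho1 /ball /= !mxE distrC.
Qed.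

Local Open Scope complex_scope.

(** * Continuous characters of the circle *)

Section CircleCharacter.
Variable R : realType.
Implicit Types x y : R.

Definition expi x : R[i] := cos x +i* sin x.

Lemma expiD x y : expi (x + y) = expi x * expi y.
Proof. by apply/eqP; rewrite eq_complex /= cosD sinD addrC eqxx [X in _ == X]addrC (mulrC (cos x)) (mulrC (sin x)) eqxx. Qed.

Lemma expi0 : expi 0 = 1.
Proof. by rewrite /expi cos0 sin0. Qed.

Lemma expi2pi : expi (pi *+ 2) = 1.
Proof. by rewrite /expi cos2pi sin2pi. Qed.

Lemma expiX x k : expi x ^+ k = expi (x *+ k).
Proof. by elim: k => [|k IH]; rewrite ?mulr0n ?expi0 // exprS mulrS expiD IH. Qed.

Lemma norm_expi x : `|expi x| = 1.
Proof. by rewrite normc_def /= cos2Dsin2 sqrtr1. Qed.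

Lemma expi_neq0 x : expi x != 0.
Proof. by rewrite -normr_eq0 norm_expi oner_eq0. Qed.

Lemma expiN x : expi (- x) = (expi x)^-1.
Proof. by apply: (mulIf (expi_neq0 x)); rewrite -expiD addNr expi0 mulVf ?expi_neq0. Qed.

Lemma expi_Mint x (k : int) : expi (x *~ k) = expi x ^ k.
Proof.
case: k => k; first by rewrite -exprnP expiX.
by rewrite [RHS]/exprz expiX -expiN.
Qed.

Lemma expi_surj (z : R[i]) : `|z| = 1 -> exists x, z = expi x.
Proof.
case: z => a b; rewrite normc_def /= => /complexI h.
have ab : a ^+ 2 + b ^+ 2 = 1.
  by have := congr1 (fun x => x ^+ 2) h; rewrite sqr_sqrtr ?addr_ge0 ?sqr_ge0 // expr1n.
have a1 : -1 <= a <= 1.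
  by rewrite -ler_norml -(@expr_le1 _ 2) // real_normK ?num_real // -ab lerDl sqr_ge0.
have : sin (acos a) ^+ 2 = b ^+ 2.
  by rewrite sin2cos2 acosK ?in_itv //= -ab addrAC subrr add0r.
move/eqP; rewrite eqf_sqr => /orP[]/eqP e.
  by exists (acos a); rewrite /expi acosK ?in_itv //= e.
by exists (- acos a); rewrite /expi cosN sinN acosK ?in_itv //= e opprK.
Qed.

Lemma expi_eq1 x : expi (x * (pi *+ 2)) = 1 -> exists k : int, x = k%:~R.
Proof.
move=> h; exists (Num.floor x); apply/eqP; rewrite -subr_eq0; set y := x - _.
have y01 : 0 <= y < 1.
  rewrite subr_ge0 Num.Theory.ge_floor /= ltrBlDr addrC.
  by have := Num.Theory.floorD1_gt x; rewrite intrD.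
have hy : expi (y * (pi *+ 2)) = 1.
  rewrite mulrBl expiD h mul1r expiN mulrzl; rewrite expi_Mint expi2pi exp1rz invr1 //.
have s0 : sin (y * pi) = 0.
  have : cos (y * (pi *+ 2)) = 1 by have := congr1 (@complex.Re R) hy.
  rewrite mulrnAr cos_mulr2n cos2sin2 => /eqP; rewrite subr_eq -mulr2n eqr_pMn2r //.
  by rewrite subr_eq -subr_eq0 opprD addNKr oppr_eq0 sqrf_eq0 => /eqP.
apply: contraT => y0; have /sin_gt0_pi : 0 < y * pi < pi.
  case/andP: y01 => y0' y1; rewrite -[X in _ && (_ < X)]mul1r ltr_pM2r ?pi_gt0 // y1.
  by rewrite mulr_gt0 ?pi_gt0 // lt_def y0.
by rewrite s0 ltxx.
Qed.

Lemma expi_continuous0 (e : R) : 0 < e ->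
  exists2 del, 0 < del & forall x, `|x| < del -> `|expi x - 1| < e%:C.
Proof.
move=> e0; have e2 : 0 < e / 2 by rewrite divr_gt0.
have /cvgrPdist_lt /(_ _ e2) /nbhs_ballP[d1 /= d10 h1] := @continuous_cos R 0.
have /cvgrPdist_lt /(_ _ e2) /nbhs_ballP[d2 /= d20 h2] := @continuous_sin R 0.
exists (Num.min d1 d2); first by rewrite lt_min d10.
move=> x; rewrite lt_min => /andP[x1 x2].
have {}h1 : `|cos x - 1| < e / 2.
  by have := h1 x; rewrite /ball /= sub0r normrN cos0 distrC; apply.
have {}h2 : `|sin x| < e / 2.
  by have := h2 x; rewrite /ball /= sub0r normrN sin0 sub0r normrN; apply.
have -> : expi x - 1 = (cos x - 1)%:C + (sin x)%:C * 'i%C.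
  by apply/eqP; rewrite eq_complex /= !(mulr0, mulr1, addr0, subr0, mul0r, add0r, oppr0) !eqxx.
apply: le_lt_trans (ler_normD _ _) _.
rewrite normrM !normc_def /= !expr0n expr1n /= !addr0 add0r sqrtr1 mulr1 !sqrtr_sqr.
by rewrite -rmorphD ltcR [e]splitr ltrD.
Qed.

Definition cont_at0 (f : R -> R[i]) :=
  forall e : R, 0 < e -> exists2 del, 0 < del & forall x, `|x| < del -> `|f x - 1| < e%:C.

(** The character is 1 on the multiples of [x0 / 2 ^+ k], every real is within such a step of one of
    them, and [g] is close to 1 near 0. *)
Lemma dyadic_trivial (g : R -> R[i]) (x0 : R) :
  (forall x y, g (x + y) = g x * g y) -> (forall x, `|g x| = 1) -> cont_at0 g ->
  0 < x0 -> (forall k : nat, g (x0 / 2 ^+ k) = 1) -> forall x, g x = 1.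
Proof.
move=> gD g1 gc x00 gd x.
have gn y : g y != 0 by rewrite -normr_eq0 g1 oner_eq0.
have g0 : g 0 = 1 by apply: (mulIf (gn 0)); rewrite -gD addr0 mul1r.
have gX y k : g (y *+ k) = g y ^+ k.
  by elim: k => [|k IH]; rewrite ?mulr0n ?g0 // mulrS exprS gD IH.
have gN y : g (- y) = (g y)^-1.
  by apply: (mulIf (gn y)); rewrite -gD addNr g0 mulVf.
have gZ y (k : int) : g y = 1 -> g (y *~ k) = 1.
  move=> gy; case: k => k; first by rewrite -pmulrn gX gy expr1n.
  by rewrite NegzE mulrNz gN -pmulrn gX gy expr1n invr1.
have small (e : R) : 0 < e -> `|g x - 1| < e%:C.
  move=> e0; have [del d0 hd] := gc e e0.
  have [k hk] : exists k : nat, x0 / 2 ^+ k < del.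
    exists (Num.bound (x0 / del)); rewrite ltr_pdivrMr ?exprn_gt0 // mulrC -ltr_pdivrMr //.
    apply: lt_trans (Num.Theory.archi_boundP _) _; first by rewrite divr_ge0 ?ltW.
    by rewrite -natrX ltr_nat ltn_expl.
  set u := x0 / 2 ^+ k in hk; have u0 : 0 < u by rewrite divr_gt0 ?exprn_gt0.
  pose j := Num.floor (x / u).
  have xE : x = (x - u *~ j) + u *~ j by rewrite subrK.
  rewrite xE gD gZ ?gd // mulr1; apply: hd; rewrite ger0_norm.
    apply: lt_trans hk; rewrite ltrBlDr -mulrzl -[X in _ < X + _]mul1r -mulrDl -ltr_pdivrMr //.
    by rewrite addrC; have := Num.Theory.floorD1_gt (x / u); rewrite intrD.
  by rewrite subr_ge0 -mulrzl -ler_pdivlMr // Num.Theory.ge_floor.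
apply/eqP; rewrite -subr_eq0 -normr_le0 normc_def lecR leNgt; apply/negP => h.
by have := small _ h; rewrite normc_def ltcR ltxx.
Qed.

(** Near 0 the real part of [f] is positive. An angle [th] of [f x0] being chosen in that
    half-plane, positivity selects the right square root at each halving, so [f] and [expi] agree on
    all [x0 / 2 ^+ k]; their quotient is trivial by [dyadic_trivial]. *)
Lemma exists_half_angles (f : R -> R[i]) :
  (forall x y, f (x + y) = f x * f y) -> (forall x, `|f x| = 1) -> cont_at0 f ->
  exists a : R, forall x, f x = expi (a * x).
Proof.
move=> fD f1 fc; have [del d0 hd] := fc 1 ltr01.
have Repos x : `|x| < del -> 0 < complex.Re (f x).
  move=> /hd h; rewrite ltNge; apply/negP => re0.
  have : `|f x - 1| >= 1%:C.
    rewrite normc_def lecR -[leLHS]sqrtr1 ler_wsqrtr // -[leLHS]addr0 lerD ?sqr_ge0 //.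
    case: (f x) re0 => a b /= a0; rewrite -subr_ge0; have -> : (a - 1) ^+ 2 - 1 = a * (a - 2) by ring.
    by rewrite mulr_le0 // subr_le0 (le_trans a0).
  by move=> /le_lt_trans /(_ h); rewrite ltxx.
pose x0 := del / 2; have x00 : 0 < x0 by rewrite divr_gt0.
have x0d k : `|x0 / 2 ^+ k| < del.
  rewrite ger0_norm ?divr_ge0 ?exprn_ge0 ?ltW // ltr_pdivrMr ?exprn_gt0 //.
  rewrite ltr_pdivrMr // -mulrA ltr_pMr // -exprSr -natrX ltr1n.
  by rewrite -{1}(expn0 2) ltn_exp2l.
have [th th1 hth] : exists2 th, f x0 = expi th & `|th| <= pi / 2.
  have : `|x0| < del by have := x0d 0%N; rewrite expr0 divr1.
  move=> /Repos; have := f1 x0; case: (f x0) => a b; rewrite normc_def /= => /complexI h a0.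
  have ab : a ^+ 2 + b ^+ 2 = 1.
    by have := congr1 (fun x => x ^+ 2) h; rewrite sqr_sqrtr ?addr_ge0 ?sqr_ge0 // expr1n.
  have b1 : -1 <= b <= 1.
    by rewrite -ler_norml -(@expr_le1 _ 2) // real_normK ?num_real // -ab lerDr sqr_ge0.
  exists (asin b); last by rewrite ler_norml asin_geNpi2 ?asin_lepi2.
  rewrite /expi asinK ?in_itv //= cos_asin // -ab addrK sqrtr_sqr gtr0_norm //.
have half k : f (x0 / 2 ^+ k) = expi (th / 2 ^+ k).
  elim: k => [|k IH]; first by rewrite !expr0 !divr1.
  have dbl (y : R) : y / 2 ^+ k = y / 2 ^+ k.+1 + y / 2 ^+ k.+1.
    by rewrite exprSr invfM mulrA -splitr.
  have : f (x0 / 2 ^+ k.+1) ^+ 2 = expi (th / 2 ^+ k.+1) ^+ 2.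
    by rewrite !expr2 -fD -expiD -!dbl.
  move/eqP; rewrite eqf_sqr => /orP[/eqP //|/eqP e].
  have := Repos _ (x0d k.+1); rewrite e /= oppr_gt0 ltNge.
  suff -> : 0 <= cos (th / 2 ^+ k.+1) by [].
  apply: cos_ge0_pihalf; rewrite -ler_norml normrM; apply: le_trans hth.
  rewrite ler_piMr // ger0_norm ?invr_ge0 ?exprn_ge0 // invf_le1 ?exprn_gt0 //.
  by rewrite -natrX ler1n expn_gt0.
exists (th / x0) => x.
pose g y := f y * expi (- (th / x0 * y)).
suff /(_ x) : forall y, g y = 1.
  by rewrite /g expiN => h; apply: (mulIf (_ : (expi (th / x0 * x))^-1 != 0)); rewrite ?invr_eq0 ?expi_neq0 // h mulfV ?expi_neq0.
apply: (@dyadic_trivial g x0) => //.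
- by move=> y z; rewrite /g fD mulrDr opprD expiD mulrACA.
- by move=> y; rewrite /g normrM f1 norm_expi mulr1.
- move=> e e0; have e2 : 0 < e / 2 by rewrite divr_gt0.
  have [d1 d10 h1] := fc _ e2; have [d2 d20 h2] := expi_continuous0 e2.
  exists (Num.min d1 (d2 / (1 + `|th / x0|))).
    by rewrite lt_min d10 divr_gt0 // ltr_pwDl.
  move=> y; rewrite lt_min => /andP[y1 y2].
  have -> : g y - 1 = (f y - 1) * expi (- (th / x0 * y)) + (expi (- (th / x0 * y)) - 1).
    by rewrite mulrBl mul1r addrA subrK.
  apply: le_lt_trans (ler_normD _ _) _; rewrite normrM norm_expi mulr1.
  rewrite [e]splitr rmorphD ltrD ?h1 // h2 // normrN normrM.
  rewrite ltr_pdivlMr ?ltr_pwDl // in y2; apply: le_lt_trans y2.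
  by rewrite mulrC ler_wpM2l // lerDr.
- by move=> k; rewrite /g half mulrA divfK ?gt_eqF // -expiD subrr expi0.
Qed.

Theorem circle_character (chi : R[i] -> R[i]) :
  (forall s t, `|s| = 1 -> `|t| = 1 -> chi (s * t) = chi s * chi t) ->
  (forall t, `|t| = 1 -> `|chi t| = 1) ->
  (forall e : R, 0 < e -> exists2 del : R, 0 < del &
     forall t, `|t| = 1 -> `|t - 1| < del%:C -> `|chi t - 1| < e%:C) ->
  exists k : int, forall t, `|t| = 1 -> chi t = t ^ k.
Proof.
move=> cM c1 cc; pose f x := chi (expi x).
have [||//|a ha] := @exists_half_angles f.
- by move=> x y; rewrite /f expiD cM // norm_expi.
- by move=> x; rewrite /f c1 // norm_expi.
- move=> e e0; have [d1 d10 h1] := cc e e0; have [d2 d20 h2] := expi_continuous0 d10.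
  by exists d2 => // x /h2 ?; apply: h1; rewrite ?norm_expi.
have [k hk] : exists k : int, a = k%:~R.
  apply: expi_eq1; rewrite -ha /f expi2pi; apply: (mulIf (_ : chi 1 != 0)).
    by rewrite -normr_eq0 c1 ?normr1 // oner_eq0.
  by rewrite -cM ?normr1 // mulr1 mul1r.
exists k => t /expi_surj[x ->]; rewrite -expi_Mint -[LHS]/(f x) ha hk.
by rewrite mulrzl.
Qed.

End CircleCharacter.

(** * Maxima on compact sets of complex matrices *)

Section CompactMax.
Variables (R : realType) (p q : nat).

Lemma normc_real (x : R) : `|x%:C| = `|x|%:C.
Proof. by rewrite normc_def /= expr0n addr0 sqrtr_sqr. Qed.

Lemma normc_ge_Im (z : R[i]) : `|complex.Im z|%:C <= `|z|.
Proof. by rewrite normc_def lecR -sqrtr_sqr ler_wsqrtr // lerDr sqr_ge0. Qed.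

Lemma normc_le_add (x y : R) : `|x +i* y| <= (`|x| + `|y|)%:C.
Proof.
rewrite normc_def lecR /=.
rewrite -(ger0_norm (addr_ge0 (normr_ge0 x) (normr_ge0 y))) -sqrtr_sqr ler_wsqrtr //.
by rewrite sqrrD !real_normK ?num_real // -addrA lerD2l lerDr mulrn_wge0 // mulr_ge0.
Qed.

(** Real coordinates, real parts then imaginary parts, so that compactness of a real cube can be
    used. *)
Definition of_coords (v : 'rV[R]_(p * q + p * q)) : 'M[R[i]]_(p, q) :=
  \matrix_(a, b) (v 0 (lshift _ (mxvec_index a b)) +i* v 0 (rshift _ (mxvec_index a b))).

Definition to_coords (X : 'M[R[i]]_(p, q)) : 'rV[R]_(p * q + p * q) :=
  row_mx (mxvec (map_mx (@complex.Re R) X)) (mxvec (map_mx (@complex.Im R) X)).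

Lemma to_coordsK X : of_coords (to_coords X) = X.
Proof.
apply/matrixP => a b; rewrite mxE row_mxEl row_mxEr !mxvecE !mxE.
by case: (X a b).
Qed.

Lemma of_coords_lipschitz (v w : 'rV[R]_(p * q + p * q)) (e : R) : (forall k, `|v 0 k - w 0 k| <= e) ->
  l1norm (of_coords v - of_coords w) <= ((p * q).*2%:R * e)%:C.
Proof.
move=> h; have h2 a b : `|(of_coords v - of_coords w) a b| <= (e *+ 2)%:C.
  rewrite !mxE; apply: le_trans (normc_le_add _ _) _.
  by rewrite lecR mulr2n lerD.
apply: le_trans (_ : \sum_(a < p) \sum_(b < q) (e *+ 2)%:C <= _).
  by apply: ler_sum => a _; apply: ler_sum => b _.
rewrite !sumr_const !card_ord -mulrnA -[(_%:C) *+ _]rmorphMn /= lecR.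
by rewrite -mulrnA mulr_natl mul2n mulnC.
Qed.

Variables (K : 'M[R[i]]_(p, q) -> Prop) (f : 'M[R[i]]_(p, q) -> R[i]) (c : R[i]).
Hypothesis K_nonempty : exists X, K X.
Hypothesis K_bounded : forall X a b, K X -> `|X a b| <= 1.
Hypothesis K_closed : forall X,
  (forall e, 0 < e -> exists2 Y, K Y & l1norm (X - Y) <= e) -> K X.
Hypothesis f_real : forall X, f X \is Num.real.
Hypothesis f_lipschitz : forall X Y, K X -> K Y -> `|f X - f Y| <= c * l1norm (X - Y).

Lemma compact_max : exists2 X, K X & forall Y, K Y -> f Y <= f X.
Proof.
pose A : set 'rV[R]_(p * q + p * q) := [set v | K (of_coords v)]%classic.
pose cube : set 'rV[R]_(p * q + p * q) := [set v | forall k, `[-1, 1]%classic (v ord0 k)]%classic.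
have near_ball (v : 'rV[R]_(p * q + p * q)) (e : R[i]) : 0 < e -> exists2 del : R, 0 < del &
    forall w, ball v del w -> l1norm (of_coords v - of_coords w) <= e.
  move=> e0; have er : e = (complex.Re e)%:C by rewrite RRe_real // gtr0_real.
  pose N : R := ((p * q).*2.+1)%:R; have N0 : 0 < N by rewrite ltr0n.
  have re0 : 0 < complex.Re e by rewrite -ltcR -er.
  exists (complex.Re e / N); first by rewrite divr_gt0.
  move=> w [hw1 hw]; rewrite er; apply: le_trans (of_coords_lipschitz (e := complex.Re e / N) _) _.
    by move=> k; have := hw ord0 k; rewrite /ball /= => /ltW.
  rewrite lecR mulrCA -[leRHS]mulr1; apply: (ler_wpM2l (ltW re0)).
  by rewrite ler_pdivrMr // mul1r ler_nat leqnSn.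
have cA : compact A.
  apply: (subclosed_compact _ (rV_compact (fun=> @segment_compact R (-1) 1))).
    move=> v clv; apply: K_closed => e /(near_ball v)[del del0 hdel].
    have [w [Kw vw]] := clv _ (nbhsx_ballx v _ del0).
    by exists (of_coords w) => //; apply: hdel.
  move=> v Kv k; rewrite /= in_itv /= -ler_norml -lecR.
  case: (split_ordP k) => l ->; case/mxvec_indexP: l => a b.
    by apply: le_trans (K_bounded a b Kv); apply: le_trans (normc_ge_Re _); rewrite mxE.
  by apply: le_trans (K_bounded a b Kv); apply: le_trans (normc_ge_Im _); rewrite mxE.
have fA : ({within A, continuous (fun v => complex.Re (f (of_coords v)))})%classic.
  apply/subspace_continuousP => v Kv; apply/cvg_ballP => e e0.
  pose c' := `|c| + 1; have c'0 : 0 < c' by rewrite ltr_wpDl.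
  have e0' : 0 < e%:C / (2 * c') by rewrite divr_gt0 ?mulr_gt0 // ltcR.
  have [del del0 hdel] := near_ball v _ e0'.
  rewrite nearE /within /=; apply/nbhs_ballP; exists del => //= w vw Kw.
  rewrite /from_subspace /ball /= -ltcR.
  apply: le_lt_trans (_ : `|f (of_coords v) - f (of_coords w)| < _).
    by rewrite -raddfB; apply: normc_ge_Re.
  apply: le_lt_trans (f_lipschitz Kv Kw) _.
  have l0 := l1norm_ge0 (of_coords v - of_coords w).
  apply: le_lt_trans (_ : c' * (e%:C / (2 * c')) < _).
    have cr : `|c * l1norm (of_coords v - of_coords w)| <= c' * (e%:C / (2 * c')).
      rewrite normrM (ger0_norm l0) ler_pM ?hdel //.
      by rewrite lerDl.
    apply: le_trans cr; rewrite -[X in X <= _]ger0_norm //.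
    exact: le_trans (normr_ge0 _) (f_lipschitz Kv Kw).
  have c'n : c' != 0 by rewrite gt_eqF.
  have -> : c' * (e%:C / (2 * c')) = e%:C / 2 by field.
  by rewrite ltr_pdivrMr // ltr_pMr ?ltcR // ltr1n.
have A0 : A !=set0%classic.
  by have [X KX] := K_nonempty; exists (to_coords X); rewrite /A /= to_coordsK.
have [v /set_mem Kv hv] := compact_EVT_max A0 cA fA.
exists (of_coords v) => // Y KY.
have KY' : to_coords Y \in A by rewrite inE /A /= to_coordsK.
by have := hv _ KY'; rewrite to_coordsK -lecR !RRe_real.
Qed.

End CompactMax.

Local Close Scope complex_scope.
Local Open Scope sesquilinear_scope.

(** * Continuous representations of the circle are diagonal *)

Section CircleRep.
Variable R : realType.
Local Notation C := R[i].

(** The matrices commute, so a finite spanning subfamily, hence the whole family, is triangular in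
    one orthonormal basis. Adjoints are inverses in the family, hence triangular too, so all are
    diagonal, and the diagonal entries are continuous characters. *)
Lemma circle_rep_diag d (sigma : C -> 'M[C]_d) :
  (forall s t, `|s| = 1 -> `|t| = 1 -> sigma (s * t) = sigma s *m sigma t) ->
  (forall t, `|t| = 1 -> sigma t \is unitarymx) ->
  (forall e : C, 0 < e -> exists2 del : C, 0 < del &
     forall t, `|t| = 1 -> `|t - 1| < del -> forall i j, `|(sigma t - 1%:M) i j| < e) ->
  exists P : 'M[C]_d, exists2 kap : 'I_d -> int, P \is unitarymx &
    forall t, `|t| = 1 -> sigma t = P^t* *m diag_mx (\row_a exprz t (kap a)) *m P.
Proof.
move=> sM su sc.
have [s hs] := @span_family _ _ {t : C | `|t| == 1} (fun t => sigma (val t)).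
have s1 : sigma 1 = 1%:M.
  have := sM 1 1 (normr1 _) (normr1 _); rewrite mulr1 => h.
  have u := unitarymx_unit (su 1 (normr1 _)).
  by have := congr1 (mulmx (invmx (sigma 1))) h; rewrite mulKmx // mulVmx.
have sV t : `|t| = 1 -> (sigma t)^t* = sigma t^-1.
  move=> t1; have t0 : t != 0 by rewrite -normr_eq0 t1 oner_eq0.
  have tV : `|t^-1| = 1 by rewrite normfV t1 invr1.
  have := sM t t^-1 t1 tV; rewrite mulfV // s1 => /(congr1 (mulmx ((sigma t)^t*))).
  by rewrite mulmx1 mulmxA adjmx_unitary ?su // mul1mx.
have [|P uP trig] := @cotrigonalization C d [seq sigma (val t) | t <- s].
  move=> A B /mapP[[a a1] _ ->] /mapP[[b b1] _ ->] /=.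
  by rewrite /comm_mx -!sM ?(eqP a1) ?(eqP b1) // mulrC.
pose X t := P *m sigma t *m P^t*.
have trigX t : `|t| = 1 -> forall i j : 'I_d, (i < j)%N -> X t i j = 0.
  move=> t1 i j ij.
  have := @coord_span _ _ _ (in_tuple [seq sigma (val t) | t <- s]) _
     (hs (exist _ t (introT eqP t1))); rewrite /= /X => ->.
  rewrite mulmx_sumr mulmx_suml summxE big1 // => k _.
  rewrite -scalemxAr -scalemxAl mxE.
  set A := _`_k; have : A \in [seq sigma (val t) | t <- s] by apply: mem_nth.
  move=> /(allP trig); rewrite /similar_to -conjymx // => /is_trig_mxP /(_ i j ij) ->.
  by rewrite mulr0.
have diagX t : `|t| = 1 -> forall i j : 'I_d, i != j -> X t i j = 0.
  move=> t1 i j; rewrite neq_ltn => /orP[/trigX -> //|ji].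
  have tV : `|t^-1| = 1 by rewrite normfV t1 invr1.
  have := trigX _ tV _ _ ji; rewrite /X -sV // => h.
  have -> : P *m sigma t *m P^t* = (P *m (sigma t)^t* *m P^t*)^t*.
    by rewrite !adjmxM !trmxCK mulmxA.
  by rewrite 2!mxE h conjC0.
pose chi a t := X t a a.
have Xdiag t : `|t| = 1 -> X t = diag_mx (\row_a chi a t).
  move=> t1; apply/matrixP => i j; rewrite [RHS]mxE [(\row__ _) _ _]mxE.
  by have [->|ij] := eqVneq i j; rewrite ?mulr1n // mulr0n diagX.
have XM s' t : `|s'| = 1 -> `|t| = 1 -> X (s' * t) = X s' *m X t.
  by move=> s1' t1; rewrite /X sM // !mulmxA -(mulmxA _ (P^t*)) adjmx_unitary // mulmx1.
have uX t : `|t| = 1 -> X t \is unitarymx.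
  by move=> t1; rewrite !mul_unitarymx ?trmxC_unitary ?su.
have hk a : exists k : int, forall t, `|t| = 1 -> chi a t = exprz t k.
  apply: circle_character.
  - move=> s' t s1' t1; rewrite {1}/chi XM // (Xdiag s') // (Xdiag t) // mulmx_diag.
    by rewrite [LHS]mxE eqxx mulr1n [LHS]mxE ![(\row__ _) _ _]mxE.
  - move=> t t1; have /unitarymxP := uX t t1; rewrite Xdiag //.
    move=> /matrixP /(_ a a); rewrite tr_diag_mx map_diag_mx mulmx_diag [LHS]mxE [RHS]mxE.
    rewrite eqxx !mulr1n [LHS]mxE [X in _ * X]mxE ![(\row__ _) _ _]mxE -normCK.
    by move/eqP; rewrite sqrp_eq1 // => /eqP.
  - move=> e e0; pose c : C := 1 + l1norm P * (d * d)%:R * l1norm (P^t*).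
    have c0 : 0 < c by rewrite ltr_pwDl // !mulr_ge0 ?l1norm_ge0.
    have eC : 0 < (e / 2)%:C%C / c by rewrite divr_gt0 // ltcR divr_gt0.
    have [del d0 hd] := sc _ eC.
    exists (complex.Re del); first by move: d0; rewrite ltcE => /andP[].
    have -> : (complex.Re del)%:C%C = del.
      move: (d0); rewrite ltcE => /andP[/eqP im _].
      by apply/eqP; rewrite eq_complex /= im !eqxx.
    move=> t t1 td.
    have -> : chi a t - 1 = (P *m (sigma t - 1%:M) *m P^t*) a a.
      rewrite mulmxBr mulmx1 mulmxBl (unitarymxP uP) [RHS]mxE [X in _ = _ + X]mxE.
      by rewrite [X in _ = _ - X]mxE eqxx.
    apply: le_lt_trans (l1norm_ge _ _ _) _; apply: le_lt_trans (ler_l1normM _ _) _.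
    apply: (@le_lt_trans _ _ ((e / 2)%:C%C)); last by rewrite ltcR ltr_pdivrMr // ltr_pMr // ltr1n.
    apply: (@le_trans _ _ (l1norm P * ((d * d)%:R * ((e / 2)%:C%C / c)) * l1norm (P^t*))).
      rewrite ler_wpM2r ?l1norm_ge0 //; apply: le_trans (ler_l1normM _ _) _.
      rewrite ler_wpM2l ?l1norm_ge0 //.
      apply: (@le_trans _ _ (\sum_(i < d) \sum_(j < d) ((e / 2)%:C%C / c))).
        by apply: ler_sum => i _; apply: ler_sum => j _; apply/ltW/hd.
      by rewrite !(sumr_const, card_ord) -mulrnA mulr_natl.
    rewrite !mulrA mulrAC ler_pdivrMr // mulrAC mulrC ler_wpM2l // ?ler0c ?divr_ge0 ?(ltW e0) //.
    by rewrite /c lerDr ler01.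
have [kap hkap] := fin_all_exists hk.
exists P, kap => // t t1.
rewrite -[X in diag_mx X](_ : \row_a chi a t = _); last first.
  by apply/rowP => a; rewrite !mxE hkap.
rewrite -Xdiag // /X !mulmxA adjmx_unitary // mul1mx -mulmxA adjmx_unitary // mulmx1.
by [].
Qed.
End CircleRep.

Lemma unit_cV_norm_le1 (C : numClosedFieldType) n (u : 'cV[C]_n) i :
  unit_cV u -> `|u i 0| <= 1.
Proof.
move=> u1; have uu : u^T \is unitarymx.
  apply/unitarymxP/matrixP => a b; rewrite !ord1.
  have /matrixP /(_ 0 0) := u1; rewrite !mxE => <-.
  by apply: eq_bigr => k _; rewrite !mxE mulrC.
by have := unitarymx_norm_le1 0 i uu; rewrite mxE.
Qed.

Lemma unitary_rep_circle_diagonal (R : realType) n d (rho : 'M[R[i]]_n -> 'M[R[i]]_d) :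
  unitary_rep rho -> circle_diagonal rho.
Proof.
move=> hr; have [ru r1 rM _] := hr; split=> // u u1.
apply: circle_rep_diag => [s t s1 t1|t t1|e e0].
- by rewrite -rM ?unitary_circle_of // circle_of_mul.
- by rewrite ru // unitary_circle_of.
have [del d0 hd] := unitary_rep_continuous1 hr e0; exists del => // t t1 td.
apply: hd; first exact: unitary_circle_of.
move=> a b; rewrite /circle_of addrC addKr mxE normrM; apply: le_lt_trans td.
rewrite ler_piMr // mxE big_ord1 normrM !mxE norm_conjC.
by rewrite mulr_ile1 // unit_cV_norm_le1.
Qed.

(** * Highest weight vectors *)

(** Pair with the increasing function [k]: it is negative on positive roots, hence at most 0 on
    [lam - kap] if [kap] is lower, while here it gives [j - i]. *)
Lemma weight_le_raise n (kap lam : n.-tuple int) (i j : 'I_n) : (i < j)%N ->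
  (forall k, tnth kap k = tnth lam k + (k == i)%:Z - (k == j)%:Z) -> ~ weight_le kap lam.
Proof.
move=> ij hk [c hc].
have : \sum_(k < n) k%:Z * (tnth lam k - tnth kap k) <= 0.
  under eq_bigr => k _.
    rewrite hc mulr_sumr; under eq_bigr do rewrite mulr_sumr; over.
  rewrite exchange_big; apply: sumr_le0 => p _; rewrite exchange_big.
  apply: sumr_le0 => q pq /=.
  have -> : \sum_(k < n) k%:Z * ((c p q)%:Z * ((k == p)%:Z - (k == q)%:Z)) =
      (c p q)%:Z * (p%:Z - q%:Z).
    under eq_bigr do rewrite mulrCA mulrBr.
    rewrite -mulr_sumr sumrB (bigD1 p) //= eqxx mulr1 big1 ?addr0 => [|k /negPf ->]; last by rewrite mulr0.
    by rewrite (bigD1 q) //= eqxx mulr1 big1 ?addr0 // => k /negPf ->; rewrite mulr0.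
  by rewrite mulr_ge0_le0 // subr_le0 lez_nat ltnW.
have -> : \sum_(k < n) k%:Z * (tnth lam k - tnth kap k) = j%:Z - i%:Z.
  rewrite (eq_bigr (fun k : 'I_n => k%:Z * (k == j)%:Z - k%:Z * (k == i)%:Z)) => [|k _]; last first.
    by rewrite hk -mulrBr; congr (_ * _); ring.
  rewrite sumrB (bigD1 j) //= eqxx mulr1 big1 ?addr0 => [|k /negPf ->]; last by rewrite mulr0.
  by rewrite (bigD1 i) //= eqxx mulr1 big1 ?addr0 // => k /negPf ->; rewrite mulr0.
by rewrite subr_le0 lez_nat leqNgt ij.
Qed.

Section Weights.
Variables (C : numClosedFieldType) (n d : nat) (rho : 'M[C]_n -> 'M[C]_d).
Hypothesis h : circle_diagonal rho.

(** If nonzero, [ediff h i j *m v] would have weight [lam] plus the positive root e_i - e_j, which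
    is not lower than [lam]. *)
Lemma highest_weight_vector (lam : n.-tuple int) : highest_weight rho lam ->
  exists v : 'cV[C]_d, [/\ v != 0, forall i, ediff h i i *m v = (tnth lam i)%:~R *: v
    & forall i j : 'I_n, (i < j)%N -> ediff h i j *m v = 0].
Proof.
move=> [[v v0 hv] top]; have wv := (torus_weight h (tnth lam) v).1 hv.
exists v; split=> // i j ij; apply/eqP/negPn/negP => w0.
pose kap := [tuple (tnth lam k + (k == i)%:Z - (k == j)%:Z) | k < n].
have ek k : tnth kap k = tnth lam k + (k == i)%:Z - (k == j)%:Z by rewrite tnth_mktuple.
apply: (weight_le_raise ij ek); apply: top; exists (ediff h i j *m v) => //.
apply/(torus_weight h (tnth kap)) => k.
rewrite ek mulmxA ediff_bracket mulmxDl -mulmxA wv -scalemxAr mulmxBl.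
rewrite intrB intrD scalerBl scalerDl -addrA; congr (_ + _).
congr (_ - _).
  by have [->|_] := eqVneq k i; rewrite ?mulr1n ?mulr0n ?mul0mx ?scale1r ?scale0r.
by rewrite (eq_sym j); have [->|_] := eqVneq k j; rewrite ?mulr1n ?mulr0n ?mul0mx ?scale1r ?scale0r.
Qed.

End Weights.

(** * Schur's lemma and cyclicity *)

Section Schur.
Variables (C : numClosedFieldType) (n d e : nat).
Variables (rho : 'M[C]_n -> 'M[C]_d) (rho' : 'M[C]_n -> 'M[C]_e).

Lemma irreducible_injective (T : 'M[C]_(e, d)) : irreducible_rep rho -> T != 0 ->
  (forall g, g \is unitarymx -> T *m rho g = rho' g *m T) ->
  forall v : 'cV[C]_d, T *m v = 0 -> v = 0.
Proof.
move=> [_ _ irr] T0 hT v Tv0.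
pose f : 'Hom('cV[C]_d, 'cV[C]_e) := linfun (mulmx T).
have fE x : f x = T *m x by rewrite lfunE.
have inv : invariant_subspace rho (lker f).
  by move=> g x ug; rewrite !memv_ker !fE mulmxA hT // -mulmxA => /eqP ->; rewrite mulmx0.
have := irr _ inv (subvf _) => -[k0|kf].
  by apply/eqP; rewrite -memv0 -k0 memv_ker fE Tv0.
case/eqP: T0; apply/matrixP => a b; rewrite mxE.
have : delta_mx b 0 \in lker f by rewrite kf memvf.
by rewrite memv_ker fE -colE => /eqP /matrixP /(_ a 0); rewrite !mxE.
Qed.

Lemma irreducible_surjective (T : 'M[C]_(d, e)) : irreducible_rep rho -> T != 0 ->
  (forall g, g \is unitarymx -> T *m rho' g = rho g *m T) ->
  forall v : 'cV[C]_d, exists x, v = T *m x.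
Proof.
move=> [_ _ irr] T0 hT v.
pose f : 'Hom('cV[C]_e, 'cV[C]_d) := linfun (mulmx T).
have fE x : f x = T *m x by rewrite lfunE.
have inv : invariant_subspace rho (limg f).
  move=> g y ug /memv_imgP[x _ ->]; rewrite fE mulmxA -hT // -mulmxA -fE.
  exact: memv_img (memvf _).
have := irr _ inv (subvf _) => -[k0|kf].
  case/eqP: T0; apply/matrixP => a b; rewrite mxE.
  have := memv_img f (memvf (delta_mx b 0)); rewrite k0 memv0 fE -colE.
  by move=> /eqP /matrixP /(_ a 0); rewrite !mxE.
have : v \in limg f by rewrite kf memvf.
by move=> /memv_imgP[x _ ->]; exists x; rewrite fE.
Qed.

End Schur.

(** The projection on the span of the words commutes with the derivative, hence with the group, so
    irreducibility makes it surjective. *)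
Lemma irreducible_words (C : numClosedFieldType) (n d : nat) (rho : 'M[C]_n -> 'M[C]_d)
    (h : circle_diagonal rho) (v : 'cV[C]_d) : irreducible_rep rho -> v != 0 ->
  forall x, in_words (fun g : 'I_n * 'I_n => ediff h g.1 g.2) v x.
Proof.
move=> irr v0 x.
have hadj (g : 'I_n * 'I_n) : (ediff h g.1 g.2)^t* = ediff h (g.2, g.1).1 (g.2, g.1).2.
  exact: ediff_adj.
have [Q [Qv Qc Qw]] := words_projection v hadj.
have Q0 : Q != 0 by apply: contra v0 => /eqP Q0; rewrite -Qv Q0 mul0mx.
have Qg := diff_rep_intertwine (h := h) (h' := h) (T := Q) (fun i j => Qc (i, j)).
by have [y ->] := irreducible_surjective irr Q0 Qg x; apply: Qw.
Qed.

(** * Complete reducibility *)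

Section CompleteReducibility.
Variables (C : numClosedFieldType) (n d : nat) (rho : 'M[C]_n -> 'M[C]_d).
Hypothesis rho_star : forall g, g \is unitarymx -> exists2 g', g' \is unitarymx & (rho g)^t* = rho g'.
Implicit Types U V W : {vspace 'cV[C]_d}.

Definition perp_mx W : 'M[C]_(\dim W, d) := \matrix_(k < \dim W) ((vbasis W)`_k)^t*.

Definition perp W : {vspace 'cV[C]_d} := lker (linfun (mulmx (perp_mx W)) : 'Hom('cV[C]_d, 'cV[C]_(\dim W))).

Lemma perpP W x : reflect (forall y, y \in W -> y^t* *m x = 0) (x \in perp W).
Proof.
rewrite memv_ker lfunE /=; apply: (iffP eqP) => [h y yW|h].
  rewrite (coord_vbasis yW) adjmx_sum mulmx_suml big1 // => k _.
  rewrite adjmxZ -scalemxAl; have := congr1 (row k) h.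
  by rewrite row_mul rowK row0 => ->; rewrite scaler0.
apply/row_matrixP => k; rewrite row_mul rowK row0; apply: h.
by apply: vbasis_mem; rewrite mem_nth ?size_tuple.
Qed.

Lemma perp_cap W : (W :&: perp W = 0)%VS.
Proof.
apply/eqP; rewrite -subv0; apply/subvP => x; rewrite memv_cap => /andP[xW /perpP /(_ x xW) h].
by rewrite memv0; apply/eqP/cdot_eq0; rewrite /cdot h mxE.
Qed.

Lemma perp_add W : (W + perp W = fullv)%VS.
Proof.
apply/eqP; rewrite eqEdim subvf /= dimv_disjoint_sum ?perp_cap //.
have := limg_ker_dim (linfun (mulmx (perp_mx W)) : 'Hom('cV[C]_d, 'cV[C]_(\dim W))) fullv.
rewrite capfv -/(perp W) => <-; rewrite addnC leq_add2r.
by apply: leq_trans (dimvS (subvf _)) _; rewrite dimvf /dim /= muln1.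
Qed.

Lemma perp_invariant W : invariant_subspace rho W -> invariant_subspace rho (perp W).
Proof.
move=> inv g x ug /perpP hx; apply/perpP => y yW; have [g' ug' e] := rho_star ug.
by have := hx _ (inv _ _ ug' yW); rewrite adjmxM -e trmxCK mulmxA.
Qed.

Lemma invariant_cap U V : invariant_subspace rho U -> invariant_subspace rho V ->
  invariant_subspace rho (U :&: V)%VS.
Proof.
by move=> hU hV g x ug; rewrite !memv_cap => /andP[xU xV]; rewrite hU ?hV.
Qed.

Definition decomposes k (V : 'I_k -> {vspace 'cV[C]_d}) W :=
  [/\ forall i, irreducible_subspace rho (V i), directv (\sum_(i < k) V i)%VS
    & (\sum_(i < k) V i)%VS = W].

Lemma decomposes_cons k (V : 'I_k -> {vspace 'cV[C]_d}) W U : irreducible_subspace rho U ->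
  (U :&: W = 0)%VS -> decomposes V W ->
  decomposes (fun i : 'I_k.+1 => if unlift ord0 i is Some j then V j else U) (U + W).
Proof.
move=> irrU UW [irr dir sumV]; split=> [i||].
- by case: (unlift ord0 i).
- move: dir; rewrite !directvE /= !big_ord_recl unlift_none.
  under [X in (U + X)%VS]eq_bigr do rewrite liftK.
  under [X in (_ + X)%N]eq_bigr do rewrite liftK.
  by rewrite sumV dimv_disjoint_sum // => /eqP ->.
rewrite big_ord_recl unlift_none; congr (_ + _)%VS; rewrite -sumV.
by apply: eq_bigr => i _; rewrite liftK.
Qed.

Lemma complete_reducibility W : invariant_subspace rho W ->
  exists k (V : 'I_k -> {vspace 'cV[C]_d}), decomposes V W.
Proof.
have [N] := ubnP (\dim W); elim: N W => // N IH W; rewrite ltnS => dW inv.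
have [->|W0] := eqVneq W 0%VS.
  exists 0, (fun=> 0%VS); split=> [[]//||]; last by rewrite big_ord0.
  by apply/directv_sumP => -[].
pose P m := `[< exists U, [/\ U != 0%VS, invariant_subspace rho U, (U <= W)%VS & \dim U = m] >].
have exP : exists m, P m by exists (\dim W); apply/asboolP; exists W.
case: (ex_minnP exP) => m /asboolP[U [U0 invU UW dU]] minU.
have irrU : irreducible_subspace rho U.
  split; [by apply/eqP | exact: invU |] => U' invU' U'U.
  have [->|U'0] := eqVneq U' 0%VS; [by left | right].
  apply/eqP; rewrite eqEdim U'U dU; apply: minU; apply/asboolP; exists U'; split=> //.
  exact: subv_trans U'U UW.
have eW : (U + (perp U :&: W))%VS = W by rewrite vspace_modl // perp_add capfv.
have cap0 : (U :&: (perp U :&: W))%VS = 0%VS by rewrite capvA perp_cap cap0v.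
have dimU : (0 < \dim U)%N by rewrite lt0n dimv_eq0.
have [||k [V hV]] := IH (perp U :&: W)%VS.
- apply: leq_trans dW; rewrite -{2}eW dimv_disjoint_sum //.
  by rewrite -[X in (X < _)%N]add0n ltn_add2r.
- by apply: invariant_cap => //; apply: perp_invariant.
rewrite -eW; exists k.+1; eexists; exact: decomposes_cons irrU cap0 hV.
Qed.

(** The image is an irreducible copy of [sigma]; a decomposition of its orthogonal complement
    completes it to one of the whole space. *)
Lemma injective_intertwiner_appears e (sigma : 'M[C]_n -> 'M[C]_e) (S : 'M[C]_(d, e)) :
  irreducible_rep sigma -> S != 0 ->
  (forall g, g \is unitarymx -> S *m sigma g = rho g *m S) -> appears_in sigma rho.
Proof.
move=> irr S0 hS; have injS := irreducible_injective irr S0 hS.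
pose f : 'Hom('cV[C]_e, 'cV[C]_d) := linfun (mulmx S).
have fE x : f x = S *m x by rewrite lfunE.
have fg g x : g \is unitarymx -> f (sigma g *m x) = rho g *m f x.
  by move=> ug; rewrite !fE !mulmxA hS.
have ker0 : lker f = 0%VS.
  apply/eqP; rewrite -subv0; apply/subvP => x; rewrite memv_ker fE memv0 => /eqP /injS ->.
  by rewrite eqxx.
have invf : invariant_subspace rho (limg f).
  by move=> g y ug /memv_imgP[x _ ->]; rewrite -fg // memv_img ?memvf.
have irrf : irreducible_subspace rho (limg f).
  have [sig0 _ irrS] := irr; split=> //.
    move=> f0; case/eqP: S0; apply/matrixP => a b; rewrite mxE.
    have := memv_img f (memvf (delta_mx b 0)); rewrite f0 memv0 fE -colE.
    by move=> /eqP /matrixP /(_ a 0); rewrite !mxE.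
  move=> W' inv' W'f; have := irrS (f @^-1: W')%VS.
  have invp : invariant_subspace sigma (f @^-1: W')%VS.
    by move=> g x ug; rewrite -!memv_preim => xW; rewrite fg // inv'.
  move=> /(_ invp (subvf _)) [p0|pf]; [left | right].
    by rewrite -(lpreimK W'f) p0 limg0.
  by rewrite -(lpreimK W'f) pf.
have [k [V hV]] := complete_reducibility (perp_invariant invf).
have := decomposes_cons irrf (perp_cap _) hV; rewrite perp_add => hdec.
eexists k.+1, _; split; first exact: hdec.
by exists ord0; rewrite unlift_none; exists f.
Qed.

End CompleteReducibility.

(** * The two implications *)

Lemma sorted_tnth n (lam : n.-tuple int) : sorted >=%R lam ->
  forall i j : 'I_n, (i <= j)%N -> tnth lam j <= tnth lam i.
Proof.
move=> s i j ij; rewrite !(tnth_nth 0).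
have := sorted_leq_nth ge_trans ge_refl 0 s; apply; rewrite ?inE ?size_tuple //.
Qed.

Lemma irrep_highest_vector (R : realType) n (lam : n.-tuple int) d (rho : 'M[R[i]]_n -> 'M[R[i]]_d)
    (h : circle_diagonal rho) : is_irrep lam rho ->
  exists v, highest_vector (diff_rep h) (tnth lam) v.
Proof.
move=> [_ irr hw]; have [v [v0 wv rv]] := highest_weight_vector h hw.
by exists v; split=> // x; apply: irreducible_words.
Qed.

Lemma spectra_appears (R : realType) (n : nat) (lam mu nu : n.-tuple int)
    (hlam : sorted >=%R lam) (hmu : sorted >=%R mu) (hnu : sorted >=%R nu)
    (dlam dmu dnu : nat)
    (Vlam : 'M[R[i]]_n -> 'M[R[i]]_dlam) (Vmu : 'M[R[i]]_n -> 'M[R[i]]_dmu)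
    (Vnu : 'M[R[i]]_n -> 'M[R[i]]_dnu)
    (hVlam : is_irrep lam Vlam) (hVmu : is_irrep mu Vmu) (hVnu : is_irrep nu Vnu)
    (Hlam Hmu Hnu : 'M[R[i]]_n) :
  Hlam \is hermsymmx -> Hmu \is hermsymmx -> Hnu \is hermsymmx ->
  has_spectrum Hlam lam -> has_spectrum Hmu mu -> has_spectrum Hnu nu ->
  Hlam + Hmu = Hnu -> appears_in Vnu (tensor_rep Vlam Vmu).
Proof.
move=> s1 s2 s3 e1 e2 e3 e.
have [ur1 _ _] := hVlam; have [ur2 _ _] := hVmu; have [ur3 irr3 _] := hVnu.
have h1 := unitary_rep_circle_diagonal ur1; have h2 := unitary_rep_circle_diagonal ur2.
have h3 := unitary_rep_circle_diagonal ur3; have h12 := tensor_circle_diagonal h1 h2.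
have [v1 hv1] := irrep_highest_vector h1 hVlam; have [v2 hv2] := irrep_highest_vector h2 hVmu.
have [v3 hv3] := irrep_highest_vector h3 hVnu.
have [S S0 hS] := horn_intertwiner (sorted_tnth hlam) (sorted_tnth hmu) (sorted_tnth hnu)
  s1 s2 s3 e1 e2 e3 e (gl_rep_diff h1) (gl_rep_diff h2) (gl_rep_diff h3) hv1 hv2 hv3.
apply: (injective_intertwiner_appears _ irr3 S0) => [g ug|].
  by exists (g^t*); [rewrite trmxC_unitary | rewrite -(rho_adj h12)].
apply: (diff_rep_intertwine (h := h3) (h' := h12)) => i j.
by rewrite hS diff_rep_tensor.
Qed.

Lemma irreducible_orbit_ind (C : numClosedFieldType) n d (rho : 'M[C]_n -> 'M[C]_d)
    (h : circle_diagonal rho) (v : 'cV[C]_d) (P : 'cV[C]_d -> Prop) :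
  irreducible_rep rho -> v != 0 -> P 0 -> (forall a x y, P x -> P y -> P (a *: x + y)) ->
  (forall g, g \is unitarymx -> P (rho g *m v)) -> forall x, P x.
Proof.
move=> irr v0 P0 PD Pg x; have [_ rho1 rhoM _] := h.
(* The value 1 off the unitary matrices makes the adjoint rule hold for every index [g], as
   [words_projection] asks. *)
pose op (g : 'M[C]_n) := if g \is unitarymx then rho g else 1%:M.
have hadj g : (op g)^t* = op (g^t*).
  rewrite /op trmxC_unitary; case: ifP => ug; last exact: adjmx1.
  by rewrite (rho_adj h).
have [Q [Qv Qc Qw]] := words_projection v hadj.
have Q0 : Q != 0 by apply: contra v0 => /eqP Q0; rewrite -Qv Q0 mul0mx.
have Qg g : g \is unitarymx -> Q *m rho g = rho g *m Q.
  by move=> ug; have := Qc g; rewrite /op ug.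
have [y ->] := irreducible_surjective irr Q0 Qg x.
have [l ->] := Qw y; elim: l => [|p l IH]; first by rewrite big_nil.
rewrite big_cons; apply: PD => //.
suff [g ug ->] : exists2 g, g \is unitarymx & word_act op p.2 v = rho g *m v by exact: Pg.
elim: p.2 => [|g w [g' ug' IHw]] /=; first by exists 1%:M; rewrite ?unitary1 // rho1 mul1mx.
rewrite IHw /op; case: ifP => ug; last by exists g' => //; rewrite mul1mx.
by exists (g *m g'); rewrite ?mul_unitarymx // rhoM // mulmxA.
Qed.

Section Maximum.
Variables (R : realType) (n d1 d2 : nat).
Local Notation C := (R[i]).
Variables (rho1 : 'M[C]_n -> 'M[C]_d1) (rho2 : 'M[C]_n -> 'M[C]_d2).
Hypotheses (h1 : circle_diagonal rho1) (h2 : circle_diagonal rho2).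
Variables (L : 'rV[C]_(d1 * d2)) (v1 : 'cV[C]_d1) (v2 : 'cV[C]_d2).

Lemma orbit_modulus_max : exists g1 g2, [/\ g1 \is unitarymx, g2 \is unitarymx &
  forall k1 k2, k1 \is unitarymx -> k2 \is unitarymx ->
    `|(L *m tensv (rho1 k1 *m v1) (rho2 k2 *m v2)) 0 0| <=
    `|(L *m tensv (rho1 g1 *m v1) (rho2 g2 *m v2)) 0 0|].
Proof.
(* The two unitary matrices are stored side by side in one matrix, so that [compact_max] applies to
   the pair. *)
pose K (X : 'M[C]_(n, n + n)) := lsubmx X \is unitarymx /\ rsubmx X \is unitarymx.
pose th (X : 'M[C]_(n, n + n)) := L *m tensv (rho1 (lsubmx X) *m v1) (rho2 (rsubmx X) *m v2).
have [c1 c10 hc1] := rho_dist h1; have [c2 c20 hc2] := rho_dist h2.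
pose m1 (A : 'M[C]_d1) (y : 'cV[C]_d2) := L *m tensv (A *m v1) y.
pose b := l1norm L * (c1 * l1norm v1 * ((d2 * d2)%:R * l1norm v2) +
   ((d1 * d1)%:R * l1norm v1) * (c2 * l1norm v2)).
have l1tensv (x : 'cV[C]_d1) (y : 'cV[C]_d2) : l1norm (tensv x y) = l1norm x * l1norm y.
  rewrite /l1norm; under eq_bigr do rewrite big_ord1.
  under [X in X * _]eq_bigr do rewrite big_ord1.
  under [X in _ * X]eq_bigr do rewrite big_ord1.
  by rewrite mulr_sum; apply: eq_bigr => k _; rewrite mxE normrM.
have [X [ul ur] hX] : exists2 X, K X & forall Y, K Y -> `|th Y 0 0| <= `|th X 0 0|.
  apply: (compact_max (c := b)).
  - exists (row_mx 1%:M 1%:M); rewrite /K row_mxKl row_mxKr; split; exact: unitary1.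
  - move=> X a k [ul ur]; case: (split_ordP k) => j ->.
      by have := unitarymx_norm_le1 a j ul; rewrite mxE.
    by have := unitarymx_norm_le1 a j ur; rewrite mxE.
  - move=> X hX; split; apply: unitarymx_closed => e /hX[Y [ul ur] XY].
      by exists (lsubmx Y) => //; apply: le_trans XY; rewrite -linearB; apply: l1norm_lsubmx.
    by exists (rsubmx Y) => //; apply: le_trans XY; rewrite -linearB; apply: l1norm_rsubmx.
  - by move=> X; rewrite normr_real.
  move=> X Y [ulX urX] [ulY urY]; apply: le_trans (ler_dist_dist _ _) _.
  have -> : th X 0 0 - th Y 0 0 = (th X - th Y) 0 0 by rewrite !mxE.
  apply: le_trans (l1norm_ge _ 0 0) _.
  have eXY : th X - th Y =
      L *m (tensv ((rho1 (lsubmx X) - rho1 (lsubmx Y)) *m v1) (rho2 (rsubmx X) *m v2) +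
            tensv (rho1 (lsubmx Y) *m v1) ((rho2 (rsubmx X) - rho2 (rsubmx Y)) *m v2)).
    rewrite /th -mulmxBr; congr (_ *m _); apply/matrixP => k j.
    rewrite !mulmxBl !(mxE, mxE) /=.
    by rewrite mulrBl mulrBr subrKA.
  rewrite eXY; apply: le_trans (ler_l1normM _ _) _.
  rewrite -[leRHS]mulrA ler_wpM2l ?l1norm_ge0 //; apply: le_trans (ler_l1normD _ _) _.
  rewrite !l1tensv [leRHS]mulrDl; set D := l1norm (X - Y).
  have [ru1 _ _ _] := h1; have [ru2 _ _ _] := h2.
  have hl : l1norm (lsubmx X - lsubmx Y) <= D by rewrite -linearB; apply: l1norm_lsubmx.
  have hr : l1norm (rsubmx X - rsubmx Y) <= D by rewrite -linearB; apply: l1norm_rsubmx.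
  apply: lerD.
    rewrite -[leRHS]mulrA [_ * D]mulrC mulrA; apply: ler_pM; rewrite ?l1norm_ge0 //.
      apply: le_trans (ler_l1normM _ _) _; rewrite mulrAC ler_wpM2r ?l1norm_ge0 //.
      by apply: le_trans (hc1 _ _ ulX ulY) _; rewrite ler_wpM2l.
    exact: l1norm_unitarymxl (ru2 _ urX).
  rewrite -[leRHS]mulrA; apply: ler_pM; rewrite ?l1norm_ge0 //.
    exact: l1norm_unitarymxl (ru1 _ ulY).
  apply: le_trans (ler_l1normM _ _) _; rewrite mulrAC ler_wpM2r ?l1norm_ge0 //.
  by apply: le_trans (hc2 _ _ urX urY) _; rewrite ler_wpM2l.
exists (lsubmx X), (rsubmx X); split=> // k1 k2 uk1 uk2.
have := hX (row_mx k1 k2); rewrite /th /K row_mxKl row_mxKr; exact.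
Qed.

End Maximum.

Lemma unitary_conj_hermitian (C : numClosedFieldType) n (g : 'M[C]_n) (lam : n.-tuple int) :
  g \is unitarymx -> let H := g *m diag_mx (\row_j (tnth lam j)%:~R) *m g^t* in
  H \is hermsymmx /\ has_spectrum H lam.
Proof.
move=> ug H; have ug' : g^t* \is unitarymx by rewrite trmxC_unitary.
have eH : H = circle_gen (g^t*) (tnth lam) by rewrite /circle_gen trmxCK.
split; first by apply/is_hermitianmxP; rewrite expr0 scale1r eH circle_gen_adj.
rewrite /has_spectrum eH /circle_gen char_poly_unitary_conj // char_poly_diag.
by apply: eq_bigr => i _; rewrite mxE.
Qed.

Lemma appears_spectra (R : realType) (n : nat) (lam mu nu : n.-tuple int)
    (dlam dmu dnu : nat)
    (Vlam : 'M[R[i]]_n -> 'M[R[i]]_dlam) (Vmu : 'M[R[i]]_n -> 'M[R[i]]_dmu)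
    (Vnu : 'M[R[i]]_n -> 'M[R[i]]_dnu)
    (hVlam : is_irrep lam Vlam) (hVmu : is_irrep mu Vmu) (hVnu : is_irrep nu Vnu) :
  appears_in Vnu (tensor_rep Vlam Vmu) ->
  exists Hlam Hmu Hnu : 'M[R[i]]_n,
     [/\ Hlam \is hermsymmx, Hmu \is hermsymmx & Hnu \is hermsymmx] /\
     [/\ has_spectrum Hlam lam, has_spectrum Hmu mu & has_spectrum Hnu nu] /\
     Hlam + Hmu = Hnu.
Proof.
move=> [k [W [_ [i0 [f [ker0 _ hf]]]]]].
have [ur1 irr1 _] := hVlam; have [ur2 irr2 _] := hVmu; have [ur3 _ _] := hVnu.
have h1 := unitary_rep_circle_diagonal ur1; have h2 := unitary_rep_circle_diagonal ur2.
have h3 := unitary_rep_circle_diagonal ur3; have h12 := tensor_circle_diagonal h1 h2.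
have [v1 [v10 wv1 rv1 _]] := irrep_highest_vector h1 hVlam.
have [v2 [v20 wv2 rv2 _]] := irrep_highest_vector h2 hVmu.
have [v3 [v30 wv3 rv3 _]] := irrep_highest_vector h3 hVnu.
pose S : 'M[R[i]]_(dlam * dmu, dnu) := \matrix_(a, b) f (delta_mx b 0) a 0.
have fE v : f v = S *m v.
  rewrite {1}[v]matrix_sum_delta linear_sum; apply/matrixP => a b; rewrite ord1 summxE mxE.
  by apply: eq_bigr => j _; rewrite big_ord1 linearZ !mxE mulrC.
have hS g : g \is unitarymx -> S *m Vnu g = (Vlam g *t Vmu g) *m S.
  by move=> ug; apply: eq_mulmx_cV => v; rewrite -!mulmxA -!fE hf.
have dS := diff_rep_of_intertwine h3 h12 hS.
pose z := S *m v3.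
have z0 : z != 0.
  apply: contra v30 => /eqP z0; rewrite -memv0 -ker0 memv_ker fE -/z z0 //.
have wz a : diff_rep h12 (delta_mx a a) *m z = (tnth nu a)%:~R *: z.
  by rewrite /z mulmxA -dS -mulmxA wv3 -scalemxAr.
have rz (a b : 'I_n) : (a < b)%N -> diff_rep h12 (delta_mx a b) *m z = 0.
  by move=> ab; rewrite /z mulmxA -dS -mulmxA rv3 // mulmx0.
have [g1 [g2 [u1 u2 hmax]]] := orbit_modulus_max h1 h2 (z^t*) v1 v2.
set x := tensv (Vlam g1 *m v1) (Vmu g2 *m v2) in hmax.
have [_ _ M1 _] := h1; have [_ _ M2 _] := h2.
have max1 g : g \is unitarymx ->
    `|(z^t* *m (Vlam g *t 1%:M) *m x) 0 0| <= `|(z^t* *m x) 0 0|.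
  move=> ug; have := hmax (g *m g1) g2; rewrite mul_unitarymx // => /(_ isT u2).
  by rewrite -[X in _ -> X <= _]/(`|(z^t* *m (Vlam g *t 1%:M) *m x) 0 0|) -mulmxA tensmx_tensv mul1mx mulmxA M1.
have max2 g : g \is unitarymx ->
    `|(z^t* *m (1%:M *t Vmu g) *m x) 0 0| <= `|(z^t* *m x) 0 0|.
  move=> ug; have := hmax g1 (g *m g2) u1; rewrite mul_unitarymx // => /(_ isT).
  by rewrite -[X in _ -> X <= _]/(`|(z^t* *m (1%:M *t Vmu g) *m x) 0 0|) -mulmxA tensmx_tensv mul1mx mulmxA M2.
(* Otherwise [z] would be orthogonal to all products of orbit vectors. These span the tensor
   product, as each orbit spans its irreducible factor, and [z] would be 0. *)
have nz : (z^t* *m x) 0 0 != 0.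
  apply: contra z0 => /eqP x0.
  have hz k1 k2 : k1 \is unitarymx -> k2 \is unitarymx ->
      z^t* *m tensv (Vlam k1 *m v1) (Vmu k2 *m v2) = 0.
    move=> uk1 uk2; apply/matrixP => a b; rewrite !ord1 [RHS]mxE; apply/eqP.
    by have := hmax _ _ uk1 uk2; rewrite x0 normr0 normr_le0.
  have hz1 k2 : k2 \is unitarymx -> forall y, z^t* *m tensv y (Vmu k2 *m v2) = 0.
    move=> uk2; apply: (irreducible_orbit_ind h1 irr1 v10) => [|a y y' hy hy'|g ug].
    - by rewrite tensv0l mulmx0.
    - by rewrite tensv_linl mulmxDr -scalemxAr hy hy' scaler0 addr0.
    - exact: hz.
  have hz2 y : forall y', z^t* *m tensv y y' = 0.
    apply: (irreducible_orbit_ind h2 irr2 v20) => [|a y1 y2 hy1 hy2|g ug].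
    - by rewrite tensv0r mulmx0.
    - by rewrite tensv_linr mulmxDr -scalemxAr hy1 hy2 scaler0 addr0.
    - exact: hz1.
  apply/eqP/cdot_eq0; rewrite /cdot [X in _ *m X]tensv_span mulmx_sumr big1 ?mxE // => a _.
  by rewrite -scalemxAr hz2 scaler0.
have crit := critical_sum wv1 rv1 wv2 rv2 wz rz u1 u2 max1 max2 nz.
have [s1 e1] := unitary_conj_hermitian lam u1; have [s2 e2] := unitary_conj_hermitian mu u2.
have [s3 e3] := unitary_conj_hermitian nu (unitary1 R[i] n).
exists (g1 *m diag_mx (\row_j (tnth lam j)%:~R) *m g1^t*),
  (g2 *m diag_mx (\row_j (tnth mu j)%:~R) *m g2^t*), (diag_mx (\row_j (tnth nu j)%:~R)).
by move: s3 e3; rewrite mul1mx adjmx1 mulmx1.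
Qed.

Theorem mainTheorem2 (R : realType) (n : nat) (hn : (1 <= n)%N)
    (lam mu nu : n.-tuple int)
    (hlam : sorted >=%R lam) (hmu : sorted >=%R mu) (hnu : sorted >=%R nu)
    (dlam dmu dnu : nat)
    (Vlam : 'M[R[i]]_n -> 'M[R[i]]_dlam)
    (Vmu : 'M[R[i]]_n -> 'M[R[i]]_dmu)
    (Vnu : 'M[R[i]]_n -> 'M[R[i]]_dnu)
    (hVlam : is_irrep lam Vlam)
    (hVmu : is_irrep mu Vmu)
    (hVnu : is_irrep nu Vnu) :
  (exists Hlam Hmu Hnu : 'M[R[i]]_n,
     [/\ Hlam \is hermsymmx, Hmu \is hermsymmx & Hnu \is hermsymmx] /\
     [/\ has_spectrum Hlam lam, has_spectrum Hmu mu & has_spectrum Hnu nu] /\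
     Hlam + Hmu = Hnu)
  <-> appears_in Vnu (tensor_rep Vlam Vmu).
Proof.
split=> [[Hlam [Hmu [Hnu [[s1 s2 s3] [[e1 e2 e3] e]]]]]|].
  exact: (spectra_appears hlam hmu hnu hVlam hVmu hVnu s1 s2 s3 e1 e2 e3 e).
exact: appears_spectra.
Qed.
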